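(* Let $K$ be a field of characteristic zero and let $R$ be an integral domain which is a regular ring and the localisation of a finitely generated $K$-algebra, and which has a maximal ideal $\mathfrak m$ such that $R/\mathfrak m$ is a finite extension of $K$. If $R$ is smooth over $K$, then the category $\mathbf{ICon}_{\mathbf{int}}(R/K)$ of finitely generated $R$-modules with integrable iterative connection is equivalent to the category of (finitely generated) stratified modules over $R$.
   Context: Higher derivations. $\mathrm{HD}_K(R)$ is the set of $K$-algebra homomorphisms $\psi:R\to R[[T]]$, $\psi(r)=\sum_k\psi^{(k)}(r)T^k$, with $\psi^{(0)}=\mathrm{id}$. Put $\psi[[T]](\sum a_iT^i)=\sum\psi(a_i)T^i$ and $\psi_1\psi_2:=\psi_1[[T]]\circ\psi_2$. Algebra of higher differentials. $\hat\Omega=\hat\Omega_{R/K}=\prod_k\hat\Omega_k$ is the completion by degree of the graded commutative $R$-algebra generated by symbols $d^{(k)}r$ ($k\ge1$, $r\in R$), of degree $k$, modulo $d^{(k)}(r+s)=d^{(k)}r+d^{(k)}s$, $d^{(k)}a=0$ for $a\in K$, $d^{(k)}(rs)=\sum_{i=0}^kd^{(i)}r\,d^{(k-i)}s$ (with $d^{(0)}r:=r$). Set $d_R(r)=\sum_kd^{(k)}r$, and let $d_{\hat\Omega}$ be the continuous $K$-algebra automorphism of $\hat\Omega$ with $d_{\hat\Omega}(d^{(i)}r)=\sum_{j\ge0}\binom{i+j}{j}d^{(i+j)}r$. For $\psi\in\mathrm{HD}_K(R)$, $\tilde\psi:\hat\Omega\to R[[T]]$ is the continuous $R$-algebra homomorphism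 with $d^{(k)}r\mapsto\psi^{(k)}(r)T^k$. Connections. $\hat\Omega\otimes_RM$ denotes $\prod_k\hat\Omega_k\otimes_RM$. A higher connection on a finitely generated $R$-module $M$ is an additive map $\nabla=\sum_k\nabla^{(k)}:M\to\hat\Omega\otimes_RM$ with $\nabla(rm)=d_R(r)\nabla(m)$ and $\nabla^{(0)}=\mathrm{id}_M$. Put ${}_{\hat\Omega}\nabla(\omega\otimes x)=d_{\hat\Omega}(\omega)\nabla(x)$, with ${}_{\hat\Omega}\nabla^{(i)}$ the part raising degrees by $i$. $\nabla$ is iterative if ${}_{\hat\Omega}\nabla^{(i)}\circ{}_{\hat\Omega}\nabla^{(j)}=\binom{i+j}{i}{}_{\hat\Omega}\nabla^{(i+j)}$ for all $i,j\ge0$. Put $\nabla_\psi=(\tilde\psi\otimes\mathrm{id}_M)\circ\nabla:M\to M[[T]]$ and $\nabla_{\psi_1}\nabla_{\psi_2}:=\nabla_{\psi_1}[[T]]\circ\nabla_{\psi_2}$, where $\nabla_\psi[[T]](\sum m_iT^i)=\sum\nabla_\psi(m_i)T^i$. An iterative connection is integrable if $\nabla_{\psi_1\psi_2}=\nabla_{\psi_1}\nabla_{\psi_2}$ for all $\psi_1,\psi_2\in\mathrm{HD}_K(R)$. Morphisms $(M_1,\nabla_1)\to(M_2,\nabla_2)$ are the $R$-linear maps $f$ with $\nabla_2\circ f=(\mathrm{id}_{\hat\Omega}\otimes f)\circ\nabla_1$. Stratifications (Berthelot–Ogus, Def. 2.10). Let $I=\ker(R\otimes_KR\to R)$ and $P^n=(R\otimes_KR)/I^{n+1}$;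 $P^n\otimes_RM$ is formed with the right and $M\otimes_RP^n$ with the left $R$-structure of $P^n$. A stratification on an $R$-module $M$ is a family of $P^n$-linear isomorphisms $\varepsilon_n:P^n\otimes_RM\to M\otimes_RP^n$ ($n\ge0$), compatible with the projections $P^{n+1}\to P^n$, with $\varepsilon_0=\mathrm{id}$, and satisfying the cocycle condition $p_{12}^*(\varepsilon_n)\circ p_{23}^*(\varepsilon_n)=p_{13}^*(\varepsilon_n)$ over $P^n(2)=(R\otimes_KR\otimes_KR)/J^{n+1}$, where $J=\ker(R\otimes_KR\otimes_KR\to R)$ and $p_{ij}:P^n\to P^n(2)$ are the maps induced by the inclusions of the $i$-th and $j$-th factors. Morphisms of stratified modules are $R$-linear maps commuting with all $\varepsilon_n$. *)

(* Defs.v *)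
From HB Require Import structures.
From mathcomp Require Import all_boot all_algebra.
From mathcomp Require Import boolp classical_sets.

Set Implicit Arguments.
Unset Strict Implicit.
Unset Printing Implicit Defensive.

Import GRing.Theory.
Local Open Scope quotient_scope.
Local Open Scope classical_set_scope.
Local Open Scope ring_scope.

(* Extension of scalars: for f : A -> B and an A-module M, the B-module       *)
(* B (x)_A M, where B is an A-module through f.                               *)

Section TensDef.
Variables (A B : comPzRingType) (f : {rmorphism A -> B}) (M : lmodType A).

Inductive tens_term :=
| TPure of B & M
| TZero
| TAdd of tens_term & tens_term
| TOpp of tens_term.

HB.instance Definition _ := gen_eqMixin tens_term.
HB.instance Definition _ := gen_choiceMixin tens_term.

Inductive tens_rel : tens_term -> tens_term -> Prop :=
| tr_refl x : tens_rel x x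
| tr_sym x y : tens_rel x y -> tens_rel y x
| tr_trans x y z : tens_rel x y -> tens_rel y z -> tens_rel x z
| tr_congD x x' y y' :
    tens_rel x x' -> tens_rel y y' -> tens_rel (TAdd x y) (TAdd x' y')
| tr_congN x x' : tens_rel x x' -> tens_rel (TOpp x) (TOpp x')
| tr_addA x y z : tens_rel (TAdd x (TAdd y z)) (TAdd (TAdd x y) z)
| tr_addC x y : tens_rel (TAdd x y) (TAdd y x)
| tr_add0 x : tens_rel (TAdd TZero x) x
| tr_addN x : tens_rel (TAdd (TOpp x) x) TZero
| tr_pureDl b b' m :
    tens_rel (TPure (b + b') m) (TAdd (TPure b m) (TPure b' m))
| tr_pureDr b m m' :
    tens_rel (TPure b (m + m')) (TAdd (TPure b m) (TPure b m'))
| tr_pureZ b a m : tens_rel (TPure (b * f a) m) (TPure b (a *: m)).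

Definition tens_relb : rel tens_term := fun x y => `[< tens_rel x y >].

Fact tens_relb_refl : reflexive tens_relb.
Proof. by move=> x; apply/asboolP; apply: tr_refl. Qed.
Fact tens_relb_sym : symmetric tens_relb.
Proof. by move=> x y; apply/asbool_equiv_eq; split; apply: tr_sym. Qed.
Fact tens_relb_trans : transitive tens_relb.
Proof.
by move=> y x z /asboolP xy /asboolP yz; apply/asboolP; apply: tr_trans xy yz.
Qed.
Canonical tens_equiv :=
  EquivRel tens_relb tens_relb_refl tens_relb_sym tens_relb_trans.

Definition tens := {eq_quot tens_equiv}.
HB.instance Definition _ : EqQuotient _ tens_equiv tens := EqQuotient.on tens.
HB.instance Definition _ := Choice.on tens.

Lemma tens_piP x y : tens_rel x y <-> \pi_tens x = \pi_tens y.
Proof. by split=> [xy|/eqmodP/asboolP//]; apply/eqmodP/asboolP. Qed.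

Lemma tens_repr x : tens_rel (repr (\pi_tens x)) x.
Proof. by apply/tens_piP; rewrite reprK. Qed.

Definition tens_zero : tens := \pi_tens TZero.
Definition tens_add (x y : tens) : tens := \pi_tens (TAdd (repr x) (repr y)).
Definition tens_opp (x : tens) : tens := \pi_tens (TOpp (repr x)).

Lemma pi_tens_add x y :
  \pi_tens (TAdd x y) = tens_add (\pi_tens x) (\pi_tens y).
Proof.
by apply/tens_piP; apply: tr_congD; apply: tr_sym; apply: tens_repr.
Qed.
Lemma pi_tens_opp x : \pi_tens (TOpp x) = tens_opp (\pi_tens x).
Proof. by apply/tens_piP; apply: tr_congN; apply: tr_sym; apply: tens_repr. Qed.

Fact tens_addA : associative tens_add.
Proof.
elim/quotW=> x; elim/quotW=> y; elim/quotW=> z.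
rewrite -(pi_tens_add y z) -(pi_tens_add x y) -(pi_tens_add x) -(pi_tens_add _ z).
by apply/tens_piP; apply: tr_addA.
Qed.
Fact tens_addC : commutative tens_add.
Proof.
elim/quotW=> x; elim/quotW=> y.
by rewrite -(pi_tens_add x y) -(pi_tens_add y x); apply/tens_piP/tr_addC.
Qed.
Fact tens_add0 : left_id tens_zero tens_add.
Proof.
elim/quotW=> x.
by rewrite -(pi_tens_add TZero x); apply/tens_piP/tr_add0.
Qed.
Fact tens_addN : left_inverse tens_zero tens_opp tens_add.
Proof.
elim/quotW=> x.
by rewrite -pi_tens_opp -(pi_tens_add _ x); apply/tens_piP/tr_addN.
Qed.

HB.instance Definition _ :=
  GRing.isZmodule.Build tens tens_addA tens_addC tens_add0 tens_addN.

Definition pure (b : B) (m : M) : tens := \pi_tens (TPure b m).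

Lemma pureDl b b' m : pure (b + b') m = pure b m + pure b' m.
Proof. by rewrite /pure /GRing.add /= -pi_tens_add; apply/tens_piP/tr_pureDl. Qed.
Lemma pureDr b m m' : pure b (m + m') = pure b m + pure b m'.
Proof. by rewrite /pure /GRing.add /= -pi_tens_add; apply/tens_piP/tr_pureDr. Qed.
Lemma pureZ b a m : pure (b * f a) m = pure b (a *: m).
Proof. by apply/tens_piP/tr_pureZ. Qed.

Lemma tens_ind (P : tens -> Prop) :
  (forall b m, P (pure b m)) -> P 0 -> (forall x y, P x -> P y -> P (x + y)) ->
  (forall x, P x -> P (- x)) -> forall x, P x.
Proof.
move=> Pp P0 PD PN; elim/quotW; elim=> [b m||x Px y Py|x Px].
- exact: Pp.
- exact: P0.
- by rewrite pi_tens_add; apply: PD.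
- by rewrite pi_tens_opp; apply: PN.
Qed.

Section Lift.
Variables (V : zmodType) (phi : B -> M -> V).

Fixpoint tens_eval (t : tens_term) : V :=
  match t with
  | TPure b m => phi b m
  | TZero => 0
  | TAdd x y => tens_eval x + tens_eval y
  | TOpp x => - tens_eval x
  end.

Definition balanced :=
  [/\ forall b b' m, phi (b + b') m = phi b m + phi b' m,
      forall b m m', phi b (m + m') = phi b m + phi b m'
    & forall b a m, phi (b * f a) m = phi b (a *: m)].

(* The additive map with value phi b m at the pure tensor of b and m; it is   *)
(* meaningful when phi is balanced, see tens_liftE.                           *)
Definition tens_lift (x : tens) : V := tens_eval (repr x).

Hypothesis bal : balanced.

Lemma tens_lift_pi t : tens_lift (\pi t) = tens_eval t.
Proof.
have [bDl bDr bZ] := bal.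
have E x y : tens_rel x y -> tens_eval x = tens_eval y.
  elim=> //= {x y} [x y z _ -> _ ->|x x' y y' _ -> _ ->|x x' _ ->|x y z|x y|x|x] //.
  - by rewrite addrA.
  - by rewrite addrC.
  - by rewrite add0r.
  - by rewrite addNr.
by apply: E; apply: tens_repr.
Qed.

Lemma tens_liftE b m : tens_lift (pure b m) = phi b m.
Proof. by rewrite tens_lift_pi. Qed.
Lemma tens_liftD x y : tens_lift (x + y) = tens_lift x + tens_lift y.
Proof.
elim/quotW: x => x; elim/quotW: y => y.
by rewrite /GRing.add /= -pi_tens_add !tens_lift_pi.
Qed.
Lemma tens_lift0 : tens_lift 0 = 0.
Proof. exact: (tens_lift_pi TZero). Qed.
Lemma tens_liftN x : tens_lift (- x) = - tens_lift x.
Proof.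
by apply: (addrI (tens_lift x)); rewrite -tens_liftD !subrr tens_lift0.
Qed.
End Lift.

Lemma tens_ext (V : zmodType) (g h : tens -> V) :
  {morph g : x y / x + y} -> {morph h : x y / x + y} ->
  (forall b m, g (pure b m) = h (pure b m)) -> g =1 h.
Proof.
have Z (k : tens -> V) : {morph k : x y / x + y} -> k 0 = 0.
  by move=> kD; apply: (addrI (k 0)); rewrite -kD !addr0.
have N (k : tens -> V) : {morph k : x y / x + y} -> {morph k : x / - x}.
  by move=> kD x; apply: (addrI (k x)); rewrite -kD !subrr Z.
move=> gD hD gh; elim/tens_ind => [|| x y gx gy|x gx] //.
- by rewrite !Z.
- by rewrite gD hD gx gy.
- by rewrite !N // gx.
Qed.

Definition tens_scale (c : B) : tens -> tens :=
  tens_lift (fun b m => pure (c * b) m).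

Fact tens_scale_bal c : balanced (fun b m => pure (c * b) m).
Proof.
split=> [b b' m|b m m'|b a m]; first by rewrite mulrDr pureDl.
  by rewrite pureDr.
by rewrite mulrA pureZ.
Qed.

Fact tens_scaleA c d x : tens_scale c (tens_scale d x) = tens_scale (c * d) x.
Proof.
move: x; apply: tens_ext => [x y|x y|b m].
- by rewrite /tens_scale !tens_liftD //; apply: tens_scale_bal.
- by rewrite /tens_scale !tens_liftD //; apply: tens_scale_bal.
- by rewrite /tens_scale !tens_liftE ?mulrA //; apply: tens_scale_bal.
Qed.
Fact tens_scale1 : left_id 1 tens_scale.
Proof.
apply: tens_ext => // [x y|b m].
- by rewrite /tens_scale !tens_liftD //; apply: tens_scale_bal.
- by rewrite /tens_scale !tens_liftE ?mul1r //; apply: tens_scale_bal.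
Qed.
Fact tens_scaleDr : right_distributive tens_scale +%R.
Proof.
by move=> c x y; rewrite /tens_scale !tens_liftD //; apply: tens_scale_bal.
Qed.
Fact tens_scaleDl x : {morph tens_scale^~ x : c d / c + d}.
Proof.
move=> c d; move: x; apply: tens_ext => [x y|x y|b m].
- exact: tens_scaleDr.
- by rewrite /= !tens_scaleDr addrACA.
- by rewrite /tens_scale !tens_liftE ?mulrDl ?pureDl //; apply: tens_scale_bal.
Qed.

HB.instance Definition _ := GRing.Zmodule_isLmodule.Build B tens
  tens_scaleA tens_scale1 tens_scaleDr tens_scaleDl.

Lemma scale_pure c b m : c *: pure b m = pure (c * b) m.
Proof. by rewrite /GRing.scale /= /tens_scale tens_liftE //; apply: tens_scale_bal. Qed.

End TensDef.
Arguments tens {A B} f M.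
Arguments pure {A B f M} b m.
Arguments tens_lift {A B f M V} phi x.

Definition tens_map (A B : comPzRingType) (f : {rmorphism A -> B})
    (M N : lmodType A) (u : M -> N) : tens f M -> tens f N :=
  tens_lift (fun b m => pure b (u m)).

Definition tens_base (A B B' : comPzRingType) (f : {rmorphism A -> B})
    (f' : {rmorphism A -> B'}) (M : lmodType A) (h : B -> B') :
    tens f M -> tens f' M :=
  tens_lift (fun b m => pure (h b) m).
Arguments tens_map {A B} f {M N} u x.
Arguments tens_base {A B B' f f' M} h x.

Definition restr (A C : comPzRingType) (g : {rmorphism A -> C}) : Type := C.

Section Restr.
Variables (A C : comPzRingType) (g : {rmorphism A -> C}).
Local Notation restr := (restr g).
HB.instance Definition _ := GRing.Zmodule.copy restr C.
Definition restr_scale (a : A) (c : restr) : restr := (g a * (c : C))%R.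
Fact restr_scaleA a b v : restr_scale a (restr_scale b v) = restr_scale (a * b) v.
Proof. by rewrite /restr_scale rmorphM mulrA. Qed.
Fact restr_scale1 : left_id 1 restr_scale.
Proof. by move=> v; rewrite /restr_scale rmorph1 mul1r. Qed.
Fact restr_scaleDr : right_distributive restr_scale +%R.
Proof. by move=> a u v; rewrite /restr_scale mulrDr. Qed.
Fact restr_scaleDl v : {morph restr_scale^~ v : a b / a + b}.
Proof. by move=> a b; rewrite /restr_scale rmorphD mulrDl. Qed.
HB.instance Definition _ := GRing.Zmodule_isLmodule.Build A restr
  restr_scaleA restr_scale1 restr_scaleDr restr_scaleDl.
End Restr.

Section TensRing.
Variables (A B C : comPzRingType).
Variables (f : {rmorphism A -> B}) (g : {rmorphism A -> C}).

Definition tensr : Type := tens f (restr g).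
HB.instance Definition _ := GRing.Zmodule.copy tensr (tens f (restr g)).

Definition tpure (b : B) (c : C) : tensr := pure b (c : restr g).

Definition tensr_mul (x y : tensr) : tensr :=
  tens_lift (fun b (c : restr g) =>
    tens_lift (fun b' (c' : restr g) => tpure (b * b') ((c : C) * (c' : C))) y) x.

Lemma tpureDl b b' c : tpure (b + b') c = tpure b c + tpure b' c.
Proof. exact: pureDl. Qed.
Lemma tpureDr b c c' : tpure b (c + c') = tpure b c + tpure b c'.
Proof. exact: pureDr. Qed.
Lemma tpureZ b a c : tpure (b * f a) c = tpure b (g a * c).
Proof. exact: pureZ. Qed.

Let inner b (c : restr g) (y : tensr) : tensr :=
  tens_lift (fun b' (c' : restr g) => tpure (b * b') ((c : C) * (c' : C))) y.

Let inner_bal b (c : restr g) : balanced f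
  (fun b' (c' : restr g) => tpure (b * b') ((c : C) * (c' : C))).
Proof.
split=> [b1 b2 c'|b1 c1 c2|b1 a c1].
- by rewrite mulrDr tpureDl.
- by rewrite mulrDr tpureDr.
- by rewrite mulrA tpureZ mulrCA.
Qed.

Let innerD b c : {morph inner b c : x y / x + y}.
Proof. by move=> x y; rewrite /inner tens_liftD //; apply: inner_bal. Qed.

Let outer_bal y : balanced f (fun b c => inner b c y).
Proof.
split=> [b b' c|b c c'|b a c]; move: y; apply: tens_ext => [y z|y z|b1 c1].
- exact: innerD.
- by rewrite !innerD addrACA.
- by rewrite /inner !tens_liftE ?mulrDl ?tpureDl //; apply: inner_bal.
- exact: innerD.
- by rewrite !innerD addrACA.
- rewrite /inner !tens_liftE; try exact: inner_bal.
  by rewrite -tpureDr; congr tpure; apply: mulrDl.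
- exact: innerD.
- exact: innerD.
- rewrite /inner !tens_liftE; try exact: inner_bal.
  by rewrite mulrAC tpureZ mulrA.
Qed.

Fact tensr_mulDl : left_distributive tensr_mul +%R.
Proof. by move=> x y z; apply: tens_liftD; apply: outer_bal. Qed.

Fact tpureM b c b' c' :
  tensr_mul (tpure b c) (tpure b' c') = tpure (b * b') (c * c').
Proof.
by rewrite /tensr_mul tens_liftE; [apply/tens_liftE/inner_bal|apply: outer_bal].
Qed.

Let mulDr : right_distributive tensr_mul +%R.
Proof.
move=> x y z; move: x; apply: tens_ext => [u v|u v|b c].
- exact: tensr_mulDl.
- by rewrite !tensr_mulDl addrACA.
- rewrite /tensr_mul !tens_liftE; first exact: innerD.
  all: exact: outer_bal.
Qed.

Fact tensr_mulC : commutative tensr_mul.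
Proof.
move=> x y; move: x; apply: tens_ext => [u v|u v|b c].
- exact: tensr_mulDl.
- exact: mulDr.
move: y; apply: tens_ext => [u v|u v|b' c'].
- exact: mulDr.
- exact: tensr_mulDl.
by rewrite !tpureM mulrC; congr tpure; apply: mulrC.
Qed.

Fact tensr_mulA : associative tensr_mul.
Proof.
move=> x y z; move: x; apply: tens_ext => [u v|u v|b c].
- exact: tensr_mulDl.
- by rewrite !tensr_mulDl.
move: y; apply: tens_ext => [u v|u v|b' c'].
- by rewrite tensr_mulDl mulDr.
- by rewrite mulDr tensr_mulDl.
move: z; apply: tens_ext => [u v|u v|b2 c2].
- by rewrite !mulDr.
- by rewrite !mulDr.
by rewrite !tpureM mulrA; congr tpure; apply: mulrA.
Qed.

Fact tensr_mul1 : left_id (tpure 1 1) tensr_mul.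
Proof.
apply: tens_ext => [u v|//|b c]; first exact: mulDr.
by rewrite tpureM mul1r; congr tpure; apply: mul1r.
Qed.

HB.instance Definition _ := GRing.Zmodule_isComPzRing.Build tensr
  tensr_mulA tensr_mulC tensr_mul1 tensr_mulDl.

Definition tinl (b : B) : tensr := tpure b 1.
Definition tinr (c : C) : tensr := tpure 1 c.

Fact tinl_nmod : nmod_morphism tinl.
Proof.
split=> [|x y]; last exact: tpureDl.
by apply: (addrI (tinl 0)); rewrite -tpureDl !addr0.
Qed.
Fact tinl_monoid : monoid_morphism tinl.
Proof. by split=> // x y; rewrite /GRing.mul /= tpureM mul1r. Qed.
HB.instance Definition _ := GRing.isNmodMorphism.Build B tensr tinl tinl_nmod.
HB.instance Definition _ := GRing.isMonoidMorphism.Build B tensr tinl tinl_monoid.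

Fact tinr_nmod : nmod_morphism tinr.
Proof.
split=> [|x y]; last exact: tpureDr.
by apply: (addrI (tinr 0)); rewrite -tpureDr !addr0.
Qed.
Fact tinr_monoid : monoid_morphism tinr.
Proof. by split=> // x y; rewrite /GRing.mul /= tpureM mul1r. Qed.
HB.instance Definition _ := GRing.isNmodMorphism.Build C tensr tinr tinr_nmod.
HB.instance Definition _ := GRing.isMonoidMorphism.Build C tensr tinr tinr_monoid.

Section Desc.
Variables (D : comPzRingType) (u : {rmorphism B -> D}) (v : {rmorphism C -> D}).
Hypothesis uv : forall a, u (f a) = v (g a).

Definition tdesc (_ : forall a, u (f a) = v (g a)) (x : tensr) : D :=
  tens_lift (fun b (c : restr g) => u b * v c) x.

Let bal : balanced f (fun b (c : restr g) => u b * v c).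
Proof.
split=> [b b' c|b c c'|b a c]; rewrite ?rmorphD ?mulrDl ?mulrDr //.
by rewrite /GRing.scale /= /restr_scale !rmorphM /= uv mulrA.
Qed.

Lemma tdescE b c : tdesc uv (tpure b c) = u b * v c.
Proof. exact: tens_liftE. Qed.

Fact tdesc_nmod : nmod_morphism (tdesc uv).
Proof. by split=> [|x y]; [apply: tens_lift0|apply: tens_liftD]. Qed.
HB.instance Definition _ :=
  GRing.isNmodMorphism.Build tensr D (tdesc uv) tdesc_nmod.

Fact tdesc_monoid : monoid_morphism (tdesc uv).
Proof.
split=> [|x y]; first by rewrite [LHS]tdescE !rmorph1 mulr1.
move: x; apply: tens_ext => [x z|x z|b c].
- by rewrite mulrDl raddfD.
- by rewrite raddfD mulrDl.
move: y; apply: tens_ext => [x z|x z|b' c'].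
- by rewrite mulrDr raddfD.
- by rewrite raddfD mulrDr.
rewrite -/(tpure b c) -/(tpure b' c') !tdescE {1}/GRing.mul /= tpureM tdescE.
by rewrite !rmorphM mulrACA.
Qed.
HB.instance Definition _ :=
  GRing.isMonoidMorphism.Build tensr D (tdesc uv) tdesc_monoid.
End Desc.
End TensRing.
Arguments tpure {A B C f g} b c.

Section Ideals.
Variable A : comPzRingType.

Inductive ideal_gen (G : set A) : set A :=
| ig_in x : G x -> ideal_gen G x
| ig_0 : ideal_gen G 0
| ig_D x y : ideal_gen G x -> ideal_gen G y -> ideal_gen G (x + y)
| ig_M a x : ideal_gen G x -> ideal_gen G (a * x).

Fixpoint ideal_pow (I : set A) (n : nat) : set A :=
  if n is n'.+1 then
    ideal_gen [set z | exists x y, [/\ I x, ideal_pow I n' y & z = x * y]]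
  else setT.

Lemma ideal_gen_sub (G : set A) (I : set A) :
  G `<=` I -> I 0 -> (forall x y, I x -> I y -> I (x + y)) ->
  (forall a x, I x -> I (a * x)) -> ideal_gen G `<=` I.
Proof.
move=> GI I0 ID IM x; elim=> {x} [x /GI||x y _ Ix _ Iy|a x _ Ix] //; first exact: ID.
exact: IM.
Qed.

Lemma ideal_pow_le (I : set A) n : ideal_pow I n.+1 `<=` ideal_pow I n.
Proof.
elim: n => // n IH; apply: ideal_gen_sub.
- by move=> z [x [y [Ix Iy ->]]]; apply: ig_in; exists x, y; split=> //; apply: IH.
- exact: ig_0.
- by move=> x y; apply: ig_D.
- by move=> a x; apply: ig_M.
Qed.
End Ideals.

Lemma ideal_pow_map (A B : comPzRingType) (h : {rmorphism A -> B})
    (I : set A) (J : set B) : (forall x, I x -> J (h x)) ->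
  forall n x, ideal_pow I n x -> ideal_pow J n (h x).
Proof.
move=> IJ; elim=> // n IH.
apply: (ideal_gen_sub (I := [set x | ideal_pow J n.+1 (h x)])) => /=
  [z [x [y [Ix Iy ->]]]||x y Hx Hy|a x Hx].
- by rewrite /= rmorphM; apply: ig_in; exists (h x), (h y); split; auto.
- by rewrite rmorph0; apply: ig_0.
- by rewrite rmorphD; apply: ig_D.
- by rewrite rmorphM; apply: ig_M.
Qed.

(* The quotient of A by the ideal generated by J. *)
Section QuotRing.
Variables (A : comPzRingType) (J : set A).

Definition quo_relb : rel A := fun x y => `[< ideal_gen J (x - y) >].

Let igN x : ideal_gen J x -> ideal_gen J (- x).
Proof. by rewrite -mulN1r; apply: ig_M. Qed.

Fact quo_relb_refl : reflexive quo_relb.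
Proof. by move=> x; apply/asboolP; rewrite subrr; apply: ig_0. Qed.
Fact quo_relb_sym : symmetric quo_relb.
Proof.
by move=> x y; apply/asbool_equiv_eq; split=> /igN; rewrite opprB.
Qed.
Fact quo_relb_trans : transitive quo_relb.
Proof.
move=> y x z /asboolP xy /asboolP yz; apply/asboolP.
by rewrite -(subrK y x) -addrA; apply: ig_D.
Qed.
Canonical quo_equiv :=
  EquivRel quo_relb quo_relb_refl quo_relb_sym quo_relb_trans.

Definition quor := {eq_quot quo_equiv}.
HB.instance Definition _ : EqQuotient _ quo_equiv quor := EqQuotient.on quor.
HB.instance Definition _ := Choice.on quor.

Definition quo (x : A) : quor := \pi_quor x.

Lemma quoP x y : ideal_gen J (x - y) <-> quo x = quo y.
Proof. by split=> [xy|/eqmodP/asboolP//]; apply/eqmodP/asboolP. Qed.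

Lemma quo_repr x : ideal_gen J (repr (quo x) - x).
Proof. by apply/quoP; rewrite /quo reprK. Qed.

Definition quo_add (x y : quor) := quo (repr x + repr y).
Definition quo_opp (x : quor) := quo (- repr x).
Definition quo_mul (x y : quor) := quo (repr x * repr y).

Let quoD x y : quo_add (quo x) (quo y) = quo (x + y).
Proof.
apply/quoP; rewrite opprD addrACA; apply: ig_D; exact: quo_repr.
Qed.
Let quoN x : quo_opp (quo x) = quo (- x).
Proof. by apply/quoP; rewrite -opprD; apply/igN/quo_repr. Qed.
Let quoM x y : quo_mul (quo x) (quo y) = quo (x * y).
Proof.
apply/quoP; rewrite -(subrK (x * repr (quo y)) (_ * _)) -addrA -mulrBl -mulrBr.
by apply: ig_D; [rewrite mulrC|]; apply/ig_M/quo_repr.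
Qed.

Let quoW (P : quor -> Prop) : (forall x, P (quo x)) -> forall x, P x.
Proof. by move=> H; elim/quotW. Qed.

Fact quo_addA : associative quo_add.
Proof.
elim/quoW=> x; elim/quoW=> y; elim/quoW=> z.
by rewrite (quoD y z) (quoD x y) (quoD x) (quoD _ z) addrA.
Qed.
Fact quo_addC : commutative quo_add.
Proof. by elim/quoW=> x; elim/quoW=> y; rewrite (quoD x y) (quoD y x) addrC. Qed.
Fact quo_add0 : left_id (quo 0) quo_add.
Proof. by elim/quoW=> x; rewrite quoD add0r. Qed.
Fact quo_addN : left_inverse (quo 0) quo_opp quo_add.
Proof. by elim/quoW=> x; rewrite quoN quoD addNr. Qed.
HB.instance Definition _ :=
  GRing.isZmodule.Build quor quo_addA quo_addC quo_add0 quo_addN.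

Fact quo_mulA : associative quo_mul.
Proof.
elim/quoW=> x; elim/quoW=> y; elim/quoW=> z.
by rewrite (quoM y z) (quoM x y) (quoM x) (quoM _ z) mulrA.
Qed.
Fact quo_mulC : commutative quo_mul.
Proof. by elim/quoW=> x; elim/quoW=> y; rewrite (quoM x y) (quoM y x) mulrC. Qed.
Fact quo_mul1 : left_id (quo 1) quo_mul.
Proof. by elim/quoW=> x; rewrite quoM mul1r. Qed.
Fact quo_mulDl : left_distributive quo_mul +%R.
Proof.
elim/quoW=> x; elim/quoW=> y; elim/quoW=> z; rewrite /GRing.add /=.
by rewrite (quoD x y) (quoM _ z) (quoM x) (quoM y) (quoD (x * z)) mulrDl.
Qed.
HB.instance Definition _ := GRing.Zmodule_isComPzRing.Build quor
  quo_mulA quo_mulC quo_mul1 quo_mulDl.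

Fact quo_nmod : nmod_morphism quo.
Proof. by split=> // x y; rewrite -quoD. Qed.
Fact quo_monoid : monoid_morphism quo.
Proof. by split=> // x y; rewrite -quoM. Qed.
HB.instance Definition _ := GRing.isNmodMorphism.Build A quor quo quo_nmod.
HB.instance Definition _ := GRing.isMonoidMorphism.Build A quor quo quo_monoid.
End QuotRing.
Arguments quo {A} J x.

Section QuoMap.
Variables (A B : comPzRingType) (J : set A) (J' : set B) (h : {rmorphism A -> B}).

Definition quo_map (_ : forall x, J x -> ideal_gen J' (h x)) (x : quor J) :
  quor J' := quo J' (h (repr x)).

Hypothesis hJ : forall x, J x -> ideal_gen J' (h x).

Lemma quo_mapE x : quo_map hJ (quo J x) = quo J' (h x).
Proof.
apply/quoP; rewrite -rmorphB.
move: (repr _ - x) (quo_repr J x).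
apply: (ideal_gen_sub (I := [set y | ideal_gen J' (h y)])) => //=.
- by rewrite rmorph0; apply: ig_0.
- by move=> y z Hy Hz; rewrite rmorphD; apply: ig_D.
- by move=> a y Hy; rewrite rmorphM; apply: ig_M.
Qed.

Fact quo_map_nmod : nmod_morphism (quo_map hJ).
Proof.
split=> [|x y]; first by rewrite -(rmorph0 (quo J)) quo_mapE !rmorph0.
elim/quotW: x => x; elim/quotW: y => y; rewrite -!/(quo J _).
by rewrite -rmorphD !quo_mapE !rmorphD.
Qed.
Fact quo_map_monoid : monoid_morphism (quo_map hJ).
Proof.
split=> [|x y]; first by rewrite -(rmorph1 (quo J)) quo_mapE !rmorph1.
elim/quotW: x => x; elim/quotW: y => y; rewrite -!/(quo J _).
by rewrite -rmorphM !quo_mapE !rmorphM.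
Qed.
HB.instance Definition _ :=
  GRing.isNmodMorphism.Build (quor J) (quor J') (quo_map hJ) quo_map_nmod.
HB.instance Definition _ :=
  GRing.isMonoidMorphism.Build (quor J) (quor J') (quo_map hJ) quo_map_monoid.
End QuoMap.

(* conv F n is the sum of F i j over i + j = n. *)
Section Conv.
Variable V : zmodType.
Implicit Types (F G : nat -> nat -> V).

Definition conv F (n : nat) : V := \sum_(i < n.+1) F i (n - i)%N.

Lemma eq_conv F G n :
  (forall i j, (i + j)%N = n -> F i j = G i j) -> conv F n = conv G n.
Proof. by move=> FG; apply: eq_bigr => i _; apply: FG; rewrite subnKC // -ltnS. Qed.

Lemma convC F n : conv F n = conv (fun i j => F j i) n.
Proof.
rewrite /conv (reindex_inj rev_ord_inj) /=; apply: eq_bigr => i _.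
by rewrite subSS subKn // -ltnS.
Qed.

Lemma convA (F : nat -> nat -> nat -> V) n :
  conv (fun i m => conv (F i) m) n = conv (fun m k => conv (fun i j => F i j k) m) n.
Proof.
pose F3 i k := F i (n - i - k)%N k.
transitivity (\sum_(i < n.+1) \sum_(k < n.+1 | (k <= n - i)%N) F3 i k).
  apply: eq_bigr => /= i _; rewrite convC.
  by rewrite (big_ord_narrow_leq (leq_subr _ _)).
rewrite (exchange_big_dep predT) //= convC; apply: eq_bigr => k _.
transitivity (\sum_(i < n.+1 | (i <= n - k)%N) F3 i k).
  apply: eq_bigl => i; rewrite -ltnS -(ltnS i) -!subSn ?leq_ord //.
  by rewrite -subn_gt0 -(subn_gt0 i) -!subnDA addnC.
rewrite (big_ord_narrow_leq (leq_subr _ _)).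
by apply: eq_bigr => i _; rewrite /F3 -!subnDA addnC.
Qed.

Lemma convD F G n : conv (fun i j => F i j + G i j) n = conv F n + conv G n.
Proof. exact: big_split. Qed.

Lemma convACA (G : nat -> nat -> nat -> nat -> V) n :
  conv (fun k l => conv (fun i p => conv (fun j q => G i p j q) l) k) n =
  conv (fun m l => conv (fun i j => conv (fun p q => G i p j q) l) m) n.
Proof.
rewrite -(convA (fun i p l => conv (fun j q => G i p j q) l)).
rewrite -(convA (fun i j l => conv (fun p q => G i p j q) l)).
apply: eq_conv => i m _.
rewrite (convA (fun p j q => G i p j q)) (convA (fun j p q => G i p j q)).
by apply: eq_conv => k q _; rewrite convC.
Qed.

Lemma conv_bin G k j :
  conv (fun i i' => conv (fun l l' =>
    G (i + l)%N (i' + l')%N *+ ('C(i + l, l) * 'C(i' + l', l'))) j) k =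
  conv G (k + j) *+ 'C(k + j, j).
Proof.
pose F l a := G a (k + j - a)%N *+ ('C(a, l) * 'C(k + j - a, j - l)).
transitivity (\sum_(l < j.+1) \sum_(i < k.+1) F l (i + l)%N).
  rewrite exchange_big /=; apply: eq_bigr => i _; apply: eq_bigr => l _.
  have -> : (k - i + (j - l) = k + j - (i + l))%N.
    by rewrite addnBA -1?ltnS // addnC addnBA -1?ltnS // -subnDA (addnC j).
  by [].
transitivity (\sum_(l < j.+1) \sum_(a < (k + j).+1) F l a).
  apply: eq_bigr => l _; rewrite -!(big_mkord xpredT) /=.
  have lj : (l <= j)%N by rewrite -ltnS.
  rewrite [RHS](@big_cat_nat _ _ _ l) ?leqW ?(leq_trans lj) ?leq_addl //=.
  rewrite [X in _ = X + _]big_nat [X in _ = X + _]big1 ?add0r => [|a /andP[_ al]]; last first.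
    by rewrite /F bin_small.
  rewrite [RHS](@big_cat_nat _ _ _ (k + l).+1) ?ltnS ?leq_add2l ?leqW ?leq_addl //=.
  rewrite [X in _ = _ + X]big_nat [X in _ = _ + X]big1 ?addr0 => [|a /andP[kla akj]]; last first.
    rewrite /F (@bin_small (k + j - a)) ?muln0 // ltn_subLR //.
    by rewrite (leq_trans _ (leq_add kla (leqnn _))) // addSn -addnA subnKC.
  have := @big_addn _ 0%R +%R 0 (k + l).+1 l xpredT (F l); rewrite add0n -addSn addnK => ->.
  by rewrite big_mkord.
rewrite exchange_big /conv -sumrMnl; apply: eq_bigr => a _ /=.
by rewrite /F sumrMnr binomial.Vandermonde subnKC // -ltnS.
Qed.
End Conv.

(* A[[T]], a power series being the sequence of its coefficients. *)
Definition pseries (A : Type) : Type := nat -> A.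

Section PSeriesZmod.
Variable V : zmodType.
Implicit Types a b c : pseries V.

HB.instance Definition _ := gen_eqMixin (pseries V).
HB.instance Definition _ := gen_choiceMixin (pseries V).

Definition ps_zero : pseries V := fun=> 0.
Definition ps_opp a : pseries V := fun n => - a n.
Definition ps_add a b : pseries V := fun n => a n + b n.
Definition ps_mono (c : V) (k : nat) : pseries V := fun n => c *+ (n == k).

Fact ps_addA : associative ps_add.
Proof. by move=> a b c; apply/funext => n; apply: addrA. Qed.
Fact ps_addC : commutative ps_add.
Proof. by move=> a b; apply/funext => n; apply: addrC. Qed.
Fact ps_add0 : left_id ps_zero ps_add.
Proof. by move=> a; apply/funext => n; apply: add0r. Qed.
Fact ps_addN : left_inverse ps_zero ps_opp ps_add.
Proof. by move=> a; apply/funext => n; apply: addNr. Qed.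
HB.instance Definition _ := GRing.isZmodule.Build (pseries V)
  ps_addA ps_addC ps_add0 ps_addN.

Lemma ps_coefD a b n : (a + b) n = a n + b n. Proof. by []. Qed.
Lemma ps_coef_sum (I : Type) (r : seq I) (P : pred I) (F : I -> pseries V) n :
  (\sum_(i <- r | P i) F i) n = \sum_(i <- r | P i) F i n.
Proof. by apply: (big_morph (fun a : pseries V => a n)). Qed.
Lemma ps_monoD (c d : V) k : ps_mono (c + d) k = ps_mono c k + ps_mono d k.
Proof. by apply/funext => n; rewrite /ps_mono mulrnDl. Qed.
End PSeriesZmod.

(* For phi : X -> Y[[T]], the map X[[T]] -> Y[[T]] sending the sum of the     *)
(* a_i T^i to the sum of the phi(a_i) T^i.                                    *)
Definition ps_ext (X : Type) (Y : zmodType) (phi : X -> pseries Y)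
  (a : pseries X) : pseries Y := conv (fun i j => phi (a i) j).

Section PSeriesRing.
Variable A : comPzRingType.
Implicit Types a b c : pseries A.

Definition ps_one : pseries A := ps_mono 1 0.
Definition ps_mul a b : pseries A := conv (fun i j => a i * b j).

Fact ps_mulA : associative ps_mul.
Proof.
move=> a b c; apply/funext => n; rewrite /ps_mul.
transitivity (conv (fun i m => conv (fun j k => a i * b j * c k) m) n).
  apply: eq_conv => i m _; rewrite /conv mulr_sumr.
  by apply: eq_bigr => j _; rewrite mulrA.
rewrite (convA (fun i j k => a i * b j * c k)); apply: eq_conv => m k _.
by rewrite /conv mulr_suml.
Qed.
Fact ps_mulC : commutative ps_mul.
Proof.
move=> a b; apply/funext => n; rewrite /ps_mul convC.
by apply: eq_conv => i j _; rewrite mulrC.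
Qed.
Fact ps_mul1 : left_id ps_one ps_mul.
Proof.
move=> a; apply/funext => n; rewrite /ps_mul /conv big_ord_recl /= mul1r subn0.
by rewrite big1 ?addr0 // => i _; rewrite mul0r.
Qed.
Fact ps_mulDl : left_distributive ps_mul +%R.
Proof.
move=> a b c; apply/funext => n; rewrite /GRing.add /= /ps_add /ps_mul -convD.
by apply: eq_conv => i j _; rewrite mulrDl.
Qed.
HB.instance Definition _ := GRing.Zmodule_isComPzRing.Build (pseries A)
  ps_mulA ps_mulC ps_mul1 ps_mulDl.

Lemma ps_coefM a b n : (a * b) n = conv (fun i j => a i * b j) n.
Proof. by []. Qed.
Lemma ps_monoM (c d : A) i j : ps_mono c i * ps_mono d j = ps_mono (c * d) (i + j).
Proof.
apply/funext => n; rewrite ps_coefM /ps_mono /conv.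
have [ni|ni] := ltnP n i.
  rewrite big1 => [|k _].
    by rewrite (ltn_eqF (leq_trans ni (leq_addr _ _))).
  by rewrite (ltn_eqF (leq_ltn_trans _ ni)) ?mul0r // -ltnS.
rewrite (bigD1 (Ordinal (ni : (i < n.+1)%N))) //= eqxx big1 ?addr0.
  by rewrite mulrnAr -(eqn_add2l i) subnKC.
by move=> k; rewrite -val_eqE /= => /negbTE ->; rewrite mul0r.
Qed.
End PSeriesRing.

Section HigherDerivations.
Variables (K : fieldType) (R : comAlgType K).

Record HD := MkHD {
  hd :> {rmorphism R -> pseries R};
  hd_alg : forall a : K, hd a%:A = ps_mono a%:A 0;
  hd_id : forall r, hd r 0%N = r
}.

Lemma ps_ext_hdE (psi : HD) (r : R) i n :
  ps_ext psi (ps_mono r i) n = if (i <= n)%N then psi r (n - i)%N else 0.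
Proof.
rewrite /ps_ext /conv; have [ile|nlt] := leqP i n; last first.
  apply: big1 => k _; rewrite /ps_mono (ltn_eqF (leq_ltn_trans _ nlt)) -1?ltnS //.
  by rewrite raddf0.
rewrite (bigD1 (Ordinal (ile : (i < n.+1)%N))) //= /ps_mono eqxx big1 ?addr0 //.
by move=> k; rewrite -val_eqE /= => /negbTE ->; rewrite raddf0.
Qed.

Section Comp.
Variables psi1 psi2 : HD.

Definition hd_comp_fun (r : R) : pseries R := ps_ext psi1 (psi2 r).

Fact hd_comp_nmod : nmod_morphism hd_comp_fun.
Proof.
split=> [|x y]; apply/funext => n; rewrite /hd_comp_fun.
  by rewrite raddf0 /ps_ext /conv big1 // => i _; rewrite raddf0.
rewrite raddfD ps_coefD /ps_ext -convD; apply: eq_conv => i j _.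
by rewrite ps_coefD raddfD.
Qed.
Fact hd_comp_monoid : monoid_morphism hd_comp_fun.
Proof.
split=> [|x y]; apply/funext => n; rewrite /hd_comp_fun.
  by rewrite rmorph1 ps_ext_hdE subn0 rmorph1.
rewrite rmorphM ps_coefM /ps_ext.
transitivity (conv (fun m l => conv (fun i j => conv (fun p q =>
   psi1 (psi2 x i) p * psi1 (psi2 y j) q) l) m) n).
  apply: eq_conv => m l _; rewrite ps_coefM /conv raddf_sum ps_coef_sum.
  by apply: eq_bigr => i _; rewrite /= rmorphM.
rewrite -(convACA (fun i p j q => psi1 (psi2 x i) p * psi1 (psi2 y j) q)).
apply: eq_conv => k l _; rewrite /conv mulr_suml; apply: eq_bigr => i _.
by rewrite mulr_sumr.
Qed.
HB.instance Definition _ :=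
  GRing.isNmodMorphism.Build R (pseries R) hd_comp_fun hd_comp_nmod.
HB.instance Definition _ :=
  GRing.isMonoidMorphism.Build R (pseries R) hd_comp_fun hd_comp_monoid.

Fact hd_comp_alg (a : K) : hd_comp_fun a%:A = ps_mono a%:A 0.
Proof.
by apply/funext => n; rewrite /hd_comp_fun hd_alg ps_ext_hdE subn0 hd_alg.
Qed.
Fact hd_comp_id r : hd_comp_fun r 0%N = r.
Proof. by rewrite /hd_comp_fun /ps_ext /conv big_ord1 /= !hd_id. Qed.

Definition hd_comp : HD := @MkHD hd_comp_fun hd_comp_alg hd_comp_id.
End Comp.
End HigherDerivations.
Arguments HD : clear implicits.

Section Omega.
Variables (K : fieldType) (R : comAlgType K).

(* ODiff k r is the symbol d^(k) r for k > 0, and the scalar r for k = 0. *)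
Inductive om_term :=
| ODiff of nat & R
| OZero
| OOne
| OAdd of om_term & om_term
| OOpp of om_term
| OMul of om_term & om_term.

HB.instance Definition _ := gen_eqMixin om_term.
HB.instance Definition _ := gen_choiceMixin om_term.

Inductive om_rel : om_term -> om_term -> Prop :=
| or_refl x : om_rel x x
| or_sym x y : om_rel x y -> om_rel y x
| or_trans x y z : om_rel x y -> om_rel y z -> om_rel x z
| or_congD x x' y y' :
    om_rel x x' -> om_rel y y' -> om_rel (OAdd x y) (OAdd x' y')
| or_congN x x' : om_rel x x' -> om_rel (OOpp x) (OOpp x')
| or_congM x x' y y' :
    om_rel x x' -> om_rel y y' -> om_rel (OMul x y) (OMul x' y')
| or_addA x y z : om_rel (OAdd x (OAdd y z)) (OAdd (OAdd x y) z)
| or_addC x y : om_rel (OAdd x y) (OAdd y x)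
| or_add0 x : om_rel (OAdd OZero x) x
| or_addN x : om_rel (OAdd (OOpp x) x) OZero
| or_mulA x y z : om_rel (OMul x (OMul y z)) (OMul (OMul x y) z)
| or_mulC x y : om_rel (OMul x y) (OMul y x)
| or_mul1 x : om_rel (OMul OOne x) x
| or_mulDl x y z : om_rel (OMul (OAdd x y) z) (OAdd (OMul x z) (OMul y z))
| or_diffD k r s : om_rel (ODiff k (r + s)) (OAdd (ODiff k r) (ODiff k s))
| or_diffM k r s : om_rel (ODiff k (r * s))
    (\big[OAdd/OZero]_(i < k.+1) OMul (ODiff i r) (ODiff (k - i) s))
| or_diffK k (a : K) : (0 < k)%N -> om_rel (ODiff k a%:A) OZero
| or_diff1 : om_rel (ODiff 0 1) OOne.

Definition om_relb : rel om_term := fun x y => `[< om_rel x y >].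

Fact om_relb_refl : reflexive om_relb.
Proof. by move=> x; apply/asboolP; apply: or_refl. Qed.
Fact om_relb_sym : symmetric om_relb.
Proof. by move=> x y; apply/asbool_equiv_eq; split; apply: or_sym. Qed.
Fact om_relb_trans : transitive om_relb.
Proof.
by move=> y x z /asboolP xy /asboolP yz; apply/asboolP; apply: or_trans xy yz.
Qed.
Canonical om_equiv := EquivRel om_relb om_relb_refl om_relb_sym om_relb_trans.

Definition Omega := {eq_quot om_equiv}.
HB.instance Definition _ : EqQuotient _ om_equiv Omega := EqQuotient.on Omega.
HB.instance Definition _ := Choice.on Omega.

Lemma om_piP x y : om_rel x y <-> \pi_Omega x = \pi_Omega y.
Proof. by split=> [xy|/eqmodP/asboolP//]; apply/eqmodP/asboolP. Qed.

Lemma om_repr x : om_rel (repr (\pi_Omega x)) x.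
Proof. by apply/om_piP; rewrite reprK. Qed.

Definition om_add (x y : Omega) := \pi_Omega (OAdd (repr x) (repr y)).
Definition om_opp (x : Omega) := \pi_Omega (OOpp (repr x)).
Definition om_mul (x y : Omega) := \pi_Omega (OMul (repr x) (repr y)).

Let piD x y : om_add (\pi_Omega x) (\pi_Omega y) = \pi_Omega (OAdd x y).
Proof. by apply/om_piP/or_congD; apply: om_repr. Qed.
Let piN x : om_opp (\pi_Omega x) = \pi_Omega (OOpp x).
Proof. by apply/om_piP/or_congN; apply: om_repr. Qed.
Let piM x y : om_mul (\pi_Omega x) (\pi_Omega y) = \pi_Omega (OMul x y).
Proof. by apply/om_piP/or_congM; apply: om_repr. Qed.

Let zero := \pi_Omega OZero.
Let one := \pi_Omega OOne.

Fact om_addA : associative om_add.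
Proof.
elim/quotW=> x; elim/quotW=> y; elim/quotW=> z.
by rewrite (piD y z) (piD x y) (piD x) (piD _ z); apply/om_piP/or_addA.
Qed.
Fact om_addC : commutative om_add.
Proof.
elim/quotW=> x; elim/quotW=> y.
by rewrite (piD x y) (piD y x); apply/om_piP/or_addC.
Qed.
Fact om_add0 : left_id zero om_add.
Proof. by elim/quotW=> x; rewrite (piD OZero x); apply/om_piP/or_add0. Qed.
Fact om_addN : left_inverse zero om_opp om_add.
Proof. by elim/quotW=> x; rewrite piN (piD _ x); apply/om_piP/or_addN. Qed.
HB.instance Definition _ :=
  GRing.isZmodule.Build Omega om_addA om_addC om_add0 om_addN.

Fact om_mulA : associative om_mul.
Proof.
elim/quotW=> x; elim/quotW=> y; elim/quotW=> z.
by rewrite (piM y z) (piM x y) (piM x) (piM _ z); apply/om_piP/or_mulA.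
Qed.
Fact om_mulC : commutative om_mul.
Proof.
elim/quotW=> x; elim/quotW=> y.
by rewrite (piM x y) (piM y x); apply/om_piP/or_mulC.
Qed.
Fact om_mul1 : left_id one om_mul.
Proof. by elim/quotW=> x; rewrite (piM OOne x); apply/om_piP/or_mul1. Qed.
Fact om_mulDl : left_distributive om_mul +%R.
Proof.
elim/quotW=> x; elim/quotW=> y; elim/quotW=> z; rewrite /GRing.add /=.
rewrite (piD x y) (piM _ z) (piM x) (piM y) (piD (OMul x z)).
exact/om_piP/or_mulDl.
Qed.
HB.instance Definition _ := GRing.Zmodule_isComPzRing.Build Omega
  om_mulA om_mulC om_mul1 om_mulDl.

Definition dO (k : nat) (r : R) : Omega := \pi_Omega (ODiff k r).

(* The conditions on phi for the existence of a ring morphism out of Omega    *)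
(* with value phi k r at d^(k) r.                                             *)
Definition om_compat (B : comPzRingType) (phi : nat -> R -> B) :=
  [/\ forall k r s, phi k (r + s) = phi k r + phi k s,
      forall k r s, phi k (r * s) = conv (fun i j => phi i r * phi j s) k,
      forall k (a : K), (0 < k)%N -> phi k a%:A = 0
    & phi 0%N 1 = 1].

Lemma dO_compat : om_compat dO.
Proof.
split=> [k r s|k r s|k a k0|].
- by rewrite /GRing.add /= /dO piD; apply/om_piP/or_diffD.
- rewrite /dO; move/om_piP: (or_diffM k r s) => ->; rewrite /conv.
  rewrite (big_morph (fun x => \pi_Omega x) (id1 := 0) (op1 := +%R)) //.
  by apply: eq_bigr => i _; rewrite /GRing.mul /= piM.
- by move/om_piP: (or_diffK a k0).
- by move/om_piP: or_diff1.
Qed.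

Section Lift.
Variables (B : comPzRingType) (phi : nat -> R -> B).

Fixpoint om_eval (t : om_term) : B :=
  match t with
  | ODiff k r => phi k r
  | OZero => 0
  | OOne => 1
  | OAdd x y => om_eval x + om_eval y
  | OOpp x => - om_eval x
  | OMul x y => om_eval x * om_eval y
  end.

Definition om_lift (_ : om_compat phi) (x : Omega) : B := om_eval (repr x).

Hypothesis H : om_compat phi.

Let lift_pi t : om_lift H (\pi_Omega t) = om_eval t.
Proof.
have [phiD phiM phiK phi1] := H.
have E x y : om_rel x y -> om_eval x = om_eval y.
  elim=> //= {x y}; first [by move=> x y z _ -> _ -> | by move=> x x' y y' _ -> _ ->
   | by move=> x x' _ -> | idtac].
  - by move=> x y z; rewrite addrA.
  - by move=> x y; rewrite addrC.
  - by move=> x; rewrite add0r.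
  - by move=> x; rewrite addNr.
  - by move=> x y z; rewrite mulrA.
  - by move=> x y; rewrite mulrC.
  - by move=> x; rewrite mul1r.
  - by move=> x y z; rewrite mulrDl.
  - move=> k r s; rewrite phiM /conv.
    by rewrite (big_morph om_eval (id1 := 0) (op1 := +%R)).
by apply: E; apply: om_repr.
Qed.

Lemma om_liftE k r : om_lift H (dO k r) = phi k r.
Proof. exact: lift_pi. Qed.

Fact om_lift_nmod : nmod_morphism (om_lift H).
Proof.
split=> [|x y]; first exact: (lift_pi OZero).
elim/quotW: x => x; elim/quotW: y => y.
by rewrite {1}/GRing.add /= piD !lift_pi.
Qed.
Fact om_lift_monoid : monoid_morphism (om_lift H).
Proof.
split=> [|x y]; first exact: (lift_pi OOne).
elim/quotW: x => x; elim/quotW: y => y.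
by rewrite {1}/GRing.mul /= piM !lift_pi.
Qed.
HB.instance Definition _ :=
  GRing.isNmodMorphism.Build Omega B (om_lift H) om_lift_nmod.
HB.instance Definition _ :=
  GRing.isMonoidMorphism.Build Omega B (om_lift H) om_lift_monoid.
End Lift.

Definition om_cst (r : R) : Omega := dO 0 r.

Fact om_cst_nmod : nmod_morphism om_cst.
Proof.
have [dD _ _ _] := dO_compat.
by split=> [|x y]; [apply: (addrI (om_cst 0)); rewrite -dD !addr0|apply: dD].
Qed.
Fact om_cst_monoid : monoid_morphism om_cst.
Proof.
have [_ dM _ d1] := dO_compat.
by split=> // x y; rewrite /om_cst dM /conv big_ord1.
Qed.
HB.instance Definition _ := GRing.isNmodMorphism.Build R Omega om_cst om_cst_nmod.
HB.instance Definition _ :=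
  GRing.isMonoidMorphism.Build R Omega om_cst om_cst_monoid.

(* The homogeneous piece of degree k of Omega; by om_homog_mono the sum of the *)
(* pieces is direct. The completion of Omega by degree is not introduced as a *)
(* type: its elements are the families w with w k in om_homog k for all k.    *)
Inductive om_homog : nat -> set Omega :=
| oh_d k r : om_homog k (dO k r)
| oh_0 k : om_homog k 0
| oh_D k x y : om_homog k x -> om_homog k y -> om_homog k (x + y)
| oh_M i j x y : om_homog i x -> om_homog j y -> om_homog (i + j) (x * y).

Lemma om_compat_mono (B : comPzRingType) (phi : nat -> R -> B) :
  om_compat phi -> om_compat (fun k r => ps_mono (phi k r) k).
Proof.
move=> [phiD phiM phiK phi1]; split=> [k r s|k r s|k a k0|].
- by rewrite phiD ps_monoD.
- rewrite phiM /conv.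
  rewrite (big_morph (fun c => ps_mono c k) (id1 := 0) (op1 := +%R)).
  + by apply: eq_bigr => i _; rewrite ps_monoM subnKC // -ltnS.
  + by move=> x y; apply: ps_monoD.
  + by apply/funext => n; rewrite /ps_mono mul0rn.
- by rewrite phiK //; apply/funext => n; rewrite /ps_mono mul0rn.
- by rewrite phi1.
Qed.

Lemma om_lift_homog (B : comPzRingType) (phi : nat -> R -> B)
    (H : om_compat phi) k x :
  om_homog k x -> om_lift (om_compat_mono H) x = ps_mono (om_lift H x) k.
Proof.
elim=> {k x} [k r|k|k x y _ Hx _ Hy|i j x y _ Hx _ Hy].
- by rewrite !om_liftE.
- by rewrite !raddf0; apply/funext => n; rewrite /ps_mono mul0rn.
- by rewrite !raddfD ps_monoD /= Hx Hy.
- by rewrite !rmorphM /= Hx Hy ps_monoM.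
Qed.

Lemma om_lift_id x : om_lift dO_compat x = x.
Proof.
elim/quotW: x; elim=> [k r|||x Hx y Hy|x Hx|x Hx y Hy].
- exact: om_liftE.
- exact: (raddf0 (om_lift dO_compat)).
- exact: (rmorph1 (om_lift dO_compat)).
- rewrite -piD [LHS](raddfD (om_lift dO_compat)).
  by congr (_ + _); [apply: Hx|apply: Hy].
- by rewrite -piN [LHS](raddfN (om_lift dO_compat)); congr (- _); apply: Hx.
- rewrite -piM [LHS](rmorphM (om_lift dO_compat)).
  by congr (_ * _); [apply: Hx|apply: Hy].
Qed.

Lemma om_homog_mono k x :
  om_homog k x -> om_lift (om_compat_mono dO_compat) x = ps_mono x k.
Proof. by move=> Hx; rewrite (om_lift_homog _ Hx) om_lift_id. Qed.

(* The continuous automorphism d_Omega of the completion is determined by its *)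
(* restriction to Omega, given here as a morphism to Omega[[T]] where T keeps *)
(* track of the degree: the coefficient of T^j is the part of d_Omega raising *)
(* degrees by j.                                                              *)
Definition dOm_gen (i : nat) (r : R) : pseries Omega :=
  fun j => dO (i + j) r *+ 'C(i + j, j).

Lemma dOm_compat : om_compat dOm_gen.
Proof.
have [dD dM dK d1] := dO_compat.
split=> [k r s|k r s|k a k0|]; apply/funext => j.
- by rewrite /dOm_gen dD mulrnDl.
- rewrite /dOm_gen dM -conv_bin /conv ps_coef_sum; apply: eq_bigr => i _.
  rewrite ps_coefM; apply: eq_bigr => l _.
  by rewrite mulrnAl mulrnAr -mulrnA mulnC.
- by rewrite /dOm_gen dK ?mul0rn // ltn_addr.
- rewrite /dOm_gen add0n binn mulr1n; case: j => [|j]; first exact: d1.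
  by rewrite -[1]scale1r dK.
Qed.

Definition dOm : Omega -> pseries Omega := om_lift dOm_compat.
HB.instance Definition _ := GRing.RMorphism.on dOm.

Lemma dOmE i r : dOm (dO i r) = (fun j => dO (i + j) r *+ 'C(i + j, j)).
Proof. exact: om_liftE. Qed.

Section Tilde.
Variable psi : HD K R.

Lemma hd_compat : om_compat (fun k r => psi r k).
Proof.
split=> [k r s|k r s|k a k0|]; first by rewrite raddfD.
- by rewrite rmorphM.
- by rewrite hd_alg /ps_mono (gtn_eqF k0).
- by rewrite hd_id.
Qed.

(* The restriction to Omega of the continuous morphism psi tilde. *)
Definition tilde : Omega -> pseries R := om_lift (om_compat_mono hd_compat).
HB.instance Definition _ := GRing.RMorphism.on tilde.

Lemma tildeE k r : tilde (dO k r) = ps_mono (psi r k) k.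
Proof. exact: om_liftE. Qed.

Lemma tilde_homog k x : om_homog k x -> tilde x = ps_mono (tilde x k) k.
Proof.
by move=> Hx; rewrite /tilde (om_lift_homog _ Hx) /ps_mono eqxx mulr1n.
Qed.
End Tilde.
End Omega.
Arguments Omega {K} R.
Arguments om_cst {K R} r.

Definition fin_gen (A : comPzRingType) (M : lmodType A) : Prop :=
  exists s : seq M, forall m, exists c : nat -> A,
    m = \sum_(i < size s) c i *: s`_i.

Section Connections.
Variables (K : fieldType) (R : comAlgType K).

(* Omega (x)_R M. The module completed by degree is encoded by the sequences  *)
(* t : nat -> OmegaM M with t k in the homogeneous piece OmegaM_homog k.      *)
Definition OmegaM (M : lmodType R) := tens (@om_cst K R) M.

Inductive OmegaM_homog (M : lmodType R) (k : nat) : set (OmegaM M) :=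
| ohm_pure w m : om_homog k w -> OmegaM_homog k (pure w m)
| ohm_0 : OmegaM_homog k 0
| ohm_D x y : OmegaM_homog k x -> OmegaM_homog k y -> OmegaM_homog k (x + y).

Section Nabla.
Variables (M : lmodType R) (nabla : nat -> M -> OmegaM M).

Definition higher_connection : Prop :=
  [/\ forall k m, OmegaM_homog k (nabla k m),
      forall k m m', nabla k (m + m') = nabla k m + nabla k m',
      forall k r m,
        nabla k (r *: m) = conv (fun i j => dO i r *: nabla j m) k
    & forall m, nabla 0%N m = pure 1 m].

(* The part raising degrees by i of w (x) x |-> d_Omega(w) nabla(x). *)
Definition om_nabla (i : nat) : OmegaM M -> OmegaM M :=
  tens_lift (fun w x => conv (fun a b => dOm w a *: nabla b x) i).

Lemma om_nabla_bal i : higher_connection ->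
  balanced (@om_cst K R) (fun w x => conv (fun a b => dOm w a *: nabla b x) i).
Proof.
case=> _ nD nM _; split=> [w w' m|w m m'|w r m].
- rewrite -convD; apply: eq_conv => a b _.
  by rewrite -scalerDl raddfD.
- by rewrite -convD; apply: eq_conv => a b _; rewrite nD scalerDr.
transitivity (conv (fun a l => conv (fun b c => (dOm w a * dO b r) *: nabla c m) l) i).
  rewrite (convA (fun a b c => (dOm w a * dO b r) *: nabla c m)).
  apply: eq_conv => a b _; rewrite rmorphM ps_coefM /conv scaler_suml.
  apply: eq_bigr => j _; congr (_ * _ *: _).
  by rewrite /= /om_cst dOmE add0n binn.
apply: eq_conv => a b _; rewrite nM /conv scaler_sumr.
by apply: eq_bigr => j _; rewrite scalerA.
Qed.

Definition iterative : Prop := forall i j t,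
  om_nabla i (om_nabla j t) = om_nabla (i + j) t *+ 'C(i + j, i).

(* psi tilde (x) id_M : Omega (x) M -> M[[T]] *)
Definition tilde_id (psi : HD K R) : OmegaM M -> pseries M :=
  tens_lift (fun w m => (fun n => tilde psi w n *: m) : pseries M).

Lemma tilde_id_bal psi :
  balanced (@om_cst K R) 
    (fun w m => (fun n => tilde psi w n *: m) : pseries M).
Proof.
split=> [w w' m|w m m'|w r m]; apply/funext => n.
- by rewrite raddfD ps_coefD scalerDl.
- by rewrite scalerDr.
rewrite rmorphM ps_coefM /= /om_cst tildeE hd_id.
rewrite convC /conv big_ord_recl /= subn0 big1 => [|i _]; last by rewrite mulr0.
by rewrite addr0 scalerA.
Qed.

(* By tilde_homog, psi tilde maps the piece of degree k of Omega to R T^k, so *)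
(* only the component of degree n contributes to the coefficient of T^n.      *)
Definition nabla_hd (psi : HD K R) (m : M) : pseries M :=
  fun n => tilde_id psi (nabla n m) n.

Definition integrable : Prop := forall psi1 psi2 m,
  nabla_hd (hd_comp psi1 psi2) m = ps_ext (nabla_hd psi1) (nabla_hd psi2 m).
End Nabla.
End Connections.

Lemma tens_map_bal (A B : comPzRingType) (f : {rmorphism A -> B})
    (M N : lmodType A) (u : M -> N) : linear u ->
  balanced f (fun b m => pure (f := f) b (u m)).
Proof.
move=> lu; have uD x y : u (x + y) = u x + u y by rewrite -[x]scale1r lu !scale1r.
have uZ a x : u (a *: x) = a *: u x.
  have u0 : u 0 = 0 by apply: (addrI (u 0)); rewrite -uD !addr0.
  by rewrite -[a *: x]addr0 lu u0 addr0.
by split=> [b b' m|b m m'|b a m]; rewrite ?pureDl ?uD ?pureDr ?pureZ ?uZ.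
Qed.

Lemma tens_map_comp (A B : comPzRingType) (f : {rmorphism A -> B})
    (M N P : lmodType A) (u : M -> N) (v : N -> P) : linear u -> linear v ->
  tens_map f (v \o u) =1 tens_map f v \o tens_map f u.
Proof.
move=> lu lv; have lvu : linear (v \o u) by move=> a x y; rewrite /= lu lv.
have bu := tens_map_bal f lu; have bv := tens_map_bal f lv.
have bvu := tens_map_bal f lvu.
apply: tens_ext => [x y|x y|b m]; rewrite /= /tens_map.
- exact: tens_liftD bvu _ _.
- by rewrite (tens_liftD bu) (tens_liftD bv).
- by rewrite (tens_liftE bvu) (tens_liftE bu) (tens_liftE bv).
Qed.

Lemma tens_map_id (A B : comPzRingType) (f : {rmorphism A -> B})
  (M : lmodType A) : tens_map f (@id M) =1 id.
Proof.
have bi : balanced f (fun b (m : M) => pure (f := f) b m).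
  by apply: (@tens_map_bal A B f M M id) => a x y.
apply: tens_ext => [x y|//|b m]; rewrite /tens_map; first exact: tens_liftD bi _ _.
exact: tens_liftE bi _ _.
Qed.

Record category := Category {
  ob :> Type;
  hom : ob -> ob -> Type;
  idm : forall x, hom x x;
  cmp : forall x y z, hom y z -> hom x y -> hom x z;
  cmp1m : forall x y (f : hom x y), cmp (idm y) f = f;
  cmpm1 : forall x y (f : hom x y), cmp f (idm x) = f;
  cmpA : forall x y z t (f : hom z t) (g : hom y z) (h : hom x y),
    cmp f (cmp g h) = cmp (cmp f g) h
}.
Arguments hom {c} x y.
Arguments idm {c} x.
Arguments cmp {c x y z} f g.

Record functor (C D : category) := Functor {
  fob :> C -> D;
  fhom : forall x y : C, hom x y -> hom (fob x) (fob y);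
  fhom1 : forall x, fhom (idm x) = idm (fob x);
  fhomM : forall (x y z : C) (f : hom y z) (g : hom x y),
    fhom (cmp f g) = cmp (fhom f) (fhom g)
}.
Arguments fhom {C D} F {x y} u : rename.

Definition id_functor (C : category) : functor C C :=
  @Functor C C id (fun x y f => f) (fun x => erefl) (fun x y z f g => erefl).

Program Definition comp_functor (C D E : category)
    (G : functor D E) (F : functor C D) : functor C E :=
  @Functor C E (fun x => G (F x)) (fun x y f => fhom G (fhom F f)) _ _.
Next Obligation. by rewrite !fhom1. Qed.
Next Obligation. by rewrite !fhomM. Qed.

Record nat_iso (C D : category) (F G : functor C D) := NatIso {
  ni_to : forall x, hom (F x) (G x);
  ni_from : forall x, hom (G x) (F x);
  ni_toK : forall x, cmp (ni_from x) (ni_to x) = idm (F x);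
  ni_fromK : forall x, cmp (ni_to x) (ni_from x) = idm (G x);
  ni_nat : forall (x y : C) (f : hom x y),
    cmp (ni_to y) (fhom F f) = cmp (fhom G f) (ni_to x)
}.

Definition equivalent_categories (C D : category) : Prop :=
  exists (F : functor C D) (G : functor D C),
    inhabited (nat_iso (comp_functor G F) (id_functor C)) /\
    inhabited (nat_iso (comp_functor F G) (id_functor D)).

Section ConnectionCategory.
Variables (K : fieldType) (R : comAlgType K).

Record icon := Icon {
  icon_mod :> lmodType R;
  icon_fg : fin_gen icon_mod;
  icon_nabla : nat -> icon_mod -> OmegaM icon_mod;
  icon_conn : higher_connection icon_nabla;
  icon_iter : iterative icon_nabla;
  icon_int : integrable icon_nabla
}.

Definition icon_hom_prop (M N : icon) (f : M -> N) : Prop :=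
  linear f /\
  forall k m, icon_nabla k (f m) = tens_map (@om_cst K R) f (icon_nabla k m).

Definition icon_hom (M N : icon) : Type := {f : M -> N | icon_hom_prop f}.

Fact icon_id_prop M : @icon_hom_prop M M id.
Proof. by split=> // k m; rewrite tens_map_id. Qed.

Fact icon_comp_prop (M N P : icon) (f : N -> P) (g : M -> N) :
  icon_hom_prop f -> icon_hom_prop g -> icon_hom_prop (f \o g).
Proof.
move=> [lf nf] [lg ng]; split=> [a x y|k m]; first by rewrite /= lg lf.
by rewrite tens_map_comp //= nf ng.
Qed.

Definition icon_id (M : icon) : icon_hom M M := exist _ id (icon_id_prop M).
Definition icon_comp (M N P : icon) (f : icon_hom N P) (g : icon_hom M N) :
    icon_hom M P :=
  exist _ (sval f \o sval g) (icon_comp_prop (svalP f) (svalP g)).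

Program Definition icon_int_category : category :=
  @Category icon icon_hom icon_id icon_comp _ _ _.
Next Obligation. by case: f => f pf; apply: eq_exist. Qed.
Next Obligation. by case: f => f pf; apply: eq_exist. Qed.
Next Obligation. exact: eq_exist. Qed.
End ConnectionCategory.
Arguments icon_int_category {K} R.

Lemma tens_base_bal (A B B' : comPzRingType) (f : {rmorphism A -> B})
    (f' : {rmorphism A -> B'}) (M : lmodType A) (h : {rmorphism B -> B'}) :
  (forall a, h (f a) = f' a) ->
  balanced f (fun b (m : M) => pure (f := f') (h b) m).
Proof.
move=> hf; split=> [b b' m|b m m'|b a m]; first by rewrite raddfD pureDl.
  by rewrite pureDr.
by rewrite rmorphM hf pureZ.
Qed.

Lemma tens_baseZ (A B B' : comPzRingType) (f : {rmorphism A -> B})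
    (f' : {rmorphism A -> B'}) (M : lmodType A) (h : {rmorphism B -> B'}) :
  (forall a, h (f a) = f' a) -> forall c (x : tens f M),
  tens_base h (c *: x) = h c *: (tens_base h x : tens f' M).
Proof.
move=> hf c; have bal := @tens_base_bal _ _ _ _ _ M h hf.
apply: tens_ext => [x y|x y|b m]; rewrite /tens_base.
- by rewrite scalerDr (tens_liftD bal).
- by rewrite (tens_liftD bal) scalerDr.
- by rewrite scale_pure !(tens_liftE bal) rmorphM scale_pure.
Qed.

Section Stratifications.
Variables (K : fieldType) (R : comAlgType K).

Local Notation iota := (GRing.in_alg R : {rmorphism K -> R}).

Definition RR := tensr iota iota.
Definition rr1 : {rmorphism R -> RR} := tinl iota iota.
Definition rr2 : {rmorphism R -> RR} := tinr iota iota.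
Definition rr_mul : {rmorphism RR -> R} :=
  @tdesc K R R iota iota R idfun idfun (fun=> erefl).

Definition RRR := tensr (rr1 \o iota) iota.
Definition rrr1 : {rmorphism R -> RRR} := tinl (rr1 \o iota) iota \o rr1.
Definition rrr2 : {rmorphism R -> RRR} := tinl (rr1 \o iota) iota \o rr2.
Definition rrr3 : {rmorphism R -> RRR} := tinr (rr1 \o iota) iota.

Fact rr_iota a : rr1 (iota a) = rr2 (iota a).
Proof.
by have := tpureZ iota iota 1 a 1; rewrite mul1r mulr1.
Qed.
Fact rrr_iota a : rrr1 (iota a) = rrr3 (iota a).
Proof.
by have := tpureZ (rr1 \o iota) iota 1 a 1; rewrite mul1r mulr1.
Qed.
Fact rr_mul_iota a : rr_mul ((rr1 \o iota) a) = idfun (iota a).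
Proof. by rewrite /= [LHS]tdescE rmorph1 mulr1. Qed.

Definition rrr_mul : {rmorphism RRR -> R} :=
  @tdesc K RR R (rr1 \o iota) iota R rr_mul idfun rr_mul_iota.

Fact rrr_iota23 a : rrr2 (iota a) = rrr3 (iota a).
Proof. by rewrite -rrr_iota /= rr_iota. Qed.

Definition rr_12 : {rmorphism RR -> RRR} := tinl (rr1 \o iota) iota.
Definition rr_23 : {rmorphism RR -> RRR} :=
  @tdesc K R R iota iota RRR rrr2 rrr3 rrr_iota23.
Definition rr_13 : {rmorphism RR -> RRR} :=
  @tdesc K R R iota iota RRR rrr1 rrr3 rrr_iota.

Definition diag2 : set RR := [set x | rr_mul x = 0].
Definition diag3 : set RRR := [set x | rrr_mul x = 0].

Definition PP (n : nat) := quor (ideal_pow diag2 n.+1).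
Definition PPP (n : nat) := quor (ideal_pow diag3 n.+1).

Definition PPl n : {rmorphism R -> PP n} := quo (ideal_pow diag2 n.+1) \o rr1.
Definition PPr n : {rmorphism R -> PP n} := quo (ideal_pow diag2 n.+1) \o rr2.
Definition PPP1 n : {rmorphism R -> PPP n} := quo (ideal_pow diag3 n.+1) \o rrr1.
Definition PPP2 n : {rmorphism R -> PPP n} := quo (ideal_pow diag3 n.+1) \o rrr2.
Definition PPP3 n : {rmorphism R -> PPP n} := quo (ideal_pow diag3 n.+1) \o rrr3.

Let rrr_mul_ext (h : {rmorphism RR -> RRR}) :
  (forall r, rrr_mul (h (rr1 r)) = r) -> (forall r, rrr_mul (h (rr2 r)) = r) ->
  forall x, rrr_mul (h x) = rr_mul x.
Proof.
move=> h1 h2; apply: tens_ext => [x y|x y|b c]; rewrite ?raddfD //.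
have -> : pure (f := iota) b (c : restr iota) = rr1 b * rr2 c.
  by rewrite [RHS]tpureM mulr1 mul1r.
by rewrite !rmorphM h1 h2 [rr_mul _]tdescE [X in _ = _ * X]tdescE !rmorph1 mulr1 mul1r.
Qed.

Let mul_rrr1 r : rrr_mul (rrr1 r) = r.
Proof. by rewrite [LHS]tdescE rmorph1 mulr1 [LHS]tdescE rmorph1 mulr1. Qed.
Let mul_rrr2 r : rrr_mul (rrr2 r) = r.
Proof. by rewrite [LHS]tdescE rmorph1 mulr1 [LHS]tdescE rmorph1 mul1r. Qed.
Let mul_rrr3 r : rrr_mul (rrr3 r) = r.
Proof. by rewrite [LHS]tdescE rmorph1 mul1r. Qed.

Let rr_23_1 r : rr_23 (rr1 r) = rrr2 r.
Proof. by rewrite [LHS]tdescE rmorph1 mulr1. Qed.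
Let rr_23_2 r : rr_23 (rr2 r) = rrr3 r.
Proof. by rewrite [LHS]tdescE rmorph1 mul1r. Qed.
Let rr_13_1 r : rr_13 (rr1 r) = rrr1 r.
Proof. by rewrite [LHS]tdescE rmorph1 mulr1. Qed.
Let rr_13_2 r : rr_13 (rr2 r) = rrr3 r.
Proof. by rewrite [LHS]tdescE rmorph1 mul1r. Qed.

Let mul_12 x : rrr_mul (rr_12 x) = rr_mul x.
Proof. by apply: rrr_mul_ext => r; rewrite ?mul_rrr1 ?mul_rrr2. Qed.
Let mul_23 x : rrr_mul (rr_23 x) = rr_mul x.
Proof. by apply: rrr_mul_ext => r; rewrite ?rr_23_1 ?rr_23_2. Qed.
Let mul_13 x : rrr_mul (rr_13 x) = rr_mul x.
Proof. by apply: rrr_mul_ext => r; rewrite ?rr_13_1 ?rr_13_2. Qed.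

Let diag_pow (h : {rmorphism RR -> RRR}) n :
  (forall x, rrr_mul (h x) = rr_mul x) ->
  forall x, ideal_pow diag2 n x -> ideal_gen (ideal_pow diag3 n) (h x).
Proof.
move=> hm x Ix; apply: ig_in.
by apply: ideal_pow_map Ix => y; rewrite /diag2 /diag3 /= hm.
Qed.

Fact diag_pow_id n x :
  ideal_pow diag2 n.+1 x -> ideal_gen (ideal_pow diag2 n) (idfun x).
Proof. by move=> Ix; apply: ig_in; apply: ideal_pow_le. Qed.
Fact diag_pow_12 n x :
  ideal_pow diag2 n x -> ideal_gen (ideal_pow diag3 n) (rr_12 x).
Proof. exact: diag_pow mul_12 _. Qed.
Fact diag_pow_23 n x :
  ideal_pow diag2 n x -> ideal_gen (ideal_pow diag3 n) (rr_23 x).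
Proof. exact: diag_pow mul_23 _. Qed.
Fact diag_pow_13 n x :
  ideal_pow diag2 n x -> ideal_gen (ideal_pow diag3 n) (rr_13 x).
Proof. exact: diag_pow mul_13 _. Qed.

Definition PP_proj n : {rmorphism PP n.+1 -> PP n} :=
  quo_map (@diag_pow_id n.+1).
Definition p12 n : {rmorphism PP n -> PPP n} := quo_map (@diag_pow_12 n.+1).
Definition p23 n : {rmorphism PP n -> PPP n} := quo_map (@diag_pow_23 n.+1).
Definition p13 n : {rmorphism PP n -> PPP n} := quo_map (@diag_pow_13 n.+1).

Lemma PP_proj_l n r : PP_proj n (PPl n.+1 r) = PPl n r.
Proof. exact: quo_mapE. Qed.
Lemma PP_proj_r n r : PP_proj n (PPr n.+1 r) = PPr n r.
Proof. exact: quo_mapE. Qed.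
Lemma p12_l n r : p12 n (PPl n r) = PPP1 n r.
Proof. exact: quo_mapE. Qed.
Lemma p12_r n r : p12 n (PPr n r) = PPP2 n r.
Proof. exact: quo_mapE. Qed.
Lemma p23_l n r : p23 n (PPl n r) = PPP2 n r.
Proof. by rewrite [LHS]quo_mapE rr_23_1. Qed.
Lemma p23_r n r : p23 n (PPr n r) = PPP3 n r.
Proof. by rewrite [LHS]quo_mapE rr_23_2. Qed.
Lemma p13_l n r : p13 n (PPl n r) = PPP1 n r.
Proof. by rewrite [LHS]quo_mapE rr_13_1. Qed.
Lemma p13_r n r : p13 n (PPr n r) = PPP3 n r.
Proof. by rewrite [LHS]quo_mapE rr_13_2. Qed.

Section StratOn.
Variable M : lmodType R.

(* The module P^n (x)_R M is formed with the right R-structure of P^n, and    *)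
(* M (x)_R P^n, represented by tens (PPl n) M, with the left one.             *)
Variable eps : forall n, tens (PPr n) M -> tens (PPl n) M.

(* The base change along h : P^n -> P^n(2) of eps n, where the base change of *)
(* B (x)_R M along B -> B' is identified with B' (x)_R M.                     *)
Definition pullback n (h : {rmorphism PP n -> PPP n})
    (f f' : {rmorphism R -> PPP n}) : tens f M -> tens f' M :=
  tens_lift (fun b m => b *: tens_base h (eps (pure 1 m))).

Lemma pullback_bal n (h : {rmorphism PP n -> PPP n})
    (f f' : {rmorphism R -> PPP n}) :
  (forall r, h (PPl n r) = f' r) -> (forall r, h (PPr n r) = f r) ->
  linear (@eps n) ->
  balanced f (fun b m => b *: (tens_base h (eps (pure 1 m)) : tens f' M)).
Proof.
move=> hl hr le.
have eD x y : eps (x + y) = eps x + @eps n y by rewrite -[x]scale1r le !scale1r.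
have eZ a x : eps (a *: x) = a *: @eps n x.
  have e0 : @eps n 0 = 0 by apply: (addrI (eps 0)); rewrite -eD !addr0.
  by rewrite -[a *: x]addr0 le e0 addr0.
split=> [b b' m|b m m'|b a m]; first by rewrite scalerDl.
  rewrite -scalerDr pureDr eD; congr (_ *: _).
  exact: (tens_liftD (@tens_base_bal _ _ _ (PPl n) f' M h hl)).
rewrite -pureZ mul1r -[PPr n a]mulr1 -scale_pure eZ (tens_baseZ hl) hr.
by rewrite scalerA.
Qed.

Definition stratification : Prop :=
  [/\ forall n, linear (@eps n) /\ bijective (@eps n),
      forall n x, tens_base (PP_proj n) (eps x) = eps (tens_base (PP_proj n) x),
      forall b m, @eps 0%N (pure b m) = pure b m
    & forall n x,
        @pullback n (p12 n) (PPP2 n) (PPP1 n)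
          (@pullback n (p23 n) (PPP3 n) (PPP2 n) x) =
        @pullback n (p13 n) (PPP3 n) (PPP1 n) x].
End StratOn.

Record strat := Strat {
  strat_mod :> lmodType R;
  strat_fg : fin_gen strat_mod;
  strat_eps : forall n, tens (PPr n) strat_mod -> tens (PPl n) strat_mod;
  strat_ax : stratification strat_eps
}.

Definition strat_hom_prop (M N : strat) (f : M -> N) : Prop :=
  linear f /\
  forall n x, tens_map (PPl n) f (strat_eps x) = strat_eps (tens_map (PPr n) f x).

Definition strat_hom (M N : strat) : Type := {f : M -> N | strat_hom_prop f}.

Fact strat_id_prop M : @strat_hom_prop M M id.
Proof. by split=> // n x; rewrite !tens_map_id. Qed.

Fact strat_comp_prop (M N Q : strat) (f : N -> Q) (g : M -> N) :
  strat_hom_prop f -> strat_hom_prop g -> strat_hom_prop (f \o g).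
Proof.
move=> [lf ef] [lg eg]; split=> [a x y|n x]; first by rewrite /= lg lf.
by rewrite !tens_map_comp //= eg ef.
Qed.

Definition strat_id (M : strat) : strat_hom M M := exist _ id (strat_id_prop M).
Definition strat_comp (M N Q : strat) (f : strat_hom N Q) (g : strat_hom M N) :
    strat_hom M Q :=
  exist _ (sval f \o sval g) (strat_comp_prop (svalP f) (svalP g)).

Program Definition strat_category : category :=
  @Category strat strat_hom strat_id strat_comp _ _ _.
Next Obligation. by case: f => f pf; apply: eq_exist. Qed.
Next Obligation. by case: f => f pf; apply: eq_exist. Qed.
Next Obligation. exact: eq_exist. Qed.
End Stratifications.
Arguments strat_category {K} R.

Section CommAlg.
Implicit Types A B : comNzRingType.

Definition is_ideal A (I : set A) : Prop :=
  [/\ I 0, forall x y, I x -> I y -> I (x + y) & forall a x, I x -> I (a * x)].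

Definition prime_ideal A (p : set A) : Prop :=
  [/\ is_ideal p, ~ p 1 & forall x y, p (x * y) -> p x \/ p y].

Definition maximal_ideal A (m : set A) : Prop :=
  [/\ is_ideal m, ~ m 1 &
      forall I : set A, is_ideal I -> ~ I 1 -> m `<=` I -> I = m].

Definition noetherian A : Prop :=
  forall I : set A, is_ideal I -> exists s : seq A, I = ideal_gen [set` s].

Definition prime_chain A (d : nat) : Prop :=
  exists p : nat -> set A,
    (forall i, (i <= d)%N -> prime_ideal (p i)) /\
    (forall i, (i < d)%N -> p i `<` p i.+1).

Definition krull_dim A (d : nat) : Prop := prime_chain A d /\ ~ prime_chain A d.+1.

Definition regular_local A : Prop :=
  noetherian A /\ exists m : set A,
    [/\ maximal_ideal m, forall m' : set A, maximal_ideal m' -> m' = m &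
        exists s : seq A, m = ideal_gen [set` s] /\ krull_dim A (size s)].

Definition multiplicative A (S : set A) : Prop :=
  S 1 /\ forall x y, S x -> S y -> S (x * y).

(* f exhibits B as the ring of fractions of A with denominators in S. *)
Definition is_localization A B (S : set A) (f : {rmorphism A -> B}) : Prop :=
  [/\ forall s, S s -> exists b, f s * b = 1,
      forall b, exists a s, S s /\ b * f s = f a
    & forall a, f a = 0 -> exists s, S s /\ s * a = 0].

Definition regular_ring A : Prop :=
  noetherian A /\
  forall (p : set A) B (f : {rmorphism A -> B}),
    prime_ideal p -> is_localization (~` p) f -> regular_local B.
End CommAlg.

Section Algebras.
Variable K : fieldType.

Inductive alg_gen (A : comAlgType K) (G : set A) : set A :=
| ag_in x : G x -> alg_gen G x
| ag_K (a : K) : alg_gen G a%:A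
| ag_D x y : alg_gen G x -> alg_gen G y -> alg_gen G (x + y)
| ag_M x y : alg_gen G x -> alg_gen G y -> alg_gen G (x * y).

Definition fg_algebra (A : comAlgType K) : Prop :=
  exists s : seq A, forall x, alg_gen [set` s] x.

Definition localization_of_fg_algebra (R : comAlgType K) : Prop :=
  exists (A : comAlgType K) (S : set A) (f : {lrmorphism A -> R}),
    [/\ fg_algebra A, multiplicative S & is_localization S f].

Definition finite_residue_field (R : comAlgType K) (m : set R) : Prop :=
  fin_gen (restr (quo m \o GRing.in_alg R)).

(* The infinitesimal lifting property. Finiteness is not part of the          *)
(* definition, so that localisations of smooth algebras are smooth.           *)
Definition smooth (R : comAlgType K) : Prop :=
  forall (C D : comAlgType K) (p : {lrmorphism C -> D}),
    (forall y, exists x, p x = y) ->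
    (forall x y, p x = 0 -> p y = 0 -> x * y = 0) ->
    forall u : {lrmorphism R -> D},
      exists v : {lrmorphism R -> C}, forall r, p (v r) = u r.
End Algebras.

(* Main.v *)
(* For R smooth over K and essentially of finite type, the differentials of   *)
(* finitely many x_i generate Omega_1, and lifting d along R^n -> Omega_1     *)
(* gives derivations D_i with dr = sum_i D_i(r) dx_i. They replace local      *)
(* coordinates globally, although they need not commute.                      *)
(*                                                                            *)
(* A stratification is a Taylor series theta : M -> M (x) P^n. Applying       *)
(* a (x) b |-> a d^(k)b to it gives nabla^(k); iterativity and integrability  *)
(* come from mapping the cocycle condition to power series rings.             *)
(*                                                                            *)
(* Conversely, integrability tested on exp(T D_i) and exp(T D_j) says that    *)
(* the operators nabla_(D_i) are flat. Let xi_i = x_i (x) 1 - 1 (x) x_i and   *)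
(* E = sum_i xi_i nabla_(D_i) on M (x) (R (x) R). E acts as multiplication by *)
(* k on I^k/I^(k+1), so theta_n(m) = prod_(1 <= k <= n) (1 - E/k)(m (x) 1) is *)
(* the lift of m killed by E modulo I^(n+1). By flatness it is horizontal,    *)
(* whence the cocycle condition.                                              *)
(*                                                                            *)
(* The two constructions are mutually inverse: in characteristic zero an      *)
(* iterative connection is determined by nabla^(1), and differentiating the   *)
(* cocycle condition shows that the Taylor series of a stratification is      *)
(* killed by E.                                                               *)

Require Import Defs.
From HB Require Import structures.
From mathcomp Require Import all_boot all_algebra ring zify.
From mathcomp Require Import boolp classical_sets.

Set Implicit Arguments.
Unset Strict Implicit.
Unset Printing Implicit Defensive.

Import GRing.Theory.
Local Open Scope quotient_scope.
Local Open Scope classical_set_scope.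
Local Open Scope ring_scope.

(** * Ideal powers and extension of scalars *)

(** Both structures extend elements of [M] to the infinitesimal neighbourhoods of the diagonal, and
    in characteristic zero both are governed by their part of order one. By [coordinates_exist]
    there are functions x_i and derivations D_i with dr = sum_i D_i(r) dx_i. A connection then
    becomes a family of operators nabla_i along the D_i, and flatness says that [nabla_i, nabla_j]
    is the same combination of the nabla_k as [D_i, D_j] is of the D_k.

    A stratification is determined by its Taylor series theta_n(m) = eps_n(1 (x) m). Reading it
    through a (x) b |-> a d^(k)b gives nabla^(k). Iterativity and integrability are images of the
    cocycle condition under ring morphisms from R (x) R (x) R to power series rings ([taylor_eval3],
    [nabla_of_iterative], [nabla_of_integrable]).

    Conversely, integrability tested on exponentials of the D_i gives flatness
    ([partial_nabla_flat]). The Euler operator E = sum_i xi_i nabla_i has weight k on the k-th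
    graded piece ([eul_grad]), so the product of the 1 - E/k projects onto the kernel of E modulo a
    power of I. The projection of m is its Taylor series [theta_of]. Flatness makes it horizontal in
    the first factor ([nab_pr_imod]), which yields the cocycle condition ([eps_of_cocycle]);
    invertibility follows by exchanging the two factors ([cocycle_bijective]).

    For the round trips, an iterative connection is determined by nabla^(1) ([iterative_unique]),
    and E kills every Taylor series ([eul2_taylor]), which is therefore the projection
    ([theta_of_nabla_of]). Modules and maps are left unchanged throughout, so the natural
    isomorphisms are identity maps. *)

Lemma additive_0 (U V : zmodType) (g : U -> V) :
  {morph g : x y / x + y} -> g 0 = 0.
Proof. by move=> gD; apply: (addrI (g 0)); rewrite -gD !addr0. Qed.

Lemma additive_opp (U V : zmodType) (g : U -> V) :
  {morph g : x y / x + y} -> {morph g : x / - x}.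
Proof. by move=> gD x; apply: (addrI (g x)); rewrite -gD !subrr additive_0. Qed.

Lemma additive_sub (U V : zmodType) (g : U -> V) :
  {morph g : x y / x + y} -> {morph g : x y / x - y}.
Proof. by move=> gD x y; rewrite gD additive_opp. Qed.

Lemma additive_sum (U V : zmodType) (g : U -> V) :
  {morph g : x y / x + y} -> forall (I : Type) (r : seq I) (P : pred I) F,
  g (\sum_(i <- r | P i) F i) = \sum_(i <- r | P i) g (F i).
Proof. by move=> gD I r P F; apply: (big_morph g gD (additive_0 gD)). Qed.

Lemma additive_muln (U V : zmodType) (g : U -> V) :
  {morph g : x y / x + y} -> forall n, {morph g : x / x *+ n}.
Proof.
by move=> gD n x; elim: n => [|n IH]; rewrite ?mulr0n ?additive_0 // !mulrS gD IH.
Qed.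

Section IdealPowers.
Variables (B : comPzRingType) (I : set B).
Implicit Types x y : B.

Lemma ideal_pow0 n : ideal_pow I n 0.
Proof. by case: n => //= n; apply: ig_0. Qed.
Lemma ideal_powD n x y :
  ideal_pow I n x -> ideal_pow I n y -> ideal_pow I n (x + y).
Proof. by case: n => //= n; apply: ig_D. Qed.
Lemma ideal_powM n b x : ideal_pow I n x -> ideal_pow I n (b * x).
Proof. by case: n => //= n; apply: ig_M. Qed.
Lemma ideal_powN n x : ideal_pow I n x -> ideal_pow I n (- x).
Proof. by move=> Ix; rewrite -mulN1r; apply: ideal_powM. Qed.
Lemma ideal_pow_sum n (J : Type) (r : seq J) (P : pred J) F :
  (forall i, P i -> ideal_pow I n (F i)) ->
  ideal_pow I n (\sum_(i <- r | P i) F i).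
Proof.
move=> H; elim/big_rec: _ => [|i x Pi IH]; first exact: ideal_pow0.
by apply: ideal_powD; auto.
Qed.
Lemma ideal_powS n x y : I x -> ideal_pow I n y -> ideal_pow I n.+1 (x * y).
Proof. by move=> Ix Iy; apply: ig_in; exists x, y. Qed.
Lemma ideal_pow_add i j x y :
  ideal_pow I i x -> ideal_pow I j y -> ideal_pow I (i + j) (x * y).
Proof.
elim: i x => [x _ Iy|i IH x Ix Iy]; first exact: ideal_powM.
elim: Ix => [_ [a [b [Ia Ib ->]]]||a b _ Ha _ Hb|a b _ Hb].
- by rewrite -mulrA addSn; apply: ideal_powS => //; apply: IH.
- by rewrite mul0r; apply: ideal_pow0.
- by rewrite mulrDl; apply: ideal_powD.
- by rewrite -mulrA; apply: ideal_powM.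
Qed.
Lemma ideal_pow1 x : I x -> ideal_pow I 1 x.
Proof. by move=> Ix; rewrite -[x]mulr1; apply: ideal_powS. Qed.
Lemma ideal_gen_pow n x : ideal_gen (ideal_pow I n) x -> ideal_pow I n x.
Proof.
elim=> {x} // [|x y _ Ix _ Iy|b x _ Ix].
- exact: ideal_pow0.
- exact: ideal_powD.
- exact: ideal_powM.
Qed.
Lemma ideal_pow_leq m n x : (m <= n)%N -> ideal_pow I n x -> ideal_pow I m x.
Proof.
elim: n => [|n IH]; first by rewrite leqn0 => /eqP->.
by rewrite leq_eqVlt => /orP[/eqP->|/IH H Ix] //; apply/H/ideal_pow_le.
Qed.
End IdealPowers.
Arguments ideal_pow {A} I n : simpl never.

Section IdealModule.
Variables (B : comPzRingType) (V : lmodType B).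

(** Only sums are closed off, which gives the submodule I V when [I] is an ideal. An arbitrary set
    is allowed so that [I] can also be the singleton of 0, where membership means vanishing. *)
Inductive imod (I : set B) : set V :=
| im_Z b v : I b -> imod I (b *: v)
| im_0 : imod I 0
| im_D u v : imod I u -> imod I v -> imod I (u + v).

Lemma imod_sum (I : set B) (J : Type) (r : seq J) (P : pred J) F :
  (forall i, P i -> imod I (F i)) -> imod I (\sum_(i <- r | P i) F i).
Proof.
by move=> H; elim/big_rec: _ => [|i x Pi IH]; [apply: im_0 | apply: im_D; auto].
Qed.

Lemma imod_mono (I J : set B) u : I `<=` J -> imod I u -> imod J u.
Proof.
move=> IJ; elim=> {u} [b v Ib||u v _ Hu _ Hv]; last exact: im_D.
  by apply: im_Z; apply: IJ.
exact: im_0.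
Qed.

Variable I : set B.
Local Notation F k := (imod (ideal_pow I k)).

Lemma imod_powZ k c u : F k u -> F k (c *: u).
Proof.
elim=> {u} [b v Ib||u v _ Hu _ Hv]; rewrite ?scaler0 ?scalerDr.
- by rewrite scalerA; apply/im_Z/ideal_powM.
- exact: im_0.
- exact: im_D.
Qed.
Lemma imod_powN k u : F k u -> F k (- u).
Proof. by rewrite -scaleN1r; apply: imod_powZ. Qed.
Lemma imod_powB k u v : F k u -> F k v -> F k (u - v).
Proof. by move=> Hu Hv; apply: im_D => //; apply: imod_powN. Qed.
Lemma imod_pow_add i k c u : ideal_pow I i c -> F k u -> F (i + k) (c *: u).
Proof.
move=> Ic; elim=> {u} [b v Ib||u v _ Hu _ Hv]; rewrite ?scaler0 ?scalerDr.
- by rewrite scalerA; apply/im_Z/ideal_pow_add.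
- exact: im_0.
- exact: im_D.
Qed.
Lemma imod_powS k c u : I c -> F k u -> F k.+1 (c *: u).
Proof. by move=> Ic; apply: (@imod_pow_add 1); apply: ideal_pow1. Qed.
Lemma imod_pow0 u : F 0 u.
Proof. by rewrite -[u]scale1r; apply: im_Z. Qed.
Lemma imod_pow_leq m n u : (m <= n)%N -> F n u -> F m u.
Proof. by move=> mn; apply: imod_mono => x; apply: ideal_pow_leq. Qed.
End IdealModule.

Section TensMore.
Variables (A B : comPzRingType) (f : {rmorphism A -> B}) (M : lmodType A).

Lemma pure0r b : pure b (0 : M) = 0 :> tens f M.
Proof. by apply: (addrI (pure b 0)); rewrite -pureDr !addr0. Qed.
Lemma pure_scale (b : B) (a : A) (m : M) :
  pure b (a *: m) = f a *: pure b m :> tens f M.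
Proof. by rewrite -pureZ scale_pure mulrC. Qed.
Lemma pureE b m : pure b m = b *: pure 1 m :> tens f M.
Proof. by rewrite scale_pure mulr1. Qed.
Lemma pure_sumr b (J : Type) (r : seq J) (P : pred J) (F : J -> M) :
  pure b (\sum_(i <- r | P i) F i) = \sum_(i <- r | P i) pure b (F i) :> tens f M.
Proof. by apply: additive_sum => x y; apply: pureDr. Qed.
Lemma pure_suml (J : Type) (r : seq J) (P : pred J) (F : J -> B) (m : M) :
  pure (\sum_(i <- r | P i) F i) m = \sum_(i <- r | P i) pure (F i) m :> tens f M.
Proof.
by apply: (additive_sum (g := fun b => pure b m : tens f M)) => x y; apply: pureDl.
Qed.

Lemma tens_pureP (x : tens f M) :
  exists s : seq (B * M), x = \sum_(p <- s) pure p.1 p.2.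
Proof.
elim/tens_ind: x => [b m||x y [s ->] [t ->]|x [s ->]].
- by exists [:: (b, m)]; rewrite big_seq1.
- by exists [::]; rewrite big_nil.
- by exists (s ++ t); rewrite big_cat.
- exists [seq (- p.1, p.2) | p <- s]; rewrite big_map -sumrN.
  apply: eq_bigr => p _ /=; rewrite [RHS]pureE scaleNr -pureE //.
Qed.
End TensMore.

Section TensBase.
Variables (A B B' : comPzRingType) (f : {rmorphism A -> B}) (f' : {rmorphism A -> B'}).
Variables (M : lmodType A) (h : B -> B').
Hypothesis hD : {morph h : x y / x + y}.
Hypothesis hf : forall b a, h (b * f a) = h b * f' a.

(** [h] is not assumed multiplicative: later it extracts one coefficient of a power series, and only
    additivity and linearity over [A] survive this. *)
Fact tens_base_add_bal : balanced f (fun b (m : M) => pure (f := f') (h b) m).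
Proof.
split=> [b b' m|b m m'|b a m]; first by rewrite hD pureDl.
  by rewrite pureDr.
by rewrite hf pureZ.
Qed.
Lemma tens_base_pure b m :
  tens_base h (pure b m : tens f M) = pure (h b) m :> tens f' M.
Proof. exact: (tens_liftE tens_base_add_bal). Qed.
Lemma tens_baseD : {morph (tens_base h : tens f M -> tens f' M) : x y / x + y}.
Proof. exact: (tens_liftD tens_base_add_bal). Qed.

Lemma tens_base_imod (I : set B) (J : set B') (x : tens f M) :
  (forall b c, I b -> J (h (b * c))) -> imod I x ->
  imod J (tens_base h x : tens f' M).
Proof.
move=> IJ; elim=> {x} [b v Ib||u v _ Hu _ Hv].
- elim/tens_ind: v => [c m||x y Hx Hy|x Hx].
  + rewrite scale_pure tens_base_pure pureE; apply: im_Z; exact: IJ.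
  + rewrite scaler0 (additive_0 tens_baseD); exact: im_0.
  + rewrite scalerDr tens_baseD; exact: im_D.
  + rewrite -[- x]scaleN1r scalerA mulrC -scalerA scaleN1r (additive_opp tens_baseD).
    (* [J] is an arbitrary set, so closure under opposites has to be proved: the sign is moved onto
       the vector. *)
    elim: Hx => [b' v' Jb||u w _ Hu _ Hw]; rewrite ?oppr0 ?opprD.
    * by rewrite -scalerN; apply: im_Z.
    * exact: im_0.
    * exact: im_D.
- by rewrite (additive_0 tens_baseD); apply: im_0.
- by rewrite tens_baseD; apply: im_D.
Qed.
End TensBase.

Definition ring_der (B : comPzRingType) (d : B -> B) : Prop :=
  {morph d : x y / x + y} /\ forall x y, d (x * y) = d x * y + x * d y.

Section RingDer.
Variables (B : comPzRingType) (d : B -> B).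
Hypothesis dd : ring_der d.

Lemma ring_der1 : d 1 = 0.
Proof.
have [dD dM] := dd; apply: (addrI (d 1)).
by rewrite addr0 -[in RHS](mulr1 1) dM mul1r mulr1.
Qed.
Lemma ring_der_nat n : d n%:R = 0.
Proof. by have [dD _] := dd; rewrite (additive_muln dD) ring_der1 mul0rn. Qed.
(** Differentiating n b = 1 gives n d(b) = 0. This makes the scalars 1/k constants for the Euler
    operator. *)
Lemma ring_der_inv n b : n%:R * b = 1 -> d b = 0.
Proof.
move=> nb; have [_ dM] := dd.
have := dM n%:R b; rewrite nb ring_der1 ring_der_nat mul0r add0r => /esym H.
by rewrite -[d b]mul1r -nb mulrAC H mul0r.
Qed.

(** By the Leibniz rule a derivation lowers the adic order by at most one, whatever it does to
    [I]. *)
Lemma ring_der_pow (I : set B) n b : ideal_pow I n.+1 b -> ideal_pow I n (d b).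
Proof.
have [dD dM] := dd; elim: n b => // n IH b.
elim=> {b} [_ [x [y [Ix Iy ->]]]||x y _ Hx _ Hy|a x Ix Hx].
- rewrite dM; apply: ideal_powD; first by apply: ideal_powM.
  by apply: ideal_powS => //; apply: IH.
- by rewrite (additive_0 dD); apply: ideal_pow0.
- by rewrite dD; apply: ideal_powD.
- rewrite dM; apply: ideal_powD; last exact: ideal_powM.
  by apply: ideal_powM; apply: ideal_pow_le; exact: Ix.
Qed.
End RingDer.

(** * The Euler operator of a connection *)

Section Radial.
Variables (A B : comPzRingType) (f : {rmorphism A -> B}) (M : lmodType A).
Variables (n : nat) (dA : 'I_n -> A -> A) (dB : 'I_n -> B -> B) (nM : 'I_n -> M -> M).
Hypothesis dB_der : forall i, ring_der (dB i).
Hypothesis dBf : forall i a, dB i (f a) = f (dA i a).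
Hypothesis nMD : forall i, {morph nM i : x y / x + y}.
Hypothesis nMZ : forall i a m, nM i (a *: m) = dA i a *: m + a *: nM i m.
Local Notation V := (tens f M).

Definition nab (i : 'I_n) : V -> V :=
  tens_lift (fun b m => pure (dB i b) m + pure b (nM i m)).

Let nab_bal i : balanced f (fun b m => pure (f := f) (dB i b) m + pure b (nM i m)).
Proof.
have [dD dM] := dB_der i; split=> [b b' m|b m m'|b a m].
- by rewrite dD !pureDl addrACA.
- by rewrite nMD !pureDr addrACA.
- by rewrite dM pureDl dBf !pureZ nMZ pureDr addrA.
Qed.

Lemma nab_pure i b m : nab i (pure b m) = pure (dB i b) m + pure b (nM i m).
Proof. exact: (tens_liftE (nab_bal i)). Qed.
Lemma nabD i : {morph nab i : u v / u + v}.
Proof. exact: (tens_liftD (nab_bal i)). Qed.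
Lemma nabZ i b u : nab i (b *: u) = dB i b *: u + b *: nab i u.
Proof.
have [dD dM] := dB_der i.
move: u; apply: tens_ext => [u v|u v|c m].
- by rewrite scalerDr nabD.
- by rewrite nabD !scalerDr addrACA.
- by rewrite scale_pure !nab_pure dM pureDl scalerDr !scale_pure addrA.
Qed.

Variable xi : 'I_n -> B.

Definition eul_ring (b : B) : B := \sum_i xi i * dB i b.
Definition eul (u : V) : V := \sum_i xi i *: nab i u.

Lemma eul_ring_der : ring_der eul_ring.
Proof.
split=> [x y|x y]; rewrite /eul_ring.
  by rewrite -big_split; apply: eq_bigr => i _; rewrite (dB_der i).1 mulrDr.
rewrite mulr_suml mulr_sumr -big_split; apply: eq_bigr => i _.
by rewrite (dB_der i).2 mulrDr mulrA (mulrCA x).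
Qed.
Lemma eulD : {morph eul : u v / u + v}.
Proof.
by move=> u v; rewrite /eul -big_split; apply: eq_bigr => i _; rewrite nabD scalerDr.
Qed.
Lemma eulZ b u : eul (b *: u) = eul_ring b *: u + b *: eul u.
Proof.
rewrite /eul /eul_ring scaler_suml scaler_sumr -big_split; apply: eq_bigr => i _.
by rewrite nabZ scalerDr !scalerA [xi i * b]mulrC.
Qed.

Variable inv : nat -> A.
Hypothesis invP : forall k, k.+1%:R * inv k = 1.

Let finvP k : k.+1%:R * f (inv k) = 1.
Proof. by rewrite -(rmorph_nat f) -rmorphM invP rmorph1. Qed.

(* The projection onto the kernel of eul modulo I^(N+1). *)
Fixpoint pr (N : nat) (u : V) : V :=
  if N is N'.+1 then pr N' u - f (inv N') *: eul (pr N' u) else u.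

Lemma eul_inv k u : eul (f (inv k) *: u) = f (inv k) *: eul u.
Proof. by rewrite eulZ (ring_der_inv eul_ring_der (finvP k)) scale0r add0r. Qed.
Lemma prD N : {morph pr N : u v / u + v}.
Proof. by elim: N => //= N IH u v; rewrite IH eulD scalerDr opprD addrACA. Qed.
(** [pr N] is a polynomial in [eul] whose coefficients are constants for [eul]. *)
Lemma eul_pr N u : eul (pr N u) = pr N (eul u).
Proof.
elim: N => //= N IH.
by rewrite (additive_sub eulD) eul_inv IH.
Qed.
Lemma prZ N b u : eul_ring b = 0 -> pr N (b *: u) = b *: pr N u.
Proof.
move=> eb; elim: N => //= N ->.
by rewrite eulZ eb scale0r add0r scalerBr !scalerA mulrC.
Qed.

Variable I : set B.
Hypothesis xiI : forall i, I (xi i).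
Local Notation F k := (@imod B V (ideal_pow I k)).

Lemma nab_imod i k u : F k.+1 u -> F k (nab i u).
Proof.
elim=> {u} [b v Ib||u v _ Hu _ Hv].
- rewrite nabZ; apply: im_D; apply: im_Z; first exact: ring_der_pow.
  exact: ideal_pow_le.
- by rewrite (additive_0 (nabD i)); apply: im_0.
- by rewrite nabD; apply: im_D.
Qed.
Lemma eul_imod1 u : F 1 (eul u).
Proof. by apply: imod_sum => i _; apply: imod_powS => //; apply: imod_pow0. Qed.
(** [nab] loses one order and the factor [xi] restores it. *)
Lemma eul_imod k u : F k u -> F k (eul u).
Proof.
case: k => [_|k Fu]; first exact: imod_pow0.
by apply: imod_sum => i _; apply: imod_powS => //; apply: nab_imod.
Qed.
Lemma pr_imod k N u : F k u -> F k (pr N u).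
Proof.
by move=> Fu; elim: N => //= N IH; apply: imod_powB => //; apply/imod_powZ/eul_imod.
Qed.
(** As a polynomial in [eul], [pr N] has constant term 1, so the difference is built from [eul u]
    alone. *)
Lemma pr_id k N u : F k (eul u) -> F k (pr N u - u).
Proof.
move=> Fu; elim: N => [|N IH] /=; first by rewrite subrr; apply: im_0.
rewrite addrAC; apply: imod_powB => //; apply: imod_powZ.
by rewrite eul_pr; apply: pr_imod.
Qed.

Hypothesis rad : forall y, I y -> ideal_pow I 2 (eul_ring y - y).

(** Euler's identity for homogeneous forms: [rad] gives weight one on I/I^2, and the Leibniz rule
    adds weights in products. *)
Lemma eul_ring_pow k b :
  ideal_pow I k b -> ideal_pow I k.+1 (eul_ring b - b *+ k).
Proof.
have [eD eM] := eul_ring_der.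
elim: k b => [b _|k IH b].
  rewrite mulr0n subr0; apply: ideal_pow_sum => i _.
  by apply: ideal_powS.
elim=> {b} [_ [x [y [Ix Iy ->]]]||x y _ Hx _ Hy|a x Ix Hx].
- have -> : eul_ring (x * y) - x * y *+ k.+1 =
      (eul_ring x - x) * y + x * (eul_ring y - y *+ k).
    rewrite eM mulrS mulrBl mulrBr mulrnAr opprD addrACA.
    by congr (_ + _).
  apply: ideal_powD; last by apply: ideal_powS => //; apply: IH.
  exact: (@ideal_pow_add _ _ 2 k _ _ (rad Ix) Iy).
- by rewrite (additive_0 eD) mul0rn subr0; apply: ideal_pow0.
- by rewrite eD mulrnDl opprD addrACA; apply: ideal_powD.
- rewrite eM -mulrnAr -addrA -mulrBr; apply: ideal_powD; last exact: ideal_powM.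
  rewrite mulrC /eul_ring mulr_sumr; apply: ideal_pow_sum => i _.
  by rewrite mulrCA; apply: ideal_powS => //; rewrite mulrC; apply: ideal_powM.
Qed.

(** The weight comes from the scalars only, because [eul] maps all of V into I V. *)
Lemma eul_grad k u : F k u -> F k.+1 (eul u - u *+ k).
Proof.
elim=> {u} [b v Ib||u v _ Hu _ Hv].
- rewrite eulZ addrAC scalerMnl -scalerBl; apply: im_D.
    by apply: im_Z; apply: eul_ring_pow.
  by rewrite -addn1; apply: imod_pow_add => //; apply: eul_imod1.
- by rewrite (additive_0 eulD) mul0rn subr0; apply: im_0.
- by rewrite eulD mulrnDl opprD addrACA; apply: im_D.
Qed.

(** When [pr N u] lies in I^(N+1) V, [eul] acts on it as N+1 up to the next power, so the factor 1 -
    E/(N+1) gains one order. *)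
Lemma pr_imod1 N u : F 1 u -> F N.+1 (pr N u).
Proof.
move=> Fu; elim: N => [//|N IH].
have -> : pr N.+1 u = - (f (inv N) *: (eul (pr N u) - pr N u *+ N.+1)).
  rewrite /= scalerBr opprB -scaler_nat scalerA mulrC.
  by rewrite finvP scale1r.
by apply/imod_powN/imod_powZ/eul_grad.
Qed.
Lemma eul_pr_imod N u : F N.+1 (eul (pr N u)).
Proof. by rewrite eul_pr; apply/pr_imod1/eul_imod1. Qed.

(** [y i j] stands for D_i(x_j) and [c i j k] for the coefficients of [D_i, D_j]. The D_i may be
    dependent, so the relations [dBy] and [nMy] replace the identity matrix that genuine coordinates
    would give for [y]. *)
Variables (c : 'I_n -> 'I_n -> 'I_n -> A) (y : 'I_n -> 'I_n -> A).
Hypothesis dBxi : forall i j, dB i (xi j) = f (y i j).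
Hypothesis dBy : forall i b, \sum_j f (y i j) * dB j b = dB i b.
Hypothesis nMy : forall i m, \sum_j y i j *: nM j m = nM i m.
Hypothesis dBflat : forall i j b,
  dB i (dB j b) = dB j (dB i b) + \sum_k f (c i j k) * dB k b.
Hypothesis nMflat : forall i j m,
  nM i (nM j m) = nM j (nM i m) + \sum_k c i j k *: nM k m.

Let naby i u : \sum_j f (y i j) *: nab j u = nab i u.
Proof.
move: u; apply: tens_ext => [u v|u v|b m].
- by rewrite -big_split; apply: eq_bigr => j _; rewrite nabD scalerDr.
- exact: nabD.
rewrite nab_pure -dBy -nMy pure_sumr pure_suml -big_split; apply: eq_bigr => j _ /=.
by rewrite nab_pure scalerDr !scale_pure [f _ * b]mulrC pureZ.
Qed.

Let nabflat i j u :
  nab i (nab j u) = nab j (nab i u) + \sum_k f (c i j k) *: nab k u.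
Proof.
move: u; apply: tens_ext => [u v|u v|b m].
- by rewrite !nabD.
- rewrite !nabD addrACA -big_split; congr (_ + _).
  by apply: eq_bigr => k _; rewrite nabD scalerDr.
have -> : \sum_k f (c i j k) *: nab k (pure b m) =
    pure (\sum_k f (c i j k) * dB k b) m + pure b (\sum_k c i j k *: nM k m).
  rewrite pure_sumr pure_suml -big_split; apply: eq_bigr => k _ /=.
  by rewrite nab_pure scalerDr !scale_pure [f _ * b]mulrC pureZ.
rewrite !(nab_pure, nabD) dBflat nMflat pureDl pureDr -!addrA.
congr (_ + _); rewrite [LHS]addrCA [RHS]addrCA; congr (_ + _).
by rewrite [LHS]addrCA; congr (_ + _); rewrite addrCA.
Qed.

(** Put v = [pr N u], so that E v has order N+1. Flatness turns nabla_j(E v) into (E + 1) nabla_j v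
    plus terms with a coefficient in I. If all nabla_j v have order k, then E + 1 acts on them as
    k+1 modulo order k+1; dividing by k+1 gains one order, as long as k < N. *)
Lemma nab_pr_imod N i u : F N (nab i (pr N u)).
Proof.
set v := pr N u; suff H k : (k <= N)%N -> forall j, F k (nab j v) by exact: H.
elim: k => [_ j|k IH kN j]; first exact: imod_pow0.
have {IH}Fv := IH (ltnW kN).
have E : nab j (eul v) = eul (nab j v) + nab j v +
    \sum_l xi l *: \sum_k f (c j l k) *: nab k v.
  rewrite {1}/eul (additive_sum (nabD j)).
  rewrite -{2}(naby j v) /eul -!big_split; apply: eq_bigr => l _ /=.
  by rewrite nabZ dBxi nabflat scalerDr addrCA addrA.
have F1 : F k.+1 (nab j (eul v)).
  by apply: imod_pow_leq kN _; apply/nab_imod/eul_pr_imod.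
have F2 : F k.+1 (\sum_l xi l *: \sum_k f (c j l k) *: nab k v).
  apply: imod_sum => l _; apply: imod_powS => //.
  by apply: imod_sum => p _; apply: imod_powZ.
have F3 : F k.+1 (nab j v *+ k.+1).
  have -> : nab j v *+ k.+1 = nab j (eul v) -
      \sum_l xi l *: (\sum_k f (c j l k) *: nab k v) - (eul (nab j v) - nab j v *+ k).
    by rewrite E addrK mulrSr opprB [RHS]addrC subrKA.
  by apply: imod_powB; [apply: imod_powB|apply: eul_grad].
by rewrite -[nab j v]scale1r -(finvP k) mulrC -scalerA scaler_nat; apply: imod_powZ.
Qed.
End Radial.

(** * Base change along ring morphisms and right exactness *)

Section TensBaseMorphism.
Variables (A B B' : comPzRingType) (f : {rmorphism A -> B}) (f' : {rmorphism A -> B'}).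
Variables (M : lmodType A) (h : {rmorphism B -> B'}).
Hypothesis hf : forall a, h (f a) = f' a.

Lemma tens_base_rpure b m :
  tens_base h (pure b m : tens f M) = pure (h b) m :> tens f' M.
Proof. exact: (tens_liftE (tens_base_bal M hf)). Qed.
Lemma tens_base_rD : {morph (tens_base h : tens f M -> tens f' M) : x y / x + y}.
Proof. exact: (tens_liftD (tens_base_bal M hf)). Qed.
Lemma tens_base_rimod (I : set B) (J : set B') (x : tens f M) :
  (forall b, I b -> J (h b)) -> imod I x -> imod J (tens_base h x : tens f' M).
Proof.
move=> IJ; elim=> {x} [b v Ib||u v _ Hu _ Hv].
- by rewrite (tens_baseZ hf); apply/im_Z/IJ.
- by rewrite (additive_0 tens_base_rD); apply: im_0.
- by rewrite tens_base_rD; apply: im_D.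
Qed.
End TensBaseMorphism.

Lemma tens_base_square (A B B1 B2 B3 : comPzRingType) (f : {rmorphism A -> B})
  (f1 : {rmorphism A -> B1}) (f2 : {rmorphism A -> B2}) (f3 : {rmorphism A -> B3})
  (M : lmodType A) (h1 : {rmorphism B -> B1}) (h2 : {rmorphism B1 -> B2})
  (h3 : {rmorphism B -> B3}) (h4 : {rmorphism B3 -> B2}) :
  (forall a, h1 (f a) = f1 a) -> (forall a, h2 (f1 a) = f2 a) ->
  (forall a, h3 (f a) = f3 a) -> (forall a, h4 (f3 a) = f2 a) ->
  (forall b, h2 (h1 b) = h4 (h3 b)) ->
  forall x : tens f M,
  tens_base h2 (tens_base h1 x : tens f1 M) =
  tens_base h4 (tens_base h3 x : tens f3 M) :> tens f2 M.
Proof.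
move=> e1 e2 e3 e4 sq; apply: tens_ext => [x y|x y|b m].
- by rewrite (tens_base_rD e1) (tens_base_rD e2).
- by rewrite (tens_base_rD e3) (tens_base_rD e4).
- by rewrite (tens_base_rpure e1) (tens_base_rpure e2) (tens_base_rpure e3)
    (tens_base_rpure e4) sq.
Qed.

Lemma tens_base_eq_id (A B : comPzRingType) (f : {rmorphism A -> B})
  (M : lmodType A) (h : {rmorphism B -> B}) : h =1 id ->
  forall x : tens f M, tens_base h x = x.
Proof.
move=> hid; have hf a : h (f a) = f a by rewrite hid.
apply: tens_ext => // [x y|b m]; first exact: tens_base_rD.
by rewrite (tens_base_rpure hf) hid.
Qed.

Section TensQuo.
Variables (A B : comPzRingType) (f : {rmorphism A -> B}) (M : lmodType A) (J : set B).
Local Notation q := (tens_base (quo J) : tens f M -> tens (quo J \o f) M).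

Let qf a : quo J (f a) = (quo J \o f) a. Proof. by []. Qed.

Lemma tens_quo_imod (x : tens f M) : imod J x -> q x = 0.
Proof.
elim=> {x} [b v Jb||u v _ Hu _ Hv].
- have /quoP qb : ideal_gen J (b - 0) by rewrite subr0; apply: ig_in.
  by rewrite (tens_baseZ qf) [X in X *: _]qb rmorph0 scale0r.
- exact: additive_0 (tens_base_rD qf).
- by rewrite (tens_base_rD qf) Hu Hv addr0.
Qed.

Lemma quo_surj (y : quor J) : exists b, y = quo J b.
Proof. by elim/quotW: y => b; exists b. Qed.

Lemma tens_quo_surj (y : tens (quo J \o f) M) : exists x, y = q x.
Proof.
elim/tens_ind: y => [b m||y y' [x ->] [x' ->]|y [x ->]].
- have [c ->] := quo_surj b; exists (pure c m).
  by rewrite (tens_base_rpure qf).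
- by exists 0; rewrite (additive_0 (tens_base_rD qf)).
- by exists (x + x'); rewrite (tens_base_rD qf).
- by exists (- x); rewrite (additive_opp (tens_base_rD qf)).
Qed.
End TensQuo.

(* Right exactness: the quotient of the left-hand side by the submodule is    *)
(* built so as to receive a map from the right-hand side.                     *)
Section TensQuoKer.
Variables (A B : comPzRingType) (f : {rmorphism A -> B}) (M : lmodType A).
Variables (I : set B) (n : nat).
Local Notation J := (ideal_pow I n).
Local Notation V := (tens f M).

Definition imod_pred : {pred V} := [pred u | `[< imod J u >]].

Fact imod_pred_zmod : zmod_closed imod_pred.
Proof.
split=> [|u v /asboolP Hu /asboolP Hv]; apply/asboolP; first exact: im_0.
exact: imod_powB.
Qed.
HB.instance Definition _ :=
  GRing.isZmodClosed.Build V imod_pred imod_pred_zmod.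

Local Notation Q := (Quotient.quot imod_pred).

Lemma tens_quo_ker (x : V) :
  tens_base (quo J) x = 0 :> tens (quo J \o f) M -> imod J x.
Proof.
pose p (u : V) : Q := \pi_Q u.
have pE (u v : V) : imod J (u - v) <-> p u = p v.
  split=> [H|/eqP]; first by apply/eqP; rewrite -Quotient.idealrBE; apply/asboolP.
  by rewrite -Quotient.idealrBE => /asboolP.
have pD : {morph p : u v / u + v} by exact: Quotient.pi_add.
pose g (b : quor J) (m : M) : Q := p (pure (repr b) m).
have gE b m : g (quo J b) m = p (pure b m).
  apply/pE; have -> : pure (repr (quo J b)) m - pure b m =
      (repr (quo J b) - b) *: pure 1 m :> V.
    by rewrite scalerBl -!pureE.
  exact/im_Z/ideal_gen_pow/quo_repr.
have bal : balanced (quo J \o f) g.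
  split=> [b b' m|b m m'|b a m].
  - have [c ->] := quo_surj b; have [c' ->] := quo_surj b'.
    by rewrite -rmorphD !gE pureDl pD.
  - by rewrite /g pureDr pD.
  - have [c ->] := quo_surj b.
    by rewrite -rmorphM !gE pureZ.
have H (u : V) : tens_lift g (tens_base (quo J) u : tens (quo J \o f) M) = p u.
  have qf a : quo J (f a) = (quo J \o f) a by [].
  move: u; apply: tens_ext => [u v|u v|b m].
  - by rewrite (tens_base_rD qf) (tens_liftD bal).
  - exact: pD.
  - by rewrite (tens_base_rpure qf) (tens_liftE bal) gE.
move=> x0; have := H x; rewrite x0 (tens_lift0 bal) -(additive_0 pD) => /esym/pE.
by rewrite subr0.
Qed.
End TensQuoKer.

Section TensDer.
Variables (A B C : comPzRingType) (f : {rmorphism A -> B}) (g : {rmorphism A -> C}).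

Lemma tensr_ext (V : zmodType) (u v : tensr f g -> V) :
  {morph u : x y / x + y} -> {morph v : x y / x + y} ->
  (forall b c, u (tpure b c) = v (tpure b c)) -> u =1 v.
Proof. exact: tens_ext. Qed.

Lemma tpureMr b c b' c' :
  tpure b c * tpure b' c' = tpure (b * b') (c * c') :> tensr f g.
Proof. exact: tpureM. Qed.

Lemma tpureE b c : tpure b c = tinl f g b * tinr f g c.
Proof. by rewrite tpureMr mulr1 mul1r. Qed.

Variable d : B -> B.
Hypothesis dd : ring_der d.
Hypothesis df : forall a, d (f a) = 0.

Definition tder (x : tensr f g) : tensr f g :=
  tens_lift (fun b (c : restr g) => tpure (d b) c) x.

Let tder_bal : balanced f (fun b (c : restr g) => tpure (d b) c : tensr f g).
Proof.
have [dD dM] := dd; split=> [b b' c|b c c'|b a c].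
- by rewrite dD tpureDl.
- exact: tpureDr.
- by rewrite dM df mulr0 addr0; apply: tpureZ.
Qed.

Lemma tderE b c : tder (tpure b c) = tpure (d b) c.
Proof. exact: (tens_liftE tder_bal). Qed.

Lemma tder_der : ring_der tder.
Proof.
have [dD dM] := dd.
have tD : {morph tder : x y / x + y} by apply: (tens_liftD tder_bal).
split=> // x y; move: x; apply: tensr_ext => [x x'|x x'|b c].
- by rewrite mulrDl tD.
- by rewrite tD !mulrDl addrACA.
move: y; apply: tensr_ext => [y y'|y y'|b' c'].
- by rewrite mulrDr tD.
- by rewrite tD !mulrDr addrACA.
by rewrite tpureMr !tderE dM tpureDl !tpureMr.
Qed.
End TensDer.

(** * Coordinates on R (x) R and R (x) R (x) R *)

Section Diagonal.
Variables (K : fieldType) (R : comAlgType K).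
Local Notation RR := (RR R).
Local Notation RRR := (RRR R).
Local Notation iota := (GRing.in_alg R : {rmorphism K -> R}).
Local Notation I := (@diag2 K R).
Local Notation J := (@diag3 K R).

Lemma rr_pureE (a b : R) : tpure a b = rr1 R a * rr2 R b :> RR.
Proof. exact: tpureE. Qed.
Lemma rrr_pureE (x : RR) (c : R) : tpure x c = rr_12 R x * rrr3 R c :> RRR.
Proof. exact: tpureE. Qed.

Lemma rr_ext (V : zmodType) (u v : RR -> V) :
  {morph u : x y / x + y} -> {morph v : x y / x + y} ->
  (forall a b, u (rr1 R a * rr2 R b) = v (rr1 R a * rr2 R b)) -> u =1 v.
Proof. by move=> uD vD uv; apply: tensr_ext => // a b; rewrite rr_pureE. Qed.

Lemma rrr_ext (V : zmodType) (u v : RRR -> V) :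
  {morph u : x y / x + y} -> {morph v : x y / x + y} ->
  (forall a b c, u (rrr1 R a * rrr2 R b * rrr3 R c) =
     v (rrr1 R a * rrr2 R b * rrr3 R c)) -> u =1 v.
Proof.
move=> uD vD uv; apply: tensr_ext => // x c; rewrite rrr_pureE; move: x.
apply: rr_ext => [x y|x y|a b]; last by rewrite rmorphM; exact: uv.
- by rewrite rmorphD mulrDl uD.
- by rewrite rmorphD mulrDl vD.
Qed.

Lemma rr_mul1 r : rr_mul R (rr1 R r) = r.
Proof. by rewrite [LHS]tdescE rmorph1 mulr1. Qed.
Lemma rr_mul2 r : rr_mul R (rr2 R r) = r.
Proof. by rewrite [LHS]tdescE rmorph1 mul1r. Qed.
Lemma rrr_mul_12 x : rrr_mul R (rr_12 R x) = rr_mul R x.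
Proof. by rewrite [LHS]tdescE rmorph1 mulr1. Qed.
Lemma rrr_mul1 r : rrr_mul R (rrr1 R r) = r.
Proof. by rewrite [LHS]rrr_mul_12 rr_mul1. Qed.
Lemma rrr_mul2 r : rrr_mul R (rrr2 R r) = r.
Proof. by rewrite [LHS]rrr_mul_12 rr_mul2. Qed.
Lemma rrr_mul3 r : rrr_mul R (rrr3 R r) = r.
Proof. by rewrite [LHS]tdescE rmorph1 mul1r. Qed.
Lemma rr_12_1 r : rr_12 R (rr1 R r) = rrr1 R r. Proof. by []. Qed.
Lemma rr_12_2 r : rr_12 R (rr2 R r) = rrr2 R r. Proof. by []. Qed.
Lemma rr_13_1 r : rr_13 R (rr1 R r) = rrr1 R r.
Proof. by rewrite [LHS]tdescE rmorph1 mulr1. Qed.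
Lemma rr_13_2 r : rr_13 R (rr2 R r) = rrr3 R r.
Proof. by rewrite [LHS]tdescE rmorph1 mul1r. Qed.

Lemma diag2_sub r : I (rr1 R r - rr2 R r).
Proof. by rewrite /diag2 /= rmorphB rr_mul1 rr_mul2 subrr. Qed.

Lemma rr_pow_13 n x : ideal_pow I n x -> ideal_pow J n (rr_13 R x).
Proof. by move=> Ix; apply: ideal_gen_pow; apply: diag_pow_13. Qed.

Section Der.
Variable d : R -> R.
Hypothesis dd : ring_der d.
Hypothesis dK : forall a : K, d a%:A = 0.

Definition rr_der : RR -> RR := @tder K R R iota iota d.
Lemma rr_der_der : ring_der rr_der.
Proof. exact: tder_der. Qed.
Lemma rr_der1 r : rr_der (rr1 R r) = rr1 R (d r).
Proof. exact: tderE. Qed.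
Lemma rr_der2 r : rr_der (rr2 R r) = 0.
Proof.
rewrite [LHS](@tderE K R R iota iota d dd dK) (ring_der1 dd).
by rewrite rr_pureE rmorph0 mul0r.
Qed.

Definition rrr_der : RRR -> RRR := @tder K RR R (rr1 R \o iota) iota rr_der.
Let rr_derK a : rr_der ((rr1 R \o iota) a) = 0.
Proof. by rewrite /= rr_der1 dK rmorph0. Qed.
Lemma rrr_der_der : ring_der rrr_der.
Proof. exact: (tder_der _ rr_der_der rr_derK). Qed.
Lemma rrr_der_12 x : rrr_der (rr_12 R x) = rr_12 R (rr_der x).
Proof. exact: (tderE _ rr_der_der rr_derK). Qed.
Lemma rrr_der1 r : rrr_der (rrr1 R r) = rrr1 R (d r).
Proof. by rewrite [LHS]rrr_der_12 rr_der1. Qed.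
Lemma rrr_der3 r : rrr_der (rrr3 R r) = 0.
Proof.
rewrite [LHS](@tderE K RR R (rr1 R \o iota) iota _ rr_der_der rr_derK).
rewrite (ring_der1 rr_der_der).
by rewrite rrr_pureE rmorph0 mul0r.
Qed.
Lemma rrr_der_13 x : rrr_der (rr_13 R x) = rr_13 R (rr_der x).
Proof.
have [rD rM] := rrr_der_der; have [sD sM] := rr_der_der.
move: x; apply: rr_ext => [x y|x y|a b].
- by rewrite rmorphD rD.
- by rewrite sD rmorphD.
rewrite rmorphM rM sM rr_13_1 rr_13_2 rrr_der1 rrr_der3 rr_der1 rr_der2.
by rewrite !mulr0 !addr0 rmorphM rr_13_1 rr_13_2.
Qed.
End Der.
End Diagonal.

Definition derivation (K : fieldType) (R : comAlgType K) (V : lmodType R)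
    (d : R -> V) : Prop :=
  [/\ {morph d : x y / x + y}, forall r s, d (r * s) = r *: d s + s *: d r
    & forall a : K, d a%:A = 0].

(* A global substitute for etale coordinates: the differentials of the x i    *)
(* generate, with a splitting given by the derivations D i, which need not    *)
(* commute.                                                                   *)
Definition coordinates (K : fieldType) (R : comAlgType K) n
    (x : 'I_n -> R) (D : 'I_n -> R -> R) : Prop :=
  [/\ forall i, ring_der (D i), forall i (a : K), D i a%:A = 0
    & forall (V : lmodType R) (d : R -> V), derivation d ->
      forall r, d r = \sum_i D i r *: d (x i)].

Section StratOfFlat.
Variables (K : fieldType) (R : comAlgType K) (n : nat).
Variables (x : 'I_n -> R) (D : 'I_n -> R -> R).
Hypothesis charK : [pchar K] =i pred0.
Hypothesis xD : coordinates x D.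
Local Notation RR := (RR R).
Local Notation RRR := (RRR R).
Local Notation I := (@diag2 K R).
Local Notation J := (@diag3 K R).

Let D_der i : ring_der (D i). Proof. by case: xD. Qed.
Let D_K i (a : K) : D i a%:A = 0. Proof. by case: xD. Qed.

Definition struct_const (i j k : 'I_n) : R := D i (D j (x k)) - D j (D i (x k)).

Lemma coord_der (d : R -> R) : ring_der d -> (forall a : K, d a%:A = 0) ->
  forall r, d r = \sum_i D i r * d (x i).
Proof.
move=> [dD dM] dK; have [_ _ H] := xD; apply: (H R^o d); split=> // r s.
by rewrite dM addrC [d r * s]mulrC.
Qed.

Lemma coord_D i r : \sum_j D i (x j) * D j r = D i r.
Proof.
rewrite [RHS](coord_der (D_der i) (D_K i)).
by apply: eq_bigr => j _; rewrite mulrC.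
Qed.

(** The commutator of two derivations is a derivation, hence determined by its values at the
    [x k]. *)
Lemma coord_flat i j r :
  D i (D j r) = D j (D i r) + \sum_k struct_const i j k * D k r.
Proof.
pose d r := D i (D j r) - D j (D i r).
have dd : ring_der d.
  split=> [a b|a b]; rewrite /d.
    by rewrite !(D_der _).1 opprD addrACA.
  rewrite !(D_der _).2 !(D_der _).1 !(D_der _).2; ring.
have dK (a : K) : d a%:A = 0 by rewrite /d !D_K !(additive_0 (D_der _).1) subrr.
apply/eqP; rewrite addrC -subr_eq; apply/eqP; rewrite -/(d r) (coord_der dd dK).
by apply: eq_bigr => k _; rewrite mulrC.
Qed.

Definition nat_inv (k : nat) : R := ((k.+1%:R : K)^-1)%:A.
Lemma nat_invP k : k.+1%:R * nat_inv k = 1.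
Proof.
rewrite /nat_inv mulr_natl scalerMnl -mulr_natl mulfV ?scale1r //.
by have /pcharf0P -> := charK.
Qed.

Definition xi2 i : RR := rr1 R (x i) - rr2 R (x i).
Definition xi3 i : RRR := rrr1 R (x i) - rrr2 R (x i).

(** Modulo I^2 the map r |-> r (x) 1 - 1 (x) r is a derivation for the left structure, since its
    defect in the Leibniz rule is a product of two elements of I. The defining property of
    [coordinates] applies to it. *)
Lemma coord_diag r :
  ideal_pow I 2 (\sum_i rr1 R (D i r) * xi2 i - (rr1 R r - rr2 R r)).
Proof.
have [_ _ H] := xD.
pose V : lmodType R := restr (PPl R 1).
pose d (r : R) : V := quo (ideal_pow I 2) (rr1 R r - rr2 R r).
have dE r0 : d r0 = quo (ideal_pow I 2) (rr1 R r0 - rr2 R r0) by [].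
have VZ a (v : RR) : a *: (quo (ideal_pow I 2) v : V) =
    quo (ideal_pow I 2) (rr1 R a * v) :> V.
  by rewrite rmorphM.
have dd : derivation d.
  split=> [a b|a b|a]; rewrite !dE.
  - transitivity (quo (ideal_pow I 2)
        ((rr1 R a - rr2 R a) + (rr1 R b - rr2 R b)) : V); last exact: rmorphD.
    by congr quo; rewrite !rmorphD opprD addrACA.
  - rewrite !VZ.
    transitivity (quo (ideal_pow I 2) (rr1 R a * (rr1 R b - rr2 R b) +
      rr1 R b * (rr1 R a - rr2 R a)) : V); last exact: rmorphD.
    apply/quoP/ig_in.
    have -> : rr1 R (a * b) - rr2 R (a * b) -
       (rr1 R a * (rr1 R b - rr2 R b) + rr1 R b * (rr1 R a - rr2 R a)) =
       - ((rr1 R a - rr2 R a) * (rr1 R b - rr2 R b)).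
      by rewrite !rmorphM; ring.
    by apply: ideal_powN; apply: ideal_powS; [|apply: ideal_pow1]; apply: diag2_sub.
  - by rewrite (rr_iota R a) subrr rmorph0.
have := H V d dd r; rewrite dE => E.
apply: ideal_gen_pow; apply/quoP; rewrite [RHS]E rmorph_sum.
by apply: eq_bigr => i _; rewrite dE VZ.
Qed.

Local Notation e2 := (eul_ring (fun i => rr_der (D i)) xi2).

(** On a (x) b the derivations see only a, and [coord_diag] evaluates the sum as (a (x) 1 - 1 (x)
    a)(1 (x) b). *)
Lemma coord_eul y : ideal_pow I 2 (e2 y - (y - rr2 R (rr_mul R y))).
Proof.
have [eD eM] := eul_ring_der (fun i => rr_der_der (D_der i) (D_K i)) xi2.
have [s ->] := tens_pureP y.
rewrite (additive_sum eD) rmorph_sum rmorph_sum -!sumrB.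
apply: ideal_pow_sum => -[a b] _ /=; rewrite -/(tpure a b) rr_pureE.
rewrite [rr_mul R _]rmorphM rr_mul1 rr_mul2 [rr2 R (a * b)]rmorphM -mulrBl.
have -> : e2 (rr1 R a * rr2 R b) = rr2 R b * \sum_i rr1 R (D i a) * xi2 i.
  rewrite /eul_ring mulr_sumr; apply: eq_bigr => i _.
  rewrite (rr_der_der (D_der i) (D_K i)).2 (rr_der1 (D_der i) (D_K i)).
  by rewrite (rr_der2 (D_der i) (D_K i)); ring.
by rewrite [X in _ + - X]mulrC -mulrBr; apply/ideal_powM/coord_diag.
Qed.

Lemma coord_rad y : I y -> ideal_pow I 2 (e2 y - y).
Proof. by move=> Iy; have := coord_eul y; rewrite Iy rmorph0 subr0. Qed.

End StratOfFlat.

(** * The stratification of a flat connection *)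

Lemma linear_additive (A : pzRingType) (U V : lmodType A) (g : U -> V) :
  linear g -> {morph g : x y / x + y}.
Proof. by move=> gl x y; rewrite -[x]scale1r gl !scale1r. Qed.
Lemma linear_scale (A : pzRingType) (U V : lmodType A) (g : U -> V) :
  linear g -> forall a x, g (a *: x) = a *: g x.
Proof.
move=> gl a x; rewrite -[a *: x]addr0 gl.
by rewrite (additive_0 (linear_additive gl)) addr0.
Qed.
Lemma linear_intro (A : pzRingType) (U V : lmodType A) (g : U -> V) :
  {morph g : x y / x + y} -> (forall a x, g (a *: x) = a *: g x) -> linear g.
Proof. by move=> gD gZ a x y; rewrite gD gZ. Qed.

(** * Taylor series and the cocycle condition *)

Section StratGeneral.
Variables (K : fieldType) (R : comAlgType K) (M : lmodType R).
Local Notation RR := (RR R).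
Local Notation RRR := (RRR R).

(** The first factor of R (x) R is absorbed into [M]; the remaining shape is that of a Taylor
    expansion. *)
Lemma tens_rr_sum (u : tens (rr1 R) M) :
  exists s : seq (R * M), u = \sum_(p <- s) pure (rr2 R p.1) p.2.
Proof.
elim/tens_ind: u => [b m||x y [s ->] [t ->]|x [s ->]].
- have [s ->] := tens_pureP b; exists [seq (p.2 : R, p.1 *: m) | p <- s].
  rewrite big_map pure_suml; apply: eq_bigr => -[a c] _ /=.
  by rewrite -/(tpure a c) rr_pureE mulrC pureZ.
- by exists [::]; rewrite big_nil.
- by exists (s ++ t); rewrite big_cat.
- exists [seq (- p.1, p.2) | p <- s]; rewrite big_map -sumrN.
  apply: eq_bigr => p _ /=.
  by rewrite [RHS]pureE rmorphN scaleNr -pureE.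
Qed.

Definition pi_n n : tens (rr1 R) M -> tens (PPl R n) M :=
  tens_base (quo (ideal_pow (@diag2 K R) n.+1)).

Let qf n a : quo (ideal_pow (@diag2 K R) n.+1) (rr1 R a) = PPl R n a.
Proof. by []. Qed.
Lemma pi_nD n : {morph pi_n n : x y / x + y}.
Proof. exact: (tens_base_rD (qf n)). Qed.
Lemma pi_nZ n b u : pi_n n (b *: u) = quo _ b *: pi_n n u.
Proof. exact: (tens_baseZ (qf n)). Qed.
Lemma pi_n_pure n b m : pi_n n (pure b m) = pure (quo _ b) m.
Proof. exact: (tens_base_rpure (qf n)). Qed.
Lemma pi_n_surj n v : exists u, v = pi_n n u.
Proof. exact: tens_quo_surj. Qed.
Lemma pi_n_imod n u : imod (ideal_pow (@diag2 K R) n.+1) u -> pi_n n u = 0.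
Proof. exact: tens_quo_imod. Qed.
Lemma pi_n_ker n u : pi_n n u = 0 -> imod (ideal_pow (@diag2 K R) n.+1) u.
Proof. exact: tens_quo_ker. Qed.
Lemma pi_n_sum n (s : seq (R * M)) :
  pi_n n (\sum_(p <- s) pure (rr2 R p.1) p.2) = \sum_(p <- s) pure (PPr R n p.1) p.2.
Proof.
rewrite (additive_sum (@pi_nD n)); apply: eq_bigr => p _.
exact: pi_n_pure.
Qed.
Lemma pi_n_eq n u v :
  imod (ideal_pow (@diag2 K R) n.+1) (u - v) -> pi_n n u = pi_n n v.
Proof.
by move/pi_n_imod; rewrite (additive_sub (@pi_nD n)) => /eqP; rewrite subr_eq0 => /eqP.
Qed.

Lemma PP_proj_pi n u : tens_base (PP_proj R n) (pi_n n.+1 u) = pi_n n u.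
Proof.
have pf a : PP_proj R n (PPl R n.+1 a) = PPl R n a by apply: PP_proj_l.
move: u; apply: tens_ext => [x y|x y|b m].
- by rewrite pi_nD (tens_base_rD pf).
- exact: pi_nD.
rewrite !pi_n_pure (tens_base_rpure pf); congr pure.
exact: quo_mapE.
Qed.

Section Pullback.
Variable eps : forall n, tens (PPr R n) M -> tens (PPl R n) M.
Hypothesis eps_lin : forall n, linear (@eps n).
Arguments eps : clear implicits.

Definition theta n m := eps n (pure 1 m).

Lemma eps_pure n b m : eps n (pure b m) = b *: theta n m.
Proof. by rewrite pureE (linear_scale (@eps_lin n)). Qed.
Lemma thetaD n : {morph theta n : x y / x + y}.
Proof. by move=> x y; rewrite /theta pureDr (linear_additive (@eps_lin n)). Qed.
Lemma thetaZ n r m : theta n (r *: m) = PPr R n r *: theta n m.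
Proof. by rewrite /theta -pureZ mul1r eps_pure. Qed.

Section One.
Variables (n : nat) (h : {rmorphism PP R n -> PPP R n}).
Variables (f f' : {rmorphism R -> PPP R n}).
Hypothesis hl : forall r, h (PPl R n r) = f' r.
Hypothesis hr : forall r, h (PPr R n r) = f r.
Local Notation pb := (@pullback K R M eps n h f f').

Lemma pullback_pure b m : pb (pure b m) = b *: tens_base h (theta n m).
Proof. exact: (tens_liftE (pullback_bal hl hr (@eps_lin n))). Qed.
Lemma pullbackD : {morph pb : x y / x + y}.
Proof. exact: (tens_liftD (pullback_bal hl hr (@eps_lin n))). Qed.
Lemma pullbackZ c x : pb (c *: x) = c *: pb x.
Proof.
move: x; apply: tens_ext => [x y|x y|b m].
- by rewrite scalerDr pullbackD.
- by rewrite pullbackD scalerDr.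
- by rewrite scale_pure !pullback_pure scalerA.
Qed.
End One.

Lemma pullback_12_23 n m (s : seq (R * M)) :
  theta n m = \sum_(p <- s) pure (PPr R n p.1) p.2 ->
  @pullback K R M eps n (p12 R n) (PPP2 R n) (PPP1 R n)
    (@pullback K R M eps n (p23 R n) (PPP3 R n) (PPP2 R n) (pure 1 m)) =
  \sum_(p <- s) PPP3 R n p.1 *: tens_base (p12 R n) (theta n p.2).
Proof.
move=> E; rewrite (pullback_pure (@p23_l K R n) (@p23_r K R n)) scale1r E.
rewrite (additive_sum (tens_base_rD (@p23_l K R n))).
rewrite (additive_sum (pullbackD (@p12_l K R n) (@p12_r K R n))).
apply: eq_bigr => p _; rewrite (tens_base_rpure (@p23_l K R n)) p23_r.
exact: pullback_pure (@p12_l K R n) (@p12_r K R n) _ _.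
Qed.

Lemma pullback_13 n m (s : seq (R * M)) :
  theta n m = \sum_(p <- s) pure (PPr R n p.1) p.2 ->
  @pullback K R M eps n (p13 R n) (PPP3 R n) (PPP1 R n) (pure 1 m) =
  \sum_(p <- s) pure (PPP3 R n p.1) p.2.
Proof.
move=> E; rewrite (pullback_pure (@p13_l K R n) (@p13_r K R n)) scale1r E.
rewrite (additive_sum (tens_base_rD (@p13_l K R n))).
by apply: eq_bigr => p _; rewrite (tens_base_rpure (@p13_l K R n)) p13_r.
Qed.

(** The cocycle condition on generators. One expansion [s] for each [m] is enough, because
    [pullback_12_23] and [pullback_13] compute both sides from any expansion. *)
Definition theta_cocycle : Prop := forall n m, exists2 s : seq (R * M),
  theta n m = \sum_(p <- s) pure (PPr R n p.1) p.2 &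
  \sum_(p <- s) PPP3 R n p.1 *: tens_base (p12 R n) (theta n p.2) =
  \sum_(p <- s) pure (PPP3 R n p.1) p.2 :> tens (PPP1 R n) M.

Lemma theta_cocycleP : theta_cocycle -> forall n x,
  @pullback K R M eps n (p12 R n) (PPP2 R n) (PPP1 R n)
    (@pullback K R M eps n (p23 R n) (PPP3 R n) (PPP2 R n) x) =
  @pullback K R M eps n (p13 R n) (PPP3 R n) (PPP1 R n) x.
Proof.
move=> H n; have D12 := pullbackD (@p12_l K R n) (@p12_r K R n).
have D23 := pullbackD (@p23_l K R n) (@p23_r K R n).
have D13 := pullbackD (@p13_l K R n) (@p13_r K R n).
apply: tens_ext => [x y|x y|b m]; first by rewrite D23 D12.
  exact: D13.
rewrite pureE (pullbackZ (@p23_l K R n) (@p23_r K R n)).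
rewrite (pullbackZ (@p12_l K R n) (@p12_r K R n)).
rewrite (pullbackZ (@p13_l K R n) (@p13_r K R n)); congr (_ *: _).
have [s E1 E2] := H n m.
by rewrite (pullback_12_23 E1) (pullback_13 E1).
Qed.

Lemma strat_cocycle n m (s : seq (R * M)) : stratification eps ->
  theta n m = \sum_(p <- s) pure (PPr R n p.1) p.2 ->
  \sum_(p <- s) PPP3 R n p.1 *: tens_base (p12 R n) (theta n p.2) =
  \sum_(p <- s) pure (PPP3 R n p.1) p.2 :> tens (PPP1 R n) M.
Proof.
case=> _ _ _ H E.
by rewrite -(pullback_12_23 E) -(pullback_13 E) H.
Qed.
End Pullback.

Section Flip.

Let flip_iota (a : K) : rr2 R (GRing.in_alg R a) = rr1 R (GRing.in_alg R a).
Proof. by rewrite (rr_iota R a). Qed.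

Definition rr_flip : {rmorphism RR -> RR} := tdesc flip_iota.
Lemma rr_flip1 r : rr_flip (rr1 R r) = rr2 R r.
Proof. by rewrite [LHS]tdescE rmorph1 mulr1. Qed.
Lemma rr_flip2 r : rr_flip (rr2 R r) = rr1 R r.
Proof. by rewrite [LHS]tdescE rmorph1 mul1r. Qed.
Lemma rr_flipK : involutive rr_flip.
Proof.
apply: rr_ext => [u v|//|a b]; first by rewrite !rmorphD.
by rewrite !rmorphM rr_flip1 !rr_flip2 rr_flip1.
Qed.
Lemma rr_mul_flip x : rr_mul R (rr_flip x) = rr_mul R x.
Proof.
move: x; apply: rr_ext => [x y|x y|a b]; rewrite ?rmorphD //.
by rewrite !rmorphM rr_flip1 rr_flip2 !rr_mul1 !rr_mul2.
Qed.
Let flip_diag n x : ideal_pow (@diag2 K R) n x ->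
  ideal_gen (ideal_pow (@diag2 K R) n) (rr_flip x).
Proof.
move=> Ix; apply: ig_in; apply: ideal_pow_map Ix => y.
by rewrite /diag2 /= rr_mul_flip.
Qed.
Definition PP_flip n : {rmorphism PP R n -> PP R n} := quo_map (@flip_diag n.+1).
Lemma PP_flip_l n r : PP_flip n (PPl R n r) = PPr R n r.
Proof. by rewrite [LHS]quo_mapE rr_flip1. Qed.
Lemma PP_flip_r n r : PP_flip n (PPr R n r) = PPl R n r.
Proof. by rewrite [LHS]quo_mapE rr_flip2. Qed.
Lemma PP_flipK n : involutive (PP_flip n).
Proof.
have E y : PP_flip n (quo _ y) = quo _ (rr_flip y) by apply: quo_mapE.
by move=> x; have [y ->] := quo_surj x; rewrite !E rr_flipK.
Qed.

Let fold_iota (a : K) :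
  (idfun : RR -> RR) ((rr1 R \o GRing.in_alg R) a) = rr1 R (GRing.in_alg R a).
Proof. by []. Qed.

(** This is a (x) b (x) c |-> ac (x) b, which identifies the first and third points. *)
Definition rrr_fold : {rmorphism RRR -> RR} :=
  @tdesc K RR R (rr1 R \o GRing.in_alg R) (GRing.in_alg R) RR idfun (rr1 R) fold_iota.
Lemma rrr_fold_12 x : rrr_fold (rr_12 R x) = x.
Proof. by rewrite [LHS]tdescE rmorph1 mulr1. Qed.
Lemma rrr_fold3 r : rrr_fold (rrr3 R r) = rr1 R r.
Proof. by rewrite [LHS]tdescE rmorph1 mul1r. Qed.
Lemma rr_mul_fold x : rr_mul R (rrr_fold x) = rrr_mul R x.
Proof.
move: x; apply: rrr_ext => [x y|x y|a b c]; rewrite ?rmorphD //.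
rewrite !rmorphM rrr_mul1 rrr_mul2 rrr_mul3 rrr_fold3 rr_mul1.
by rewrite -rr_12_1 -rr_12_2 !rrr_fold_12 rr_mul1 rr_mul2.
Qed.
Let fold_diag n x : ideal_pow (@diag3 K R) n x ->
  ideal_gen (ideal_pow (@diag2 K R) n) (rrr_fold x).
Proof.
move=> Ix; apply: ig_in; apply: ideal_pow_map Ix => y.
by rewrite /diag2 /diag3 /= rr_mul_fold.
Qed.
Definition PPP_fold n : {rmorphism PPP R n -> PP R n} := quo_map (@fold_diag n.+1).
Lemma PPP_fold_p12 n x : PPP_fold n (p12 R n x) = x.
Proof.
have E y : PPP_fold n (quo _ y) = quo _ (rrr_fold y) by apply: quo_mapE.
have E' y : p12 R n (quo _ y) = quo _ (rr_12 R y) by apply: quo_mapE.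
by have [y ->] := quo_surj x; rewrite E' E rrr_fold_12.
Qed.
Lemma PPP_fold3 n r : PPP_fold n (PPP3 R n r) = PPl R n r.
Proof. by rewrite [LHS]quo_mapE rrr_fold3. Qed.
End Flip.

(* Restricting the cocycle condition to x = z shows that eps conjugated by    *)
(* the flip of the two factors is inverse to eps.                             *)
Lemma cocycle_bijective (eps : forall n, tens (PPr R n) M -> tens (PPl R n) M) :
  (forall n, linear (@eps n)) -> theta_cocycle eps ->
  (forall n m (s : seq (R * M)), theta eps n m = \sum_(p <- s) pure (PPr R n p.1) p.2 ->
     \sum_(p <- s) p.1 *: p.2 = m) ->
  forall n, bijective (@eps n).
Proof.
move=> lin coc unit n.
pose s x : tens (PPr R n) M := tens_base (PP_flip n) (x : tens (PPl R n) M).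
pose t x : tens (PPl R n) M := tens_base (PP_flip n) (x : tens (PPr R n) M).
have fl := @PP_flip_l n; have fr := @PP_flip_r n.
have sD : {morph s : x y / x + y} := tens_base_rD fl.
have tD : {morph t : x y / x + y} := tens_base_rD fr.
have eD : {morph @eps n : x y / x + y} := linear_additive (lin n).
have ts x : t (s x) = x.
  move: x; apply: tens_ext => [x y|x y|b m] //; first by rewrite sD tD.
  by rewrite /s (tens_base_rpure fl) /t (tens_base_rpure fr) PP_flipK.
have st x : s (t x) = x.
  move: x; apply: tens_ext => [x y|x y|b m] //; first by rewrite tD sD.
  by rewrite /t (tens_base_rpure fr) /s (tens_base_rpure fl) PP_flipK.
(* Folded along [PPP_fold], the left side of the cocycle condition becomes [eps] of the flipped
   Taylor series of [m], and the right side becomes 1 (x) (sum of the [p.1 *: p.2]), which [unit]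
   identifies with [pure 1 m]. *)
have key x : eps n (s (eps n (s x))) = x.
  move: x; apply: tens_ext => [x y|x y|b m] //; first by rewrite sD eD sD eD.
  rewrite /s (tens_base_rpure fl) (eps_pure lin) (tens_baseZ fl) PP_flipK.
  rewrite (linear_scale (lin n)) [RHS]pureE; congr (_ *: _).
  have [l E1 E2] := coc n m; rewrite E1 (additive_sum (tens_base_rD fl)).
  rewrite (additive_sum eD).
  have F1 a : PPP_fold n (PPP1 R n a) = PPl R n a.
    by rewrite -(@p12_l K R n a) PPP_fold_p12.
  have := congr1 (fun y => tens_base (PPP_fold n) y : tens (PPl R n) M) E2.
  rewrite /= !(additive_sum (tens_base_rD F1)).
  rewrite -[in pure 1 m](unit n m l E1) pure_sumr => E3.
  transitivity (\sum_(p <- l) tens_base (PPP_fold n)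
    (PPP3 R n p.1 *: (tens_base (p12 R n) (theta eps n p.2) :
       tens (PPP1 R n) M)) : tens (PPl R n) M).
    apply: eq_bigr => p _; rewrite (tens_base_rpure fl) fr (eps_pure lin).
    rewrite (tens_baseZ F1) PPP_fold3; congr (_ *: _).
    rewrite (@tens_base_square _ _ _ _ _ (PPl R n) (PPP1 R n) (PPl R n) (PPl R n) M
      (p12 R n) (PPP_fold n) idfun idfun (@p12_l K R n) F1 _ _ (@PPP_fold_p12 n)) //.
    by rewrite !tens_base_eq_id.
  rewrite E3; apply: eq_bigr => p _.
  by rewrite (tens_base_rpure F1) PPP_fold3 -pureZ mul1r.
exists (fun y => s (eps n (s y))) => y //.
by rewrite -{1}(st y) key st.
Qed.
End StratGeneral.

(** The matrix D_i(x_j) is the projector of R^n onto the chosen lift of Omega_1. The third condition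
    says that the family of the [nM i m] is fixed by it, that is, comes from an element of Omega_1
    (x) M; the fourth is vanishing curvature. *)
Definition flat_nabla (K : fieldType) (R : comAlgType K) n
    (x : 'I_n -> R) (D : 'I_n -> R -> R) (M : lmodType R) (nM : 'I_n -> M -> M) : Prop :=
  [/\ forall i, {morph nM i : m m' / m + m'},
      forall i a m, nM i (a *: m) = D i a *: m + a *: nM i m,
      forall i m, \sum_j D i (x j) *: nM j m = nM i m
    & forall i j m,
      nM i (nM j m) = nM j (nM i m) + \sum_k struct_const x D i j k *: nM k m].

Section StratOfFlat.
Variables (K : fieldType) (R : comAlgType K) (n : nat).
Variables (x : 'I_n -> R) (D : 'I_n -> R -> R).
Hypothesis charK : [pchar K] =i pred0.
Hypothesis xD : coordinates x D.
Variables (M : lmodType R) (nM : 'I_n -> M -> M).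
Local Notation RR := (RR R).
Local Notation RRR := (RRR R).
Local Notation I := (@diag2 K R).
Local Notation J := (@diag3 K R).
Local Notation d2 := (fun i => rr_der (D i)).
Local Notation d3 := (fun i => rrr_der (D i)).
Local Notation inv := (nat_inv R).

Definition eul2 : tens (rr1 R) M -> tens (rr1 R) M := eul d2 nM (xi2 x).
Definition pr2 : nat -> tens (rr1 R) M -> tens (rr1 R) M := pr d2 nM (xi2 x) inv.
Definition theta_of N (m : M) : tens (PPl R N) M := pi_n N (pr2 N (pure 1 m)).
Definition eps_of N (v : tens (PPr R N) M) : tens (PPl R N) M :=
  tens_lift (fun b m => b *: theta_of N m) v.

Hypothesis flat : flat_nabla x D nM.

Let D_der i : ring_der (D i). Proof. by case: xD. Qed.
Let D_K i (a : K) : D i a%:A = 0. Proof. by case: xD. Qed.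
Let nMD i : {morph nM i : m m' / m + m'}. Proof. by case: flat. Qed.
Let nMZ i a m : nM i (a *: m) = D i a *: m + a *: nM i m. Proof. by case: flat. Qed.
Let nMy i m : \sum_j D i (x j) *: nM j m = nM i m. Proof. by case: flat. Qed.
Let nMflat i j m :
  nM i (nM j m) = nM j (nM i m) + \sum_k struct_const x D i j k *: nM k m.
Proof. by case: flat. Qed.
Let d2_der i := rr_der_der (D_der i) (D_K i).
Let d2f i a : rr_der (D i) (rr1 R a) = rr1 R (D i a).
Proof. exact: (rr_der1 (D_der i) (D_K i)). Qed.
Let d3_der i := rrr_der_der (D_der i) (D_K i).
Let d3f i a : rrr_der (D i) (rrr1 R a) = rrr1 R (D i a).
Proof. exact: (rrr_der1 (D_der i) (D_K i)). Qed.
Let invP := nat_invP R charK.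
Let xi2I i : I (xi2 x i). Proof. exact: diag2_sub. Qed.
Let rad := coord_rad xD.

Lemma eul2D : {morph eul2 : u v / u + v}.
Proof. exact: eulD. Qed.
Lemma pr2D N : {morph pr2 N : u v / u + v}.
Proof. exact: prD. Qed.
Lemma pr2_imod1 N u : imod (ideal_pow I 1) u -> imod (ideal_pow I N.+1) (pr2 N u).
Proof. exact: (pr_imod1 d2_der d2f nMD nMZ invP xi2I rad). Qed.
Lemma eul2_pr2_imod N u : imod (ideal_pow I N.+1) (eul2 (pr2 N u)).
Proof. exact: (eul_pr_imod d2_der d2f nMD nMZ invP xi2I rad). Qed.
Lemma pr2_id k N u : imod (ideal_pow I k) (eul2 u) -> imod (ideal_pow I k) (pr2 N u - u).
Proof. exact: (pr_id d2_der d2f nMD nMZ invP xi2I). Qed.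

Let d2y i b : \sum_j rr1 R (D i (x j)) * rr_der (D j) b = rr_der (D i) b.
Proof.
move: b; apply: rr_ext => [u v|u v|a b].
- by rewrite -big_split; apply: eq_bigr => j _; rewrite (d2_der j).1 mulrDr.
- exact: (d2_der i).1.
rewrite (d2_der i).2 d2f (rr_der2 (D_der i) (D_K i)) mulr0 addr0 -(coord_D xD).
rewrite rmorph_sum mulr_suml; apply: eq_bigr => j _.
by rewrite (d2_der j).2 d2f (rr_der2 (D_der j) (D_K j)) rmorphM; ring.
Qed.

Let d2flat i j b : rr_der (D i) (rr_der (D j) b) = rr_der (D j) (rr_der (D i) b) +
  \sum_k rr1 R (struct_const x D i j k) * rr_der (D k) b.
Proof.
have dD k := (d2_der k).1.
move: b; apply: rr_ext => [u v|u v|a b].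
- by rewrite !dD.
- rewrite !dD addrACA -big_split; congr (_ + _).
  by apply: eq_bigr => k _; rewrite dD mulrDr.
have E k c : rr_der (D k) (rr1 R c * rr2 R b) = rr1 R (D k c) * rr2 R b.
  by rewrite (d2_der k).2 d2f (rr_der2 (D_der k) (D_K k)) mulr0 addr0.
rewrite !E (coord_flat xD) rmorphD mulrDl; congr (_ + _).
rewrite rmorph_sum mulr_suml; apply: eq_bigr => k _.
by rewrite E rmorphM mulrA.
Qed.

Let d2xi i j : rr_der (D i) (xi2 x j) = rr1 R (D i (x j)).
Proof.
rewrite (additive_sub (d2_der i).1) d2f.
by rewrite (rr_der2 (D_der i) (D_K i)) subr0.
Qed.

(** Horizontality of the Taylor series in its first factor, up to the one order lost by
    differentiating. *)
Lemma nab_pr2_imod N i u : imod (ideal_pow I N) (nab d2 nM i (pr2 N u)).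
Proof.
exact: (nab_pr_imod d2_der d2f nMD nMZ invP xi2I rad d2xi d2y nMy d2flat nMflat).
Qed.

Lemma theta_ofD N : {morph theta_of N : m m' / m + m'}.
Proof. by move=> m m'; rewrite /theta_of pureDr pr2D pi_nD. Qed.

Lemma eul_ring_rr2 r : eul_ring d2 (xi2 x) (rr2 R r) = 0.
Proof.
by apply: big1 => i _; rewrite (rr_der2 (D_der i) (D_K i)) mulr0.
Qed.

Lemma pr2_rr2 N r u : pr2 N (rr2 R r *: u) = rr2 R r *: pr2 N u.
Proof. by apply: (prZ d2_der d2f nMD nMZ); apply: eul_ring_rr2. Qed.

(** The lifts of r m and of (1 (x) r) m differ by (r (x) 1 - 1 (x) r) m, which lies in I V and is
    sent to order N+1 by [pr2]. The second factor is constant for E, so it passes through [pr2]. *)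
Lemma theta_ofZ N r m : theta_of N (r *: m) = PPr R N r *: theta_of N m.
Proof.
rewrite /theta_of -pi_nZ -pr2_rr2; apply: pi_n_eq.
rewrite -(additive_sub (@pr2D N)) pure_scale -scalerBl; apply: pr2_imod1.
by apply: im_Z; apply: ideal_pow1; apply: diag2_sub.
Qed.

Let eps_bal N : balanced (PPr R N) (fun b m => b *: theta_of N m).
Proof.
split=> [b b' m|b m m'|b a m]; first by rewrite scalerDl.
  by rewrite theta_ofD scalerDr.
by rewrite theta_ofZ scalerA.
Qed.

Lemma eps_of_pure N b m : eps_of (pure b m) = b *: theta_of N m.
Proof. exact: (tens_liftE (@eps_bal N)). Qed.

Lemma eps_of_linear N : linear (@eps_of N).
Proof.
have eD : {morph @eps_of N : u v / u + v} by exact: (tens_liftD (@eps_bal N)).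
apply: linear_intro => // a; apply: tens_ext => [u v|u v|b m].
- by rewrite scalerDr eD.
- by rewrite eD scalerDr.
- by rewrite scale_pure !eps_of_pure scalerA.
Qed.

Lemma theta_eps_of N m : theta eps_of N m = theta_of N m.
Proof. by rewrite /theta eps_of_pure scale1r. Qed.

Definition mul_M (u : tens (rr1 R) M) : M := tens_lift (fun b m => rr_mul R b *: m) u.
Let mul_bal : balanced (rr1 R) (fun b (m : M) => rr_mul R b *: m).
Proof.
split=> [b b' m|b m m'|b a m]; first by rewrite rmorphD scalerDl.
  by rewrite scalerDr.
by rewrite rmorphM rr_mul1 scalerA.
Qed.
Lemma mul_M_pure b m : mul_M (pure b m) = rr_mul R b *: m.
Proof. exact: (tens_liftE mul_bal). Qed.
Lemma mul_MD : {morph mul_M : u v / u + v}.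
Proof. exact: (tens_liftD mul_bal). Qed.
Lemma mul_MZ b u : mul_M (b *: u) = rr_mul R b *: mul_M u.
Proof.
move: u; apply: tens_ext => [u v|u v|c m].
- by rewrite scalerDr mul_MD.
- by rewrite mul_MD scalerDr.
- by rewrite scale_pure !mul_M_pure rmorphM scalerA.
Qed.
Lemma mul_M_imod k u : imod (ideal_pow I k.+1) u -> mul_M u = 0.
Proof.
move/(imod_pow_leq (ltn0Sn k)).
elim=> {u} [b v Ib||u v _ Hu _ Hv].
- rewrite mul_MZ; suff -> : rr_mul R b = 0 by rewrite scale0r.
  elim: Ib => [_ [a [c [Ia _ ->]]]||a c _ Ha _ Hc|a c _ Hc].
  + by rewrite rmorphM Ia mul0r.
  + by rewrite rmorph0.
  + by rewrite rmorphD Ha Hc addr0.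
  + by rewrite rmorphM Hc mulr0.
- exact: (additive_0 mul_MD).
- by rewrite mul_MD Hu Hv addr0.
Qed.

Lemma mul_M_pr2 N u : mul_M (pr2 N u) = mul_M u.
Proof.
apply/eqP; rewrite -subr_eq0 -(additive_sub mul_MD); apply/eqP.
by apply: (@mul_M_imod 0); apply: pr2_id; apply: eul_imod1.
Qed.

(** Restrict to the diagonal: E has values in I V, so [pr2] does not change the restriction. *)
Lemma theta_of_unit N m (s : seq (R * M)) :
  theta_of N m = \sum_(p <- s) pure (PPr R N p.1) p.2 ->
  \sum_(p <- s) p.1 *: p.2 = m.
Proof.
rewrite -pi_n_sum => /eqP; rewrite -subr_eq0 -(additive_sub (@pi_nD _ _ M N)).
move/eqP/pi_n_ker/mul_M_imod/eqP; rewrite (additive_sub mul_MD) subr_eq0.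
rewrite mul_M_pr2 mul_M_pure rmorph1 scale1r (additive_sum mul_MD) => /eqP ->.
by apply: eq_bigr => p _; rewrite mul_M_pure rr_mul2.
Qed.

(** The additional factor 1 - E/(N+1) changes the vector by a multiple of E([pr2 N]), which is
    already of order N+1. *)
Lemma theta_of_proj N m : tens_base (PP_proj R N) (theta_of N.+1 m) = theta_of N m.
Proof.
rewrite /theta_of PP_proj_pi /=; apply: pi_n_eq.
by rewrite addrAC subrr add0r; apply/imod_powN/imod_powZ/eul2_pr2_imod.
Qed.

Local Notation tb12 := (tens_base (rr_12 R) : tens (rr1 R) M -> tens (rrr1 R) M).
Local Notation tb13 := (tens_base (rr_13 R) : tens (rr1 R) M -> tens (rrr1 R) M).
Let f12 a : rr_12 R (rr1 R a) = rrr1 R a. Proof. by []. Qed.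
Let f13 a : rr_13 R (rr1 R a) = rrr1 R a. Proof. exact: rr_13_1. Qed.
Local Notation nab2 := (nab (f := rr1 R) d2 nM).
Local Notation nab3 := (nab (f := rrr1 R) d3 nM).
Local Notation eul3 := (eul (f := rrr1 R) d3 nM (xi3 x)).
Local Notation pr3 := (pr (f := rrr1 R) d3 nM (xi3 x) inv).

Let nab_12 i u : nab3 i (tb12 u) = tb12 (nab2 i u).
Proof.
move: u; apply: tens_ext => [u v|u v|b m].
- by rewrite (tens_base_rD f12) (nabD d3_der d3f nMD nMZ).
- by rewrite (nabD d2_der d2f nMD nMZ) (tens_base_rD f12).
rewrite (tens_base_rpure f12) (nab_pure d2_der d2f nMD nMZ) (tens_base_rD f12).
rewrite (nab_pure d3_der d3f nMD nMZ) !(tens_base_rpure f12).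
by rewrite (rrr_der_12 (D_der i) (D_K i)).
Qed.
Let nab_13 i u : nab3 i (tb13 u) = tb13 (nab2 i u).
Proof.
move: u; apply: tens_ext => [u v|u v|b m].
- by rewrite (tens_base_rD f13) (nabD d3_der d3f nMD nMZ).
- by rewrite (nabD d2_der d2f nMD nMZ) (tens_base_rD f13).
rewrite (tens_base_rpure f13) (nab_pure d2_der d2f nMD nMZ) (tens_base_rD f13).
rewrite (nab_pure d3_der d3f nMD nMZ) !(tens_base_rpure f13).
by rewrite (rrr_der_13 (D_der i) (D_K i)).
Qed.
Let eul_12 u : eul3 (tb12 u) = tb12 (eul2 u).
Proof.
rewrite /eul2 /eul (additive_sum (tens_base_rD f12)); apply: eq_bigr => i _.
by rewrite nab_12 (tens_baseZ f12) /xi3 /xi2 rmorphB.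
Qed.
Let pr_12 N u : pr3 N (tb12 u) = tb12 (pr2 N u).
Proof.
elim: N => //= N ->; rewrite (additive_sub (tens_base_rD f12)).
by rewrite (tens_baseZ f12) eul_12.
Qed.

Let xi3J i : J (xi3 x i).
Proof. by rewrite /diag3 /= rmorphB rrr_mul1 rrr_mul2 subrr. Qed.

(** Both sides are lifts of the same object to R (x) R (x) R: one is [w], the Taylor series between
    points 1 and 3, and the other is its projection [pr3 N w] along points 1 and 2. Horizontality of
    [w] in the first factor makes the projection act trivially. *)
Lemma eps_of_cocycle : theta_cocycle eps_of.
Proof.
move=> N m; have [s E] := tens_rr_sum (pr2 N (pure 1 m)).
exists s; first by rewrite theta_eps_of /theta_of E pi_n_sum.
pose Pi : tens (rrr1 R) M -> tens (PPP1 R N) M := tens_base (quo (ideal_pow J N.+1)).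
have qf a : quo (ideal_pow J N.+1) (rrr1 R a) = PPP1 R N a by [].
have PiD : {morph Pi : u v / u + v} := tens_base_rD qf.
pose w : tens (rrr1 R) M := \sum_(p <- s) pure (rrr3 R p.1) p.2.
have w13 : w = tb13 (pr2 N (pure 1 m)).
  rewrite E (additive_sum (tens_base_rD f13)); apply: eq_bigr => p _.
  by rewrite (tens_base_rpure f13) rr_13_2.
(* The third factor is constant for [eul3], so [pr3] passes to each [pure 1 p.2], where it is the
   Taylor series pulled back along the first two factors. *)
have E1 : \sum_(p <- s) PPP3 R N p.1 *: tens_base (p12 R N) (theta eps_of N p.2) =
    Pi (pr3 N w).
  rewrite /w (additive_sum (prD d3_der d3f nMD nMZ (xi3 x) inv N)) (additive_sum PiD).
  apply: eq_bigr => p _; rewrite [pure (rrr3 R _) _]pureE.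
  rewrite (prZ d3_der d3f nMD nMZ); last first.
    by apply: big1 => i _; rewrite (rrr_der3 (D_der i) (D_K i)) mulr0.
  rewrite [RHS](tens_baseZ qf); congr (_ *: _).
  have -> : pure 1 p.2 = tb12 (pure 1 p.2) by rewrite (tens_base_rpure f12) rmorph1.
  rewrite theta_eps_of pr_12 /theta_of.
  apply: (@tens_base_square _ _ _ _ _ (rr1 R) (PPl R N) (PPP1 R N) (rrr1 R) M
    (quo _) (p12 R N) (rr_12 R) (quo _)) => // [a|b]; first exact: p12_l.
  exact: quo_mapE.
have E2 : \sum_(p <- s) pure (PPP3 R N p.1) p.2 = Pi w.
  by rewrite (additive_sum PiD); apply: eq_bigr => p _; rewrite /Pi (tens_base_rpure qf).
rewrite E1 E2; apply/eqP; rewrite -subr_eq0 -(additive_sub PiD); apply/eqP.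
apply: tens_quo_imod.
apply: (pr_id d3_der d3f nMD nMZ invP xi3J).
(* Horizontality gives order N only; the coefficient [xi3], lying in J, supplies the missing
   order. *)
apply: imod_sum => i _; apply: imod_powS => //.
rewrite w13 nab_13.
apply: (tens_base_rimod f13 _ (nab_pr2_imod N i (pure 1 m))) => b.
exact: rr_pow_13.
Qed.

Lemma eps_of_strat : stratification eps_of.
Proof.
split=> [N|N|b m|].
- split; first exact: eps_of_linear.
  apply: cocycle_bijective; [exact: eps_of_linear|exact: eps_of_cocycle|].
  by move=> k m s; rewrite theta_eps_of; apply: theta_of_unit.
- have pl a : PP_proj R N (PPl R N.+1 a) = PPl R N a by apply: PP_proj_l.
  have pp a : PP_proj R N (PPr R N.+1 a) = PPr R N a by apply: PP_proj_r.
  have eD k := linear_additive (@eps_of_linear k).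
  apply: tens_ext => [u v|u v|b m]; first by rewrite eD (tens_base_rD pl).
    by rewrite (tens_base_rD pp) eD.
  rewrite eps_of_pure (tens_baseZ pl) (tens_base_rpure pp) eps_of_pure.
  by rewrite theta_of_proj.
- by rewrite eps_of_pure /theta_of /= pi_n_pure rmorph1 scale_pure mulr1.
- by apply: theta_cocycleP; [exact: eps_of_linear|exact: eps_of_cocycle].
Qed.
End StratOfFlat.

(** * The connection of a stratification *)

Lemma ps_coef0M (A : comPzRingType) (a b : pseries A) : (a * b) 0%N = a 0%N * b 0%N.
Proof. by rewrite ps_coefM /conv big_ord1. Qed.

Section PSeriesFiltration.
Variable B : comPzRingType.

Definition ps_val (n : nat) : set (pseries B) :=
  [set a | forall k, (k < n)%N -> a k = 0].
Definition ps2_val (n : nat) : set (pseries (pseries B)) :=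
  [set a | forall k l, (k + l < n)%N -> a k l = 0].

Lemma ps_val_pow n : ideal_pow (ps_val 1) n `<=` ps_val n.
Proof.
elim: n => [//|n IH]; apply: ideal_gen_sub =>
  [_ [a [b [Ha Hb ->]]] k kn|//|a b Ha Hb k kn|a b Hb k kn].
- rewrite ps_coefM; apply: big1 => -[[|i] ik] _ /=; first by rewrite Ha ?mul0r.
  rewrite (IH _ Hb) ?mulr0 //; lia.
- by rewrite ps_coefD Ha // Hb // addr0.
- rewrite ps_coefM; apply: big1 => i _; rewrite Hb ?mulr0 //.
  by apply: leq_ltn_trans kn; apply: leq_subr.
Qed.

Lemma ps2_val_pow n : ideal_pow (ps2_val 1) n `<=` ps2_val n.
Proof.
have coef (a b : pseries (pseries B)) k l : (a * b) k l =
    conv (fun i i' => conv (fun j j' => a i j * b i' j') l) k.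
  by rewrite ps_coefM /conv ps_coef_sum.
elim: n => [//|n IH]; apply: ideal_gen_sub =>
  [_ [a [b [Ha Hb ->]]] k l kn|//|a b Ha Hb k l kn|a b Hb k l kn].
- rewrite coef; apply: big1 => -[i ik] _ /=; apply: big1 => -[j jl] _ /=.
  have [/eqP|ij] := posnP (i + j).
    by rewrite addn_eq0 => /andP[/eqP-> /eqP->]; rewrite Ha // mul0r.
  rewrite (IH _ Hb) ?mulr0 //.
  lia.
- by rewrite !ps_coefD Ha // Hb // addr0.
- rewrite coef; apply: big1 => i _; apply: big1 => j _; rewrite Hb ?mulr0 //.
  by apply: leq_ltn_trans kn; apply: leq_add; apply: leq_subr.
Qed.
End PSeriesFiltration.

Section PSeriesConst.
Variables (A B : comPzRingType) (f : {rmorphism A -> B}).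

Definition ps_cst (a : A) : pseries B := ps_mono (f a) 0.

Fact ps_cst_nmod : nmod_morphism ps_cst.
Proof.
split=> [|x y]; last by rewrite /ps_cst rmorphD ps_monoD.
by apply/funext => n; rewrite /ps_cst rmorph0 /ps_mono mul0rn.
Qed.
Fact ps_cst_monoid : monoid_morphism ps_cst.
Proof.
split=> [|x y]; first by rewrite /ps_cst rmorph1.
by rewrite /ps_cst rmorphM ps_monoM.
Qed.
HB.instance Definition _ :=
  GRing.isNmodMorphism.Build A (pseries B) ps_cst ps_cst_nmod.
HB.instance Definition _ :=
  GRing.isMonoidMorphism.Build A (pseries B) ps_cst ps_cst_monoid.

Lemma ps_cst0 a : ps_cst a 0%N = f a.
Proof. by rewrite /ps_cst /ps_mono mulr1n. Qed.
Lemma ps_mul_cst (u : pseries B) a n : (u * ps_cst a) n = u n * f a.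
Proof.
rewrite mulrC ps_coefM /conv big_ord_recl /= subn0 ps_cst0 big1 ?addr0 1?mulrC // => i _.
by rewrite /ps_cst /ps_mono /= mulr0n mul0r.
Qed.
End PSeriesConst.

Section Descent.
Variables (K : fieldType) (R : comAlgType K) (C : comPzRingType).
Local Notation RR := (RR R).
Local Notation RRR := (RRR R).
Variables al be ga : {rmorphism R -> C}.
Hypothesis ab : forall a : K, al a%:A = be a%:A.
Hypothesis ac : forall a : K, al a%:A = ga a%:A.

Definition rr_desc : {rmorphism RR -> C} :=
  @tdesc K R R (GRing.in_alg R) (GRing.in_alg R) C al be ab.
Lemma rr_desc1 r : rr_desc (rr1 R r) = al r.
Proof. by rewrite [LHS]tdescE rmorph1 mulr1. Qed.
Lemma rr_desc2 r : rr_desc (rr2 R r) = be r.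
Proof. by rewrite [LHS]tdescE rmorph1 mul1r. Qed.

Let ac' (a : K) : rr_desc ((rr1 R \o GRing.in_alg R) a) = ga (GRing.in_alg R a).
Proof. by rewrite /= rr_desc1 ac. Qed.

Definition rrr_desc : {rmorphism RRR -> C} :=
  @tdesc K RR R (rr1 R \o GRing.in_alg R) (GRing.in_alg R) C rr_desc ga ac'.
Lemma rrr_desc_12 x : rrr_desc (rr_12 R x) = rr_desc x.
Proof. by rewrite [LHS]tdescE rmorph1 mulr1. Qed.
Lemma rrr_desc1 r : rrr_desc (rrr1 R r) = al r.
Proof. by rewrite [LHS]rrr_desc_12 rr_desc1. Qed.
Lemma rrr_desc2 r : rrr_desc (rrr2 R r) = be r.
Proof. by rewrite [LHS]rrr_desc_12 rr_desc2. Qed.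
Lemma rrr_desc3 r : rrr_desc (rrr3 R r) = ga r.
Proof. by rewrite [LHS]tdescE rmorph1 mul1r. Qed.
End Descent.

Section OmegaSeries.
Variables (K : fieldType) (R : comAlgType K).

Lemma Omega_ind (P : Omega R -> Prop) : (forall k r, P (dO k r)) -> P 0 -> P 1 ->
  (forall x y, P x -> P y -> P (x + y)) -> (forall x, P x -> P (- x)) ->
  (forall x y, P x -> P y -> P (x * y)) -> forall x, P x.
Proof.
move=> Pd P0 P1 PD PN PM; elim/quotW; elim=> [k r|||x Hx y Hy|x Hx|x Hx y Hy].
- exact: Pd.
- exact: P0.
- exact: P1.
- have -> : \pi_(Omega R) (OAdd x y) = \pi_(Omega R) x + \pi_(Omega R) y.
    by apply/om_piP/or_congD; apply/or_sym/om_repr.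
  exact: PD.
- have -> : \pi_(Omega R) (OOpp x) = - \pi_(Omega R) x.
    by apply/om_piP/or_congN; apply/or_sym/om_repr.
  exact: PN.
- have -> : \pi_(Omega R) (OMul x y) = \pi_(Omega R) x * \pi_(Omega R) y.
    by apply/om_piP/or_congM; apply/or_sym/om_repr.
  exact: PM.
Qed.

Lemma ps_coefMn (V : zmodType) (a : pseries V) n k : (a *+ n) k = a k *+ n.
Proof. by apply: (additive_muln (g := fun a : pseries V => a k)). Qed.

Lemma dOmM x y k : dOm (x * y) k = conv (fun i j => dOm x i * dOm y j) k :> Omega R.
Proof. by rewrite rmorphM. Qed.

Lemma dOmD (x y : Omega R) k : dOm (x + y) k = dOm x k + dOm y k.
Proof. by rewrite raddfD. Qed.
Lemma dOmN (x : Omega R) k : dOm (- x) k = - dOm x k.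
Proof. by rewrite raddfN. Qed.

(** Iterativity of d_Omega itself: an identity of binomial coefficients on the generators, and
    Vandermonde convolution ([conv_bin]) for products. *)
Lemma dOm_dOm (w : Omega R) a c : dOm (dOm w a) c = dOm w (a + c)%N *+ 'C(a + c, c).
Proof.
move: w a c; apply: Omega_ind => [k r a c|a c|a c|x y Hx Hy a c|x Hx a c|x y Hx Hy a c].
- rewrite !dOmE raddfMn ps_coefMn /= dOmE addnA -!mulrnA; congr (_ *+ _).
  (* The identity C(k+a, a) C(k+a+c, c) = C(k+a+c, a+c) C(a+c, c) is checked after multiplication by
     k! a! c!. *)
  have := bin_fact (leq_addl k (a + c)); have := bin_fact (leq_addl (k + a) c).
  have := bin_fact (leq_addl k a); have := bin_fact (leq_addl a c).
  rewrite !addnK addnA => E1 E2 E3 E4.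
  apply/eqP; rewrite -(eqn_pmul2r (fact_gt0 k)) -(eqn_pmul2r (fact_gt0 a)).
  rewrite -(eqn_pmul2r (fact_gt0 c)); apply/eqP; nia.
- by rewrite !raddf0 mul0rn.
- rewrite rmorph1; case: a => [|a]; last first.
    have -> : (1 : pseries (Omega R)) a.+1 = 0 by [].
    by rewrite raddf0 addSn mul0rn.
  by rewrite rmorph1 add0n; case: c => [|c]; rewrite ?bin0 ?mulr1n // mul0rn.
- by rewrite !dOmD Hx Hy mulrnDl.
- by rewrite !dOmN Hx mulNrn.
rewrite dOmM /conv raddf_sum /= ps_coef_sum.
transitivity (conv (fun i i' => conv (fun l l' =>
    (dOm x (i + l)%N * dOm y (i' + l')%N) *+ ('C(i + l, l) * 'C(i' + l', l'))) c) a).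
  apply: eq_bigr => i _; rewrite dOmM; apply: eq_conv => l l' _.
  by rewrite Hx Hy mulrnAl mulrnAr -mulrnA mulnC.
by rewrite (conv_bin (fun p q => dOm x p * dOm y q)) dOmM.
Qed.
End OmegaSeries.

Section ConnOfStrat.
Variables (K : fieldType) (R : comAlgType K) (M : lmodType R).
Variable eps : forall n, tens (PPr R n) M -> tens (PPl R n) M.
Hypothesis st : stratification eps.
Local Notation RR := (RR R).
Local Notation RRR := (RRR R).
Local Notation I := (@diag2 K R).
Local Notation J := (@diag3 K R).
Local Notation om_cst := (@om_cst K R).

Let lin n : linear (@eps n). Proof. by case: st => /(_ n) []. Qed.

(* s represents theta n m as the sum of the 1 (x) p.1 applied to p.2. *)
Definition taylor n (m : M) (s : seq (R * M)) : Prop :=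
  theta eps n m = \sum_(p <- s) pure (PPr R n p.1) p.2.

Lemma taylor_ex n m : exists s, taylor n m s.
Proof.
have [u uE] := pi_n_surj (theta eps n m); have [s sE] := tens_rr_sum u.
by exists s; rewrite /taylor uE sE pi_n_sum.
Qed.
Definition tay n m : seq (R * M) := sval (cid (taylor_ex n m)).
Lemma tayP n m : taylor n m (tay n m).
Proof. exact: svalP (cid (taylor_ex n m)). Qed.

Lemma theta_proj n m : tens_base (PP_proj R n) (theta eps n.+1 m) = theta eps n m.
Proof.
have [_ H _ _] := st; rewrite H; congr (eps _).
by rewrite (tens_base_rpure (@PP_proj_r K R n)) rmorph1.
Qed.

Lemma taylor_leq k n m s : (k <= n)%N -> taylor n m s -> taylor k m s.
Proof.
elim: n => [|n IH]; first by rewrite leqn0 => /eqP->.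
rewrite leq_eqVlt => /orP[/eqP-> //|kn E]; apply: IH => //.
rewrite /taylor -theta_proj E (additive_sum (tens_base_rD (@PP_proj_l K R n))).
by apply: eq_bigr => p _; rewrite (tens_base_rpure (@PP_proj_l K R n)) PP_proj_r.
Qed.

Lemma taylor0 m : taylor 0 m [:: (1, m)].
Proof.
by rewrite /taylor big_seq1 /= rmorph1; case: st => _ _ H _; rewrite /theta H.
Qed.
Lemma taylorD n m m' s s' :
  taylor n m s -> taylor n m' s' -> taylor n (m + m') (s ++ s').
Proof. by move=> E E'; rewrite /taylor (thetaD lin) E E' big_cat. Qed.
Lemma taylorZ n r m s : taylor n m s -> taylor n (r *: m) [seq (r * p.1, p.2) | p <- s].
Proof.
move=> E; rewrite /taylor (thetaZ lin) E scaler_sumr big_map.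
by apply: eq_bigr => p _; rewrite scale_pure rmorphM.
Qed.

Lemma imod_set0 (B : comPzRingType) (V : lmodType B) (S : set B) (u : V) :
  (forall b, S b -> b = 0) -> imod S u -> u = 0.
Proof.
move=> H; elim=> {u} [b v /H->||u v _ Hu _ Hv]; rewrite ?scale0r //.
by rewrite Hu Hv addr0.
Qed.

Section Eval2.
Variables (B : comPzRingType) (f : {rmorphism R -> B}) (h : RR -> B) (n : nat).
Hypothesis hD : {morph h : x y / x + y}.
Hypothesis hf : forall b a, h (b * rr1 R a) = h b * f a.
Hypothesis h0 : forall b, ideal_pow I n.+1 b -> h b = 0.

(** A map linear in the first factor and zero on I^(n+1) factors through P^n, so its value on a
    Taylor series is independent of the expansion. *)
Lemma taylor_eval2 m (s s' : seq (R * M)) : taylor n m s -> taylor n m s' ->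
  \sum_(p <- s) pure (h (rr2 R p.1)) p.2 =
  \sum_(p <- s') pure (h (rr2 R p.1)) p.2 :> tens f M.
Proof.
have LD := tens_baseD (M := M) hD hf.
have E l : \sum_(p <- l) pure (h (rr2 R p.1)) p.2 =
    tens_base h (\sum_(p <- l) pure (rr2 R p.1) p.2 : tens (rr1 R) M) :> tens f M.
  rewrite (additive_sum LD); apply: eq_bigr => p _.
  by rewrite (tens_base_pure hD hf).
rewrite /taylor -!pi_n_sum => -> /eqP; rewrite -subr_eq0 -(additive_sub (@pi_nD _ _ M n)).
move/eqP/pi_n_ker => H; apply/eqP; rewrite -subr_eq0 !E -(additive_sub LD); apply/eqP.
apply: (@imod_set0 _ _ [set 0]) => //.
apply: (tens_base_imod hD hf _ H) => b c Ib.
by apply: h0; rewrite mulrC; apply: ideal_powM.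
Qed.
End Eval2.

Section Eval3.
Variables (B : comPzRingType) (f : {rmorphism R -> B}) (h : RRR -> B) (n : nat).
Hypothesis hD : {morph h : x y / x + y}.
Hypothesis hf : forall b a, h (b * rrr1 R a) = h b * f a.
Hypothesis h0 : forall b, ideal_pow J n.+1 b -> h b = 0.

(** The cocycle condition read through a map linear in the first factor and zero on J^(n+1). Each
    property of the connection below comes from a choice of [h]. *)
Lemma taylor_eval3 m (s : seq (R * M)) : taylor n m s ->
  \sum_(p <- s) \sum_(q <- tay n p.2) pure (h (rrr2 R q.1 * rrr3 R p.1)) q.2 =
  \sum_(p <- s) pure (h (rrr3 R p.1)) p.2 :> tens f M.
Proof.
move=> E; have := strat_cocycle lin st E.
have qf a : quo (ideal_pow J n.+1) (rrr1 R a) = PPP1 R n a by [].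
pose Pi : tens (rrr1 R) M -> tens (PPP1 R n) M := tens_base (quo (ideal_pow J n.+1)).
have PiD : {morph Pi : u v / u + v} := tens_base_rD qf.
pose u : tens (rrr1 R) M :=
  \sum_(p <- s) \sum_(q <- tay n p.2) pure (rrr2 R q.1 * rrr3 R p.1) q.2.
pose w : tens (rrr1 R) M := \sum_(p <- s) pure (rrr3 R p.1) p.2.
have -> : \sum_(p <- s) pure (PPP3 R n p.1) p.2 = Pi w.
  rewrite /w (additive_sum PiD); apply: eq_bigr => p _.
  by rewrite /Pi (tens_base_rpure qf).
have -> : \sum_(p <- s) PPP3 R n p.1 *: tens_base (p12 R n) (theta eps n p.2) =
    Pi u.
  rewrite /u (additive_sum PiD); apply: eq_bigr => p _.
  rewrite (tayP n p.2) (additive_sum (tens_base_rD (@p12_l K R n))).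
  rewrite (additive_sum PiD) scaler_sumr; apply: eq_bigr => q _.
  rewrite /Pi (tens_base_rpure qf) (tens_base_rpure (@p12_l K R n)) scale_pure p12_r.
  by rewrite mulrC rmorphM.
move/eqP; rewrite -subr_eq0 -(additive_sub PiD) => /eqP/tens_quo_ker H.
have LD := tens_baseD (M := M) hD hf.
have Eu : \sum_(p <- s) \sum_(q <- tay n p.2) pure (h (rrr2 R q.1 * rrr3 R p.1)) q.2 =
    tens_base h u :> tens f M.
  rewrite /u (additive_sum LD); apply: eq_bigr => p _.
  rewrite (additive_sum LD); apply: eq_bigr => q _.
  by rewrite (tens_base_pure hD hf).
have Ew : \sum_(p <- s) pure (h (rrr3 R p.1)) p.2 = tens_base h w :> tens f M.
  rewrite /w (additive_sum LD); apply: eq_bigr => p _.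
  by rewrite (tens_base_pure hD hf).
rewrite Eu Ew; apply/eqP; rewrite -subr_eq0 -(additive_sub LD); apply/eqP.
apply: (@imod_set0 _ _ [set 0]) => //.
apply: (tens_base_imod hD hf _ H) => b c Ib.
by apply: h0; rewrite mulrC; apply: ideal_powM.
Qed.
End Eval3.

Fact dR_nmod : nmod_morphism (fun r : R => (fun k => dO k r) : pseries (Omega R)).
Proof.
have [dD _ _ _] := dO_compat R.
by split=> [|x y]; apply/funext => k; [rewrite (additive_0 (dD k))|rewrite dD].
Qed.
Fact dR_monoid : monoid_morphism (fun r : R => (fun k => dO k r) : pseries (Omega R)).
Proof.
have [_ dM dK d1] := dO_compat R.
split=> [|x y]; apply/funext => k; last by rewrite dM.
case: k => [|k]; first by rewrite d1.
by rewrite -[1]scale1r dK.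
Qed.
Definition dR (r : R) : pseries (Omega R) := fun k => dO k r.
HB.instance Definition _ :=
  GRing.isNmodMorphism.Build R (pseries (Omega R)) dR dR_nmod.
HB.instance Definition _ :=
  GRing.isMonoidMorphism.Build R (pseries (Omega R)) dR dR_monoid.

Lemma dO_K k (a : K) : (0 < k)%N -> dO k a%:A = 0 :> Omega R.
Proof. by case: (dO_compat R) => _ _ H _; apply: H. Qed.

Let cst_dR (a : K) : ps_cst om_cst a%:A = dR a%:A.
Proof.
by apply/funext => -[|k]; rewrite /ps_cst /ps_mono /dR ?mulr1n // dO_K.
Qed.

Definition tau_rr : {rmorphism RR -> pseries (Omega R)} :=
  rr_desc (al := ps_cst om_cst) (be := dR) cst_dR.

(** a (x) b |-> a d_R(b) has constant term ab, so I goes to series without constant term. *)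
Lemma tau_rr_pow n b k : ideal_pow I n b -> (k < n)%N -> tau_rr b k = 0.
Proof.
move=> Ib; suff : ps_val n (tau_rr b) by apply.
apply: ps_val_pow; apply: ideal_pow_map Ib => y Iy [|//] _.
suff -> : tau_rr y 0%N = om_cst (rr_mul R y) by rewrite Iy rmorph0.
move: y {Iy}; apply: rr_ext => [u v|u v|a c].
- by rewrite rmorphD.
- by rewrite !rmorphD.
rewrite !rmorphM ps_coef0M rr_desc1 rr_desc2 /= ps_cst0.
by rewrite rr_mul1 rr_mul2.
Qed.

Definition nabla_of n (m : M) : OmegaM M := \sum_(p <- tay n m) pure (dO n p.1) p.2.

(** Every expansion of order at least [k] may be used, as the coefficient of T^k of [tau_rr] kills
    I^(k+1). *)
Lemma nabla_ofE k n m s : (k <= n)%N -> taylor n m s ->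
  nabla_of k m = \sum_(p <- s) pure (dO k p.1) p.2.
Proof.
move=> kn E; have := taylor_eval2 (f := om_cst) (h := fun b => tau_rr b k) _ _ _
  (tayP k m) (taylor_leq kn E).
have E2 r : tau_rr (rr2 R r) k = dO k r by rewrite rr_desc2.
under eq_bigr do rewrite E2; under [RHS]eq_bigr do rewrite E2.
apply => [u v|b a|b Ib]; first by rewrite rmorphD.
  by rewrite rmorphM rr_desc1 ps_mul_cst.
exact: tau_rr_pow Ib _.
Qed.

Lemma nabla_of_connection : higher_connection nabla_of.
Proof.
split=> [k m|k m m'|k r m|m].
- rewrite /nabla_of; elim/big_rec: _ => [|p t _ IH]; first exact: ohm_0.
  by apply: ohm_D => //; apply/ohm_pure/oh_d.
- have H := taylorD (tayP k m) (tayP k m').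
  by rewrite (nabla_ofE (leqnn k) H) big_cat.
- rewrite (nabla_ofE (leqnn k) (taylorZ r (tayP k m))) big_map.
  transitivity (conv (fun i j =>
    \sum_(p <- tay k m) dO i r *: (pure (dO j p.1) p.2 : OmegaM M)) k).
    rewrite /conv exchange_big; apply: eq_bigr => p _.
    have [_ dM _ _] := dO_compat R.
    rewrite /= dM /conv pure_suml; apply: eq_bigr => i _.
    by rewrite scale_pure.
  apply: eq_conv => i j ij; rewrite -scaler_sumr; congr (_ *: _).
  by rewrite (nabla_ofE _ (tayP k m)) // -ij leq_addl.
- have [_ _ _ d1] := dO_compat R.
  by rewrite (nabla_ofE (leqnn 0) (taylor0 m)) big_seq1 /= d1.
Qed.

Local Notation om_nab := (om_nabla nabla_of).
Let bal i := om_nabla_bal i nabla_of_connection.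
Let om_nabD i : {morph om_nab i : u v / u + v}. Proof. exact: (tens_liftD (bal i)). Qed.
Let om_nab_pure i w m : om_nab i (pure w m) = conv (fun a b => dOm w a *: nabla_of b m) i.
Proof. exact: (tens_liftE (bal i)). Qed.

(* The cocycle condition is mapped to Omega[[S]][[T]] by sending the three    *)
(* factors r of R (x) R (x) R to r, to the sum of the d^(k)r S^k and to the   *)
(* sum of the d^(k)r (S + T)^k.                                               *)
Let ga_fun (r : R) : pseries (pseries (Omega R)) := fun b => dOm (dO b r).
Let ga_nmod : nmod_morphism ga_fun.
Proof.
have [dD _ _ _] := dO_compat R.
split=> [|x y]; apply/funext => k; rewrite /ga_fun.
  by rewrite (additive_0 (dD k)) raddf0.
by rewrite dD raddfD.
Qed.
Let ga_monoid : monoid_morphism ga_fun.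
Proof.
have [_ dM dK d1] := dO_compat R.
split=> [|x y]; apply/funext => k; rewrite /ga_fun.
  case: k => [|k]; first by rewrite d1 rmorph1.
  by rewrite -[1]scale1r dK // raddf0.
rewrite dM ps_coefM /conv raddf_sum; apply: eq_bigr => i _.
by rewrite /= rmorphM.
Qed.
HB.instance Definition _ :=
  GRing.isNmodMorphism.Build R (pseries (pseries (Omega R))) ga_fun ga_nmod.
HB.instance Definition _ :=
  GRing.isMonoidMorphism.Build R (pseries (pseries (Omega R))) ga_fun ga_monoid.

Let al : {rmorphism R -> pseries (pseries (Omega R))} :=
  ps_cst (idfun : {rmorphism pseries (Omega R) -> pseries (Omega R)}) \o ps_cst om_cst.
Let be : {rmorphism R -> pseries (pseries (Omega R))} :=
  ps_cst (idfun : {rmorphism pseries (Omega R) -> pseries (Omega R)}) \o dR.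

Let ab (a : K) : al a%:A = be a%:A.
Proof. by rewrite /al /be /= cst_dR. Qed.
Let ac (a : K) : al a%:A = ga_fun a%:A.
Proof.
rewrite ab /be; apply/funext => -[|k]; rewrite /= /ps_cst /ps_mono /ga_fun.
  rewrite mulr1n /= dOmE; apply/funext => -[|j]; rewrite /dR add0n binn mulr1n //.
by rewrite /= mulr0n dO_K // raddf0.
Qed.

Let tau3 := rrr_desc (al := al) (be := be) (ga := ga_fun) ab ac.

(** Compare the coefficients of S^e T^b in the image of the cocycle condition, [b] being the outer
    index and [e] the inner one. The binomial comes from (S + T)^(b+e), and order b + e suffices
    because J maps to series without constant term. *)
Lemma om_nabla_nabla_of e b m :
  om_nab e (nabla_of b m) = nabla_of (b + e) m *+ 'C(b + e, e).
Proof.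
pose N := (b + e)%N; pose s := tay N m.
have E : taylor N m s := tayP N m.
have := taylor_eval3 (f := om_cst) (h := fun x => tau3 x b e) _ _ _ E.
have h3 r : tau3 (rrr3 R r) b e = dO (b + e) r *+ 'C(b + e, e).
  by rewrite rrr_desc3 /= /ga_fun dOmE.
have h23 r r' : tau3 (rrr2 R r * rrr3 R r') b e =
   conv (fun a b' => dOm (dO b r') a * dO b' r) e.
  rewrite rmorphM rrr_desc3 rrr_desc2 mulrC /be /=.
  rewrite (ps_mul_cst idfun (ga_fun r') (dR r) b) /= ps_coefM.
  by [].
under eq_bigr do under eq_bigr do rewrite h23.
under [in X in _ = X]eq_bigr do rewrite h3.
move=> H; rewrite (nabla_ofE (leq_addr e b) E) (additive_sum (@om_nabD e)).
rewrite (nabla_ofE (leqnn N) E) -sumrMnl.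
transitivity (\sum_(p <- s) \sum_(q <- tay N p.2)
    (pure (conv (fun a b' : nat => dOm (dO b p.1) a * dO b' q.1) e) q.2 : OmegaM M)).
  apply: eq_bigr => p _; rewrite om_nab_pure.
  transitivity (conv (fun a b' => \sum_(q <- tay N p.2)
     (pure (dOm (dO b p.1) a * dO b' q.1) q.2 : OmegaM M)) e).
    apply: eq_conv => a b' ab'; rewrite (nabla_ofE _ (tayP N p.2)); last first.
      by rewrite /N -ab'; lia.
    by rewrite scaler_sumr; apply: eq_bigr => q _; rewrite scale_pure.
  by rewrite /conv exchange_big; apply: eq_bigr => q _; rewrite pure_suml.
rewrite H => [|u v|x a|x Jx].
- apply: eq_bigr => p _.
  by rewrite [LHS]pureE [X in _ = X *+ _]pureE scalerMnl.
- by rewrite rmorphD.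
- rewrite rmorphM rrr_desc1 /al /=.
  by rewrite (ps_mul_cst idfun (tau3 x) _ b) /= ps_mul_cst.
suff : ps2_val N.+1 (tau3 x) by apply; rewrite ltnSn.
apply: ps2_val_pow; apply: ideal_pow_map Jx => y Jy k l; rewrite ltnS leqn0 addn_eq0.
move=> /andP[/eqP-> /eqP->].
suff -> : tau3 y 0%N 0%N = om_cst (rrr_mul R y) by rewrite Jy rmorph0.
move: y {Jy}; apply: rrr_ext => [u v|u v|c1 c2 c3].
- by rewrite rmorphD.
- by rewrite !rmorphD.
rewrite !rmorphM rrr_desc1 rrr_desc2 rrr_desc3 rrr_mul1 rrr_mul2 rrr_mul3.
have al0 c : al c 0%N 0%N = om_cst c by [].
have be0 c : be c 0%N 0%N = om_cst c by [].
have ga0 c : ga_fun c 0%N 0%N = om_cst c by rewrite /ga_fun dOmE mulr1n.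
by rewrite !ps_coef0M al0 be0; congr (_ * _); apply: ga0.
Qed.

(** Iterativity on elements of [M] ([om_nabla_nabla_of]) and on Omega ([dOm_dOm]) combine over
    tensors through the Leibniz rule and [conv_bin]. *)
Lemma nabla_of_iterative : iterative nabla_of.
Proof.
have om_nabZ i w t : om_nab i (w *: t) = conv (fun a b => dOm w a *: om_nab b t) i.
  move: t; apply: tens_ext => [u v|u v|c m].
  - by rewrite scalerDr om_nabD.
  - by rewrite -convD; apply: eq_conv => a b _; rewrite om_nabD scalerDr.
  rewrite scale_pure om_nab_pure.
  transitivity (conv (fun l b =>
    conv (fun a a' => (dOm w a * dOm c a') *: nabla_of b m) l) i).
    by apply: eq_conv => a b _; rewrite dOmM /conv scaler_suml.
  rewrite -(convA (fun a a' b => (dOm w a * dOm c a') *: nabla_of b m)).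
  apply: eq_conv => a b _; rewrite om_nab_pure /conv scaler_sumr.
  by apply: eq_bigr => k _; rewrite scalerA.
move=> i j; apply: tens_ext => [u v|u v|w m]; first by rewrite !om_nabD.
  by rewrite om_nabD mulrnDl.
rewrite om_nab_pure {1}/conv (additive_sum (@om_nabD i)).
transitivity (conv (fun a b => conv (fun c e =>
   (dOm w (a + c)%N *: nabla_of (b + e)%N m) *+ ('C(a + c, c) * 'C(b + e, e))) i) j).
  apply: eq_bigr => a _; rewrite om_nabZ; apply: eq_conv => c e _.
  rewrite dOm_dOm om_nabla_nabla_of -scalerMnl -scalerMnr.
  by rewrite -mulrnA mulnC.
rewrite (conv_bin (fun p q => dOm w p *: nabla_of q m)) om_nab_pure addnC.
by [].
Qed.

Lemma nabla_hd_ofE psi k n m s : (k <= n)%N -> taylor n m s ->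
  nabla_hd nabla_of psi m k = \sum_(p <- s) psi p.1 k *: p.2.
Proof.
move=> kn E; rewrite /nabla_hd (nabla_ofE kn E).
have tD : {morph (tilde_id (M := M) psi) : x y / x + y} :=
  tens_liftD (tilde_id_bal M psi).
rewrite (additive_sum tD) ps_coef_sum; apply: eq_bigr => p _.
rewrite /tilde_id (tens_liftE (tilde_id_bal M psi)).
by rewrite tildeE /ps_mono eqxx mulr1n.
Qed.

(** Map the three factors of R (x) R (x) R to R[[T]] by the constants, by psi1 and by psi1 psi2. The
    coefficient of T^N of the cocycle condition is the required equality. *)
Lemma nabla_of_integrable : integrable nabla_of.
Proof.
move=> psi1 psi2 m; apply/funext => N.
pose al1 : {rmorphism R -> pseries R} := ps_cst (idfun : {rmorphism R -> R}).
have ab1 (a : K) : al1 a%:A = psi1 a%:A by rewrite hd_alg.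
have ac1 (a : K) : al1 a%:A = hd_comp_fun psi1 psi2 a%:A.
  by rewrite (hd_comp_alg psi1 psi2).
pose s := tay N m; have E : taylor N m s := tayP N m.
pose H3 := rrr_desc ab1 ac1.
have bM : balanced (idfun : {rmorphism R -> R}) (fun b (m : M) => b *: m).
  split=> [b b' u|b u u'|b a u]; [exact: scalerDl|exact: scalerDr|].
  by rewrite scalerA.
have hD : {morph (fun x => H3 x N) : u v / u + v} by move=> u v; rewrite rmorphD.
have hf x a : H3 (x * rrr1 R a) N = H3 x N * a.
  by rewrite rmorphM rrr_desc1 ps_mul_cst.
have h0 x : ideal_pow J N.+1 x -> H3 x N = 0.
  move=> Jx; suff : ps_val N.+1 (H3 x) by apply.
  apply: ps_val_pow; apply: ideal_pow_map Jx => y Jy [|//] _.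
  suff -> : H3 y 0%N = rrr_mul R y by rewrite Jy.
  move: y {Jy}; apply: rrr_ext => [u v|u v|c1 c2 c3].
  - by rewrite rmorphD.
  - by rewrite !rmorphD.
  rewrite !rmorphM rrr_desc1 rrr_desc2 rrr_desc3 rrr_mul1 rrr_mul2 rrr_mul3.
  by rewrite !ps_coef0M hd_id; congr (_ * _); apply: (hd_comp_id psi1 psi2).
have := congr1 (tens_lift (fun b (m : M) => b *: m))
  (taylor_eval3 (f := idfun) hD hf h0 E).
rewrite !(additive_sum (tens_liftD bM)).
under eq_bigr do rewrite (additive_sum (tens_liftD bM)).
under eq_bigr do under eq_bigr do rewrite (tens_liftE bM) rmorphM rrr_desc2 rrr_desc3.
under [in X in _ = X -> _]eq_bigr do rewrite (tens_liftE bM) rrr_desc3.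
move=> H; rewrite (nabla_hd_ofE _ (leqnn N) E) /= -H.
apply/esym; rewrite /ps_ext.
have hdD k : {morph (fun m => nabla_hd nabla_of psi1 m k) : x y / x + y}.
  move=> x y; have [_ nD _ _] := nabla_of_connection.
  by rewrite /nabla_hd nD /tilde_id (tens_liftD (tilde_id_bal M psi1)).
transitivity (conv (fun i j => \sum_(p <- s) \sum_(q <- tay N p.2)
   (psi1 (psi2 p.1 i) * psi1 q.1) j *: q.2) N).
  apply: eq_conv => i j ij; have iN : (i <= N)%N by rewrite -ij leq_addr.
  have jN : (j <= N)%N by rewrite -ij leq_addl.
  rewrite (nabla_hd_ofE _ iN E) (additive_sum (hdD j)).
  apply: eq_bigr => p _.
  have T := taylorZ (psi2 p.1 i) (taylor_leq jN (tayP N p.2)).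
  rewrite (nabla_hd_ofE _ (leqnn j) T) big_map.
  by apply: eq_bigr => q _; rewrite /= rmorphM.
rewrite /conv exchange_big; apply: eq_bigr => p _.
rewrite exchange_big; apply: eq_bigr => q _ /=.
rewrite -scaler_suml; congr (_ *: _).
rewrite mulrC ps_coefM /hd_comp_fun /ps_ext.
transitivity (conv (fun i j => conv (fun k l => psi1 (psi2 p.1 i) k * psi1 q.1 l) j) N).
  by apply: eq_bigr => i _; rewrite ps_coefM.
rewrite (convA (fun i k l => psi1 (psi2 p.1 i) k * psi1 q.1 l)).
by apply: eq_conv => k l _; rewrite /conv mulr_suml.
Qed.
End ConnOfStrat.

(** * Existence of coordinates *)

Section TrivialExtension.
Variables (K : fieldType) (R : comAlgType K) (V : lmodType R).

(** The square-zero extension of R by V, which turns derivations into V into algebra sections over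
    R. *)
Definition triv_ext : Type := (R * V)%type.
HB.instance Definition _ := GRing.Zmodule.on triv_ext.

Definition triv_one : triv_ext := (1, 0).
Definition triv_mul (x y : triv_ext) : triv_ext := (x.1 * y.1, x.1 *: y.2 + y.1 *: x.2).
Definition triv_scale (k : K) (x : triv_ext) : triv_ext := (k *: x.1, k%:A *: x.2).

Fact triv_mulA : associative triv_mul.
Proof.
move=> [a u] [b v] [c w]; congr (_, _) => /=; first exact: mulrA.
by rewrite !scalerDr !scalerA addrA [c * a]mulrC [c * b]mulrC.
Qed.
Fact triv_mulC : commutative triv_mul.
Proof. by move=> [a u] [b v]; rewrite /triv_mul /= mulrC addrC. Qed.
Fact triv_mul1 : left_id triv_one triv_mul.
Proof. by move=> [a u]; rewrite /triv_mul /= mul1r scale1r scaler0 addr0. Qed.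
Fact triv_mulDl : left_distributive triv_mul +%R.
Proof.
move=> [a u] [b v] [c w]; congr (_, _) => /=; first exact: mulrDl.
by rewrite scalerDl scalerDr addrACA.
Qed.
Fact triv_1_neq0 : triv_one != 0.
Proof. by apply/negP => /eqP[] /eqP; rewrite oner_eq0. Qed.
HB.instance Definition _ := GRing.Zmodule_isComNzRing.Build triv_ext
  triv_mulA triv_mulC triv_mul1 triv_mulDl triv_1_neq0.

Fact triv_scaleA k l x : triv_scale k (triv_scale l x) = triv_scale (k * l) x.
Proof.
rewrite /triv_scale /= !scalerA; congr (_, _ *: _).
by rewrite -scalerAl mul1r scalerA.
Qed.
Fact triv_scale1 : left_id 1 triv_scale.
Proof. by move=> [a u]; rewrite /triv_scale /= !scale1r. Qed.
Fact triv_scaleDr : right_distributive triv_scale +%R.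
Proof. by move=> k [a u] [b v]; congr (_, _); apply: scalerDr. Qed.
Fact triv_scaleDl x : {morph triv_scale^~ x : k l / k + l}.
Proof. by move=> k l; congr (_, _); rewrite /= ?scalerDl. Qed.
HB.instance Definition _ := GRing.Zmodule_isLmodule.Build K triv_ext
  triv_scaleA triv_scale1 triv_scaleDr triv_scaleDl.

Fact triv_scaleAl (k : K) (x y : triv_ext) : k *: (x * y) = (k *: x) * y.
Proof.
case: x y => [a u] [b v]; congr (_, _) => /=; first exact: scalerAl.
by rewrite scalerDr !scalerA [b * _]mulrC -scalerAl mul1r.
Qed.
HB.instance Definition _ := GRing.Lmodule_isLalgebra.Build K triv_ext triv_scaleAl.
HB.instance Definition _ := GRing.Lalgebra_isComAlgebra.Build K triv_ext.

End TrivialExtension.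

Section DerivationAsMorphism.
Variables (K : fieldType) (R : comAlgType K) (V : lmodType R) (d : R -> V).
Hypothesis dd : derivation d.

Definition der_morph (r : R) : triv_ext V := (r, d r).
Fact der_morph_nmod : nmod_morphism der_morph.
Proof.
have [dD dM dK] := dd; split=> [|x y]; rewrite /der_morph ?dD //.
by rewrite (additive_0 dD).
Qed.
Fact der_morph_monoid : monoid_morphism der_morph.
Proof.
have [dD dM dK] := dd; split=> [|x y]; rewrite /der_morph ?dM //.
by have := dK 1; rewrite scale1r => ->.
Qed.
Fact der_morph_scalable : scalable der_morph.
Proof.
have [dD dM dK] := dd => k x; congr (_, _).
by rewrite -[k *: x]mulr1 -scalerAl scalerAr mulrC dM dK scaler0 addr0.
Qed.
HB.instance Definition _ :=
  GRing.isNmodMorphism.Build R (triv_ext V) der_morph der_morph_nmod.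
HB.instance Definition _ :=
  GRing.isMonoidMorphism.Build R (triv_ext V) der_morph der_morph_monoid.
HB.instance Definition _ :=
  GRing.isScalable.Build K R (triv_ext V) *:%R der_morph der_morph_scalable.
Definition der_lrmorph : {lrmorphism R -> triv_ext V} := der_morph.
End DerivationAsMorphism.

Section TrivialExtensionMap.
Variables (K : fieldType) (R : comAlgType K) (V W : lmodType R) (p : V -> W).
Hypothesis lp : linear p.

Definition triv_map (x : triv_ext V) : triv_ext W := (x.1, p x.2).
Let pD : {morph p : x y / x + y}.
Proof. by move=> x y; rewrite -[x]scale1r lp !scale1r. Qed.
Let pZ a x : p (a *: x) = a *: p x.
Proof. by rewrite -[a *: x]addr0 lp (additive_0 pD) addr0. Qed.
Fact triv_map_nmod : nmod_morphism triv_map.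
Proof.
split=> [|x y]; rewrite /triv_map /=; first by rewrite (additive_0 pD).
by rewrite pD.
Qed.
Fact triv_map_monoid : monoid_morphism triv_map.
Proof.
split=> [|x y]; rewrite /triv_map /=; first by rewrite (additive_0 pD).
by rewrite pD !pZ.
Qed.
Fact triv_map_scalable : scalable triv_map.
Proof. by move=> k x; rewrite /triv_map /= pZ. Qed.
HB.instance Definition _ :=
  GRing.isNmodMorphism.Build (triv_ext V) (triv_ext W) triv_map triv_map_nmod.
HB.instance Definition _ :=
  GRing.isMonoidMorphism.Build (triv_ext V) (triv_ext W) triv_map triv_map_monoid.
HB.instance Definition _ :=
  GRing.isScalable.Build K (triv_ext V) (triv_ext W) *:%R triv_map triv_map_scalable.
Definition triv_lrmorph : {lrmorphism triv_ext V -> triv_ext W} := triv_map.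
End TrivialExtensionMap.

(** A derivation into W is an algebra section of the square-zero extension by W. The extension by V
    maps onto it with square-zero kernel, so smoothness lifts the section. *)
Lemma smooth_lift_derivation (K : fieldType) (R : comAlgType K) (V W : lmodType R)
    (p : V -> W) (d : R -> W) : smooth R -> linear p -> (forall w, exists v, p v = w) ->
  derivation d -> exists2 d' : R -> V, derivation d' & forall r, p (d' r) = d r.
Proof.
move=> smoothR lp p_surj dd.
have [||v Hv] := smoothR _ _ (triv_lrmorph lp) _ _ (der_lrmorph dd).
- by case=> a w; have [u <-] := p_surj w; exists (a, u).
- move=> [a u] [b w] [/= -> _] [/= -> _].
  by congr (_, _); rewrite /= ?mul0r // !scale0r addr0.
have v1 r : (v r).1 = r by have [] := Hv r.
exists (fun r => (v r).2); last by move=> r; have [] := Hv r.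
split=> [x y|x y|a]; first by rewrite rmorphD.
  by rewrite rmorphM /= !v1.
by rewrite linearZ /= rmorph1 scaler0.
Qed.

Section Span.
Variables (A : comPzRingType) (V : lmodType A) (n : nat) (g : 'I_n -> V).

Definition span_pred : {pred V} :=
  [pred v | `[< exists c : 'I_n -> A, v = \sum_i c i *: g i >]].
Fact span_submod : submod_closed span_pred.
Proof.
split=> [|a u v /asboolP[c ->] /asboolP[e ->]]; apply/asboolP.
  by exists (fun=> 0); rewrite big1 // => i _; rewrite scale0r.
exists (fun i => a * c i + e i); rewrite scaler_sumr -big_split.
by apply: eq_bigr => i _; rewrite scalerDl scalerA.
Qed.
HB.instance Definition _ := GRing.isSubmodClosed.Build A V span_pred span_submod.

Record span_sub := SpanSub { span_val :> V; _ : span_val \in span_pred }.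
HB.instance Definition _ := [isSub for span_val].
HB.instance Definition _ := [Choice of span_sub by <:].
HB.instance Definition _ := [SubChoice_isSubLmodule of span_sub by <:].
End Span.

Section CoordinatesExist.
Variables (K : fieldType) (R : comAlgType K).
Local Notation W := (restr (@om_cst K R)).

Lemma dO1_derivation : derivation (fun r : R => dO 1 r : W).
Proof.
have [dD dM dK _] := dO_compat R; split=> [x y|r s|a]; first exact: dD.
  rewrite dM /conv big_ord_recl big_ord1 /= [X in _ + X]mulrC.
  by [].
exact: dK.
Qed.

(* Omega_1 is universal: a derivation into V is read off from the morphism    *)
(* Omega -> triv_ext V killing the d^(k) with k > 1.                          *)
Lemma omega1_universal (V : lmodType R) (d : R -> V) n (x : 'I_n -> R) (c : 'I_n -> R) r :
  derivation d -> dO 1 r = \sum_i om_cst (c i) * dO 1 (x i) :> Omega R ->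
  d r = \sum_i c i *: d (x i).
Proof.
move=> [dD dM dK] E.
pose phi (k : nat) (r : R) : triv_ext V :=
  match k with 0 => (r, 0) | 1 => (0, d r) | _ => (0, 0) end.
have H : om_compat phi.
  split=> [[|[|k]] a b|[|[|k]] a b|[|[|k]] a // _|//].
  - by congr (_, _); rewrite addr0.
  - by congr (_, _); rewrite ?addr0 // dD.
  - by congr (_, _); rewrite addr0.
  - by rewrite /conv big_ord1; congr (_, _); rewrite /= !scaler0 addr0.
  - rewrite /conv big_ord_recl big_ord1 /phi /=.
    by congr (_, _); rewrite /= ?mul0r ?mulr0 ?addr0 // !scale0r addr0 add0r dM.
  - rewrite /conv big1 // => -[[|[|i]] ik] _ /=; rewrite ?subn0 ?subSS ?subn0 /=.
    + by congr (_, _); rewrite /= ?mulr0 // scaler0 scale0r addr0.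
    + by case: k ik => [|k] _; congr (_, _); rewrite /= ?mulr0 // !scale0r addr0.
    + by case: (k - i)%N => [|[|j]]; congr (_, _);
        rewrite /= ?mul0r // ?scaler0 ?scale0r ?addr0.
  - by congr (_, _); rewrite dK.
have := congr1 (fun w => (om_lift H w).2) E.
rewrite om_liftE rmorph_sum /= => ->.
transitivity ((\sum_i ((0, c i *: d (x i)) : triv_ext V)).2).
  congr (_.2); apply: eq_bigr => i _; rewrite rmorphM /= !om_liftE /phi /=.
  by congr (_, _); rewrite /= ?mulr0 // scale0r addr0.
by apply: (big_morph snd).
Qed.

(** The Leibniz rule reduces the image of A to its generators. Denominators are handled by the
    quotient rule: from r t = a follows t dr = da - r dt, and t is invertible in R. *)
Lemma omega1_fg : localization_of_fg_algebra R -> exists n (x : 'I_n -> R),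
  forall r, exists c : 'I_n -> R, dO 1 r = \sum_i c i *: (dO 1 (x i) : W) :> W.
Proof.
move=> [A [S [f [[s As] multS [fS fsurj _]]]]].
pose x (i : 'I_(size s)) := f s`_i; exists (size s), x.
pose P : {pred W} := span_pred (fun i => dO 1 (x i) : W).
have [dD dM dK] := dO1_derivation.
have PE (w : W) : w \in P ->
    exists c : 'I_(size s) -> R, w = \sum_i c i *: (dO 1 (x i) : W).
  by move/asboolP.
have dP (a : A) : (dO 1 (f a) : W) \in P.
  elim: (As a) => {a} [a|k|a b _ Pa _ Pb|a b _ Pa _ Pb].
  - move=> /= /(nthP 0) [i ilt <-]; apply/asboolP.
    exists (fun j => (j == Ordinal ilt)%:R).
    rewrite (bigD1 (Ordinal ilt)) //= eqxx scale1r big1 ?addr0 // => j /negbTE ->.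
    by rewrite scale0r.
  - by rewrite rmorph_alg dK rpred0.
  - by rewrite rmorphD dD rpredD.
  - by rewrite rmorphM dM rpredD // rpredZ.
move=> r; apply: PE; have [a [t [St E]]] := fsurj r; have [b tb] := fS _ St.
have -> : (dO 1 r : W) = b *: (f t *: (dO 1 r : W)) by rewrite scalerA mulrC tb scale1r.
rewrite rpredZ //; have := dM r (f t); rewrite E => Ea.
have -> : f t *: (dO 1 r : W) = (dO 1 (f a) : W) - r *: (dO 1 (f t) : W).
  by rewrite Ea addrAC subrr add0r.
by rewrite rpredB // rpredZ.
Qed.

(** The universal derivation into Omega_1 lifts along the surjection R^n -> Omega_1 given by the
    dx_i; the components of the lift are the [D i]. *)
Lemma coordinates_exist : localization_of_fg_algebra R -> smooth R ->
  exists n (x : 'I_n -> R) (D : 'I_n -> R -> R), coordinates x D.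
Proof.
move=> /omega1_fg[n [x gen]] smoothR; exists n, x.
pose g i : W := dO 1 (x i).
have dg r : (dO 1 r : W) \in span_pred g by apply/asboolP; apply: gen.
pose V2 := span_sub g.
have [dD dM dK] := dO1_derivation.
pose d (r : R) : V2 := SpanSub (dg r).
have dd : derivation d.
  split=> [a b|a b|a]; apply: val_inj; first exact: dD.
    exact: dM.
  exact: dK.
have gs i : g i \in span_pred g by apply: dg.
pose p (v : 'rV[R]_n) : V2 := \sum_i v 0 i *: SpanSub (gs i).
have lp : linear p.
  move=> a u v; rewrite /p scaler_sumr -big_split; apply: eq_bigr => i _.
  by rewrite !mxE scalerDl scalerA.
have p_surj w : exists v, p v = w.
  have /asboolP[c E] : val w \in span_pred g by case: w.
  exists (\row_i c i); apply: val_inj; rewrite E raddf_sum.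
  by apply: eq_bigr => i _; rewrite mxE.
have [d' [d'D d'M d'K] pd'] := smooth_lift_derivation smoothR lp p_surj dd.
exists (fun i r => d' r 0 i); split=> [i|i a|V e de r].
- split=> [a b|a b]; first by rewrite d'D mxE.
  by rewrite d'M !mxE addrC mulrC.
- by rewrite d'K mxE.
apply: omega1_universal => //.
have := congr1 val (pd' r); rewrite raddf_sum => /esym E.
rewrite [LHS]E; apply: eq_bigr => i _.
by [].
Qed.
End CoordinatesExist.

(** * Exponentials of derivations in characteristic zero *)

Section Exponential.
Variables (K : fieldType) (R : comAlgType K) (E : R -> R).
Hypothesis charK : [pchar K] =i pred0.
Hypothesis Eder : ring_der E.
Hypothesis EK : forall a : K, E a%:A = 0.

Let ED : {morph E : x y / x + y}. Proof. by case: Eder. Qed.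
Let EM x y : E (x * y) = E x * y + x * E y. Proof. by case: Eder. Qed.
Let EZ (k : K) r : E (k *: r) = k *: E r.
Proof. by rewrite -[k *: r]mulr_algl EM EK mul0r add0r mulr_algl. Qed.

Definition exp_fun (r : R) : pseries R := fun n => (n`!%:R : K)^-1 *: iter n E r.

Let nat_neq0 n : (n.+1%:R : K) != 0.
Proof. by have /pcharf0P -> := charK. Qed.

Let exp_rec r n : exp_fun r n.+1 *+ n.+1 = E (exp_fun r n).
Proof.
rewrite /exp_fun EZ /= scalerMnl; congr (_ *: _).
by rewrite factS natrM invfM -mulr_natl mulrA mulfV ?mul1r.
Qed.

Let muln_inj n (u v : R) : u *+ n.+1 = v *+ n.+1 -> u = v.
Proof.
rewrite -!scaler_nat => /(congr1 (fun w => (n.+1%:R : K)^-1 *: w)).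
by rewrite !scaler_nat -!(scaler_nat (R := K)) !scalerA mulVf ?nat_neq0 // !scale1r.
Qed.

Fact exp_nmod : nmod_morphism exp_fun.
Proof.
have iD n : {morph iter n E : x y / x + y}.
  by elim: n => [//|n IH x y]; rewrite !iterS IH ED.
split=> [|x y]; apply/funext => n; rewrite /exp_fun.
  by rewrite (additive_0 (iD n)) scaler0.
by rewrite iD scalerDr.
Qed.
Let exp0 r : exp_fun r 0%N = r.
Proof. by rewrite /exp_fun fact0 invr1 scale1r. Qed.
Let expK (a : K) : exp_fun a%:A = ps_mono a%:A 0.
Proof.
apply/funext => -[|n]; first by rewrite exp0 /ps_mono mulr1n.
rewrite /exp_fun /ps_mono mulr0n iterSr EK.
have -> : iter n E 0 = 0 by elim: n => //= n ->; apply: additive_0.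
by rewrite scaler0.
Qed.
(** The coefficients satisfy (n+1) a_(n+1) = E(a_n), and by the Leibniz rule the product of two such
    series satisfies the same recursion. *)
Fact exp_monoid : monoid_morphism exp_fun.
Proof.
split=> [|x y]; first by have := expK 1; rewrite scale1r.
apply/funext; elim=> [|n IH].
  by rewrite ps_coefM /conv big_ord1 !exp0.
apply: (@muln_inj n); rewrite exp_rec IH !ps_coefM /conv.
rewrite (additive_sum ED) -sumrMnl.
transitivity (\sum_(i < n.+2) (exp_fun x i * exp_fun y (n.+1 - i)%N) *+ i +
    \sum_(i < n.+2) (exp_fun x i * exp_fun y (n.+1 - i)%N) *+ (n.+1 - i)); last first.
  rewrite -big_split; apply: eq_bigr => i _ /=.
  by rewrite -mulrnDr subnKC // -ltnS.
rewrite [X in _ = X + _]big_ord_recl mulr0n add0r.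
rewrite [X in _ = _ + X]big_ord_recr /= subnn mulr0n addr0 -big_split.
apply: eq_bigr => i _ /=; rewrite EM -!exp_rec mulrnAl mulrnAr.
have -> : (n.+1 - i = (n - i).+1)%N by rewrite subSn // -ltnS.
by rewrite subSS.
Qed.
HB.instance Definition _ :=
  GRing.isNmodMorphism.Build R (pseries R) exp_fun exp_nmod.
HB.instance Definition _ :=
  GRing.isMonoidMorphism.Build R (pseries R) exp_fun exp_monoid.

Definition hexp : HD K R := @MkHD K R exp_fun expK exp0.

Lemma hexp1 r : hexp r 1%N = E r.
Proof. by rewrite -[LHS]mulr1n (exp_rec r 0) exp0. Qed.
Lemma hexp2 r : hexp r 2 *+ 2 = E (E r).
Proof. by rewrite (exp_rec r 1); congr E; apply: hexp1. Qed.
End Exponential.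

(** * Flatness and the round trips *)

Lemma conv1 (V : zmodType) (F : nat -> nat -> V) : conv F 1 = F 0%N 1%N + F 1%N 0%N.
Proof. by rewrite /conv big_ord_recl big_ord1. Qed.
Lemma conv2 (V : zmodType) (F : nat -> nat -> V) :
  conv F 2 = F 0%N 2%N + F 1%N 1%N + F 2%N 0%N.
Proof. by rewrite /conv !big_ord_recl big_ord0 addr0 addrA. Qed.

Section Homogeneous.
Variables (K : fieldType) (R : comAlgType K) (n : nat).
Variables (x : 'I_n -> R) (D : 'I_n -> R -> R).
Hypothesis xD : coordinates x D.

Lemma dO1_coord r : dO 1 r = \sum_i om_cst (D i r) * dO 1 (x i) :> Omega R.
Proof. by have [_ _ H] := xD; have := H _ _ (dO1_derivation R) r. Qed.

(** Degrees 0 and 1 are proved together, because a product of degree 1 has one factor in each. *)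
Lemma om_homog01 k (w : Omega R) : om_homog k w ->
  (k = 0%N -> exists r, w = om_cst r) /\
  (k = 1%N -> exists c, w = \sum_i om_cst (c i) * dO 1 (x i)).
Proof.
elim=> {k w} [k r|k|k w w' _ [H0 H1] _ [H0' H1']|i j w w' _ [H0 H1] _ [H0' H1']].
- split=> [->|->]; first by exists r.
  by exists (fun i => D i r); apply: dO1_coord.
- split=> _; first by exists 0; rewrite rmorph0.
  by exists (fun=> 0); rewrite big1 // => i _; rewrite rmorph0 mul0r.
- split=> k0.
    have [r ->] := H0 k0; have [r' ->] := H0' k0.
    by exists (r + r'); rewrite rmorphD.
  have [c ->] := H1 k0; have [c' ->] := H1' k0.
  exists (fun i => c i + c' i); rewrite -big_split; apply: eq_bigr => i _.
  by rewrite rmorphD mulrDl.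
- split=> /eqP; first rewrite addn_eq0 => /andP[/eqP i0 /eqP j0].
    have [r ->] := H0 i0; have [r' ->] := H0' j0.
    by exists (r * r'); rewrite rmorphM.
  case: i H0 H1 => [|[|i]] H0 H1; rewrite ?add0n ?addSn ?eqSS //.
    move=> /eqP j1; have [r ->] := H0 erefl; have [c ->] := H1' j1.
    exists (fun i => r * c i); rewrite mulr_sumr; apply: eq_bigr => i _.
    by rewrite rmorphM mulrA.
  rewrite add0n => /eqP j0; have [c ->] := H1 erefl; have [r ->] := H0' j0.
  exists (fun i => r * c i); rewrite mulr_suml; apply: eq_bigr => i _.
  by rewrite rmorphM mulrC mulrA.
Qed.

Lemma OmegaM_homog1 (M : lmodType R) (t : OmegaM M) : OmegaM_homog 1 t ->
  exists mu : 'I_n -> M, t = \sum_i pure (dO 1 (x i)) (mu i).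
Proof.
elim=> {t} [w m Hw||t t' _ [mu ->] _ [mu' ->]].
- have [_ /(_ erefl)[c ->]] := om_homog01 Hw; exists (fun i => c i *: m).
  by rewrite pure_suml; apply: eq_bigr => i _; rewrite mulrC pureZ.
- by exists (fun=> 0); rewrite big1 // => i _; rewrite pure0r.
- exists (fun i => mu i + mu' i); rewrite -big_split.
  by apply: eq_bigr => i _; rewrite pureDr.
Qed.
End Homogeneous.

Section NablaHD.
Variables (K : fieldType) (R : comAlgType K) (M : lmodType R).
Variable nabla : nat -> M -> OmegaM M.
Hypothesis conn : higher_connection nabla.

Lemma tilde_idD psi :
  {morph (tilde_id (M := M) psi : OmegaM M -> pseries M) : u v / u + v}.
Proof. exact: (tens_liftD (tilde_id_bal M psi)). Qed.
Lemma tilde_id_pure psi w (m : M) k : tilde_id psi (pure w m) k = tilde psi w k *: m.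
Proof. by rewrite /tilde_id (tens_liftE (tilde_id_bal M psi)). Qed.
Lemma tilde_id_dO psi k r (m : M) : tilde_id psi (pure (dO k r) m) k = psi r k *: m.
Proof. by rewrite tilde_id_pure tildeE /ps_mono eqxx mulr1n. Qed.
Lemma tilde_id_sum psi k (J : Type) (l : seq J) (P : pred J) F :
  tilde_id (M := M) psi (\sum_(j <- l | P j) F j) k =
  \sum_(j <- l | P j) tilde_id psi (F j) k.
Proof. by rewrite (additive_sum (@tilde_idD psi)) ps_coef_sum. Qed.

Lemma nabla_hdD psi k : {morph (fun m => nabla_hd nabla psi m k) : m m' / m + m'}.
Proof. by move=> m m'; case: conn => _ nD _ _; rewrite /nabla_hd nD tilde_idD. Qed.
Lemma nabla_hd0 psi m : nabla_hd nabla psi m 0%N = m.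
Proof.
case: conn => _ _ _ n0; rewrite /nabla_hd n0 tilde_id_pure.
by rewrite rmorph1 /GRing.one /= /ps_one /ps_mono scale1r.
Qed.

Lemma nabla_hd1Z psi r m :
  nabla_hd nabla psi (r *: m) 1%N = psi r 1%N *: m + r *: nabla_hd nabla psi m 1%N.
Proof.
case: conn => _ _ nM n0; rewrite /nabla_hd nM conv1 n0.
rewrite tilde_idD ps_coefD scale_pure mulr1 tilde_id_dO addrC; congr (_ + _).
move: (nabla _ m) => t; move: t; apply: tens_ext => [u v|u v|w m'].
- by rewrite scalerDr tilde_idD.
- by rewrite tilde_idD ps_coefD scalerDr.
rewrite scale_pure !tilde_id_pure rmorphM /= tildeE hd_id scalerA; congr (_ *: _).
by rewrite ps_coefM conv1 /ps_mono mulr1n mulr0n mul0r addr0.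
Qed.

Local Notation om_nab := (om_nabla nabla).
Lemma om_nablaD i : {morph om_nab i : u v / u + v}.
Proof. exact: (tens_liftD (om_nabla_bal i conn)). Qed.
Lemma om_nabla_pure i w m :
  om_nab i (pure w m) = conv (fun a b => dOm w a *: nabla b m) i.
Proof. exact: (tens_liftE (om_nabla_bal i conn)). Qed.
Lemma om_nabla1 i m : om_nab i (pure 1 m) = nabla i m.
Proof.
rewrite om_nabla_pure /conv big_ord_recl subn0 rmorph1.
rewrite big1 ?addr0 => [|j _]; first exact: scale1r.
by rewrite -[RHS](scale0r (nabla (i - bump 0 j) m)).
Qed.
End NablaHD.

(** Iterativity gives (k+1) nabla^(k+1) = nabla^(1) nabla^(k) on Omega (x) M, and the extension of
    nabla^(1) to Omega (x) M involves only nabla^(0) and nabla^(1). *)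
Lemma iterative_unique (K : fieldType) (R : comAlgType K) (M : lmodType R)
    (nabla nabla' : nat -> M -> OmegaM M) : [pchar K] =i pred0 ->
  higher_connection nabla -> iterative nabla ->
  higher_connection nabla' -> iterative nabla' ->
  (forall m, nabla 1%N m = nabla' 1%N m) -> forall k m, nabla k m = nabla' k m.
Proof.
move=> charK conn iter conn' iter' E1.
have E0 m : nabla 0%N m = nabla' 0%N m.
  by case: conn => _ _ _ ->; case: conn' => _ _ _ ->.
have Eom t : om_nabla nabla 1 t = om_nabla nabla' 1 t.
  move: t; apply: tens_ext => [u v|u v|w m]; rewrite ?om_nablaD //.
  rewrite !om_nabla_pure //; apply: eq_conv => a [|[|b]]; rewrite ?E0 ?E1 //.
  by rewrite !addnS.
elim=> [|k IH] m; first exact: E0.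
have H : nabla k.+1 m *+ k.+1 = nabla' k.+1 m *+ k.+1.
  have := iter 1%N k (pure 1 m); have := iter' 1%N k (pure 1 m).
  by rewrite !om_nabla1 // Eom IH !add1n !bin1 => -> ->.
have inv : (om_cst (nat_inv R k) : Omega R) * k.+1%:R = 1.
  by rewrite -(rmorph_nat om_cst) -rmorphM mulrC (nat_invP R charK) rmorph1.
rewrite -[LHS]scale1r -[RHS]scale1r -inv -!scalerA !scaler_nat.
by congr (_ *: _).
Qed.

(** * Flatness from integrability *)

Section FlatOfConn.
Variables (K : fieldType) (R : comAlgType K) (n : nat).
Variables (x : 'I_n -> R) (D : 'I_n -> R -> R).
Hypothesis charK : [pchar K] =i pred0.
Hypothesis xD : coordinates x D.

Let D_der i : ring_der (D i). Proof. by case: xD. Qed.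
Let D_K i (a : K) : D i a%:A = 0. Proof. by case: xD. Qed.

Definition flow i : HD K R := hexp charK (D_der i) (D_K i).

Variable M : lmodType R.
Variable nabla : nat -> M -> OmegaM M.

Definition partial_nabla i (m : M) : M := nabla_hd nabla (flow i) m 1%N.
Local Notation nM := partial_nabla.

Hypothesis conn : higher_connection nabla.

(** Write nabla^(1)(m) as a sum of dx_i (x) mu_i and substitute dx_i = sum_j D_j(x_i) dx_j: the new
    coefficients sum_i D_j(x_i) mu_i are the contractions with D_j. *)
Lemma nabla1E m : nabla 1%N m = \sum_i pure (dO 1 (x i)) (nM i m).
Proof.
case: (conn) => hom _ _ _; have [mu E] := OmegaM_homog1 xD (hom 1%N m).
rewrite E /partial_nabla /nabla_hd E.
transitivity (\sum_i \sum_j pure (dO 1 (x j)) (D j (x i) *: mu i) : OmegaM M).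
  apply: eq_bigr => i _; rewrite {1}(dO1_coord xD) pure_suml.
  by apply: eq_bigr => j _; rewrite mulrC pureZ.
rewrite exchange_big; apply: eq_bigr => j _ /=.
rewrite tilde_id_sum pure_sumr; apply: eq_bigr => i _.
by rewrite tilde_id_dO hexp1.
Qed.

Lemma nabla_hd1 psi m : nabla_hd nabla psi m 1%N = \sum_i psi (x i) 1%N *: nM i m.
Proof.
rewrite /nabla_hd nabla1E tilde_id_sum; apply: eq_bigr => i _.
exact: tilde_id_dO.
Qed.

Hypothesis iter : iterative nabla.

(** By iterativity 2 nabla^(2) = nabla^(1) nabla^(1), and nabla^(1) is expanded by [nabla1E]. The
    factor 2 avoids fractions. *)
Lemma nabla_hd2 psi m : nabla_hd nabla psi m 2 *+ 2 =
  \sum_i (psi (x i) 2 *+ 2) *: nM i m +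
  \sum_i \sum_j (psi (x i) 1%N * psi (x j) 1%N) *: nM j (nM i m).
Proof.
have n2 : nabla 2 m *+ 2 = om_nabla nabla 1 (nabla 1%N m).
  by have := iter 1%N 1%N (pure 1 m); rewrite !om_nabla1 // => ->.
rewrite /nabla_hd -ps_coefMn -(additive_muln (@tilde_idD _ _ M psi)) n2 nabla1E.
rewrite (additive_sum (om_nablaD conn 1%N)) tilde_id_sum -big_split.
apply: eq_bigr => i _ /=; rewrite om_nabla_pure // conv1.
rewrite tilde_idD ps_coefD [LHS]addrC dOmE; congr (_ + _).
  case: (conn) => _ _ _ n0.
  rewrite n0 scale_pure mulr1 tilde_id_pure raddfMn ps_coefMn /=.
  by rewrite tildeE /ps_mono eqxx mulr1n.
rewrite nabla1E scaler_sumr tilde_id_sum; apply: eq_bigr => j _.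
rewrite scale_pure tilde_id_pure addn0 bin0 mulr1n rmorphM /= !tildeE ps_monoM.
by rewrite /ps_mono mulr1n.
Qed.

Hypothesis int : integrable nabla.

(** Compare twice the coefficients of T^2 in integrability for exp(T D_i) and exp(T D_j). In terms
    of the sums [A] and [B] below, nabla_i nabla_j is A_ij + B_ij. By [nabla_hd2] the composite
    derivation contributes B_ij + B_ji, symmetric in i and j, while the composite operator
    contributes 2 B_ij. Hence B_ij = B_ji, and the commutator is A_ij - A_ji. *)
Lemma partial_nabla_flat : flat_nabla x D nM.
Proof.
have nMD i : {morph nM i : m m' / m + m'} by apply: nabla_hdD.
have nMZ i a m : nM i (a *: m) = D i a *: m + a *: nM i m.
  by rewrite /partial_nabla nabla_hd1Z // hexp1.
have nMy i m : \sum_j D i (x j) *: nM j m = nM i m.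
  rewrite [RHS]nabla_hd1; apply: eq_bigr => j _.
  by rewrite hexp1.
split=> // i j m.
pose A i j := \sum_k D i (D j (x k)) *: nM k m.
pose B i j := \sum_k \sum_l (D j (x k) * D i (x l)) *: nM l (nM k m).
have nMnM i' j' : nM i' (nM j' m) = A i' j' + B i' j'.
  rewrite -[nM j' m]nMy (additive_sum (nMD i')) -big_split; apply: eq_bigr => k _.
  rewrite nMZ /=; congr (_ + _); rewrite -nMy scaler_sumr.
  by apply: eq_bigr => l _; rewrite scalerA.
suff BC : B i j = B j i.
  rewrite !nMnM BC [RHS]addrAC; congr (_ + _).
  rewrite -big_split; apply: eq_bigr => k _ /=.
  by rewrite -scalerDl addrC subrK.
have Hflow i' : nabla_hd nabla (flow i') m 2 *+ 2 = A i' i' + B i' i'.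
  rewrite nabla_hd2; congr (_ + _); apply: eq_bigr => k _.
    by rewrite hexp2.
  by apply: eq_bigr => l _; rewrite !hexp1.
have f1 i' r : flow i' r 1%N = D i' r by apply: hexp1.
have f2 i' r : flow i' r 2 *+ 2 = D i' (D i' r) by apply: hexp2.
have c1 r : hd_comp (flow i) (flow j) r 1%N = D i r + D j r.
  change (ps_ext (flow i) (flow j r) 1%N = D i r + D j r).
  by rewrite /ps_ext conv1 !hd_id !f1.
have c2 r : hd_comp (flow i) (flow j) r 2 *+ 2 =
    D i (D i r) + D i (D j r) *+ 2 + D j (D j r).
  change (ps_ext (flow i) (flow j r) 2 *+ 2 =
    D i (D i r) + D i (D j r) *+ 2 + D j (D j r)).
  by rewrite /ps_ext conv2 !mulrnDl !hd_id !f1 !f2.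
have := congr1 (fun s : pseries M => s 2 *+ 2) (int (flow i) (flow j) m).
rewrite nabla_hd2.
have -> : ps_ext (nabla_hd nabla (flow i)) (nabla_hd nabla (flow j) m) 2 *+ 2 =
    (A i i + B i i) + (A i j + B i j) *+ 2 + (A j j + B j j).
  rewrite /ps_ext conv2 -(nMnM i j) -!Hflow -!mulrnDl; congr (_ *+ _).
  by congr (_ + _ + _); rewrite nabla_hd0.
have -> : \sum_k (hd_comp (flow i) (flow j) (x k) 2 *+ 2) *: nM k m =
    A i i + A i j *+ 2 + A j j.
  rewrite -sumrMnl -!big_split; apply: eq_bigr => k _ /=.
  by rewrite c2 !scalerDl mulr2n.
have -> : \sum_k \sum_l (hd_comp (flow i) (flow j) (x k) 1%N *
     hd_comp (flow i) (flow j) (x l) 1%N) *: nM l (nM k m) =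
    B i i + B i j + B j i + B j j.
  rewrite -!big_split; apply: eq_bigr => k _.
  rewrite -!big_split; apply: eq_bigr => l _ /=.
  by rewrite !c1 -!scalerDl; congr (_ *: _); ring.
rewrite mulrnDl (mulr2n (B i j)) => H.
(* The added sum is everything the two sides of [H] share; what is left over is B_ij against
   B_ji. *)
apply: (addrI (A i i + A i j *+ 2 + A j j + B i i + B j j + B i j)).
transitivity (A i i + B i i + (A i j *+ 2 + (B i j + B i j)) + (A j j + B j j)).
  by rewrite [RHS](AC ((2*(1*2))*2) (1*3*6*2*7*4*5)).
by rewrite -H [LHS](AC (3*4) (1*2*3*4*7*5*6)).
Qed.
End FlatOfConn.

(** * The two constructions are mutually inverse *)

Section RoundTrips.
Variables (K : fieldType) (R : comAlgType K) (n : nat).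
Variables (x : 'I_n -> R) (D : 'I_n -> R -> R).
Hypothesis charK : [pchar K] =i pred0.
Hypothesis xD : coordinates x D.
Variable M : lmodType R.
Local Notation RR := (RR R).
Local Notation RRR := (RRR R).
Local Notation I := (@diag2 K R).
Local Notation J := (@diag3 K R).

Let D_der i : ring_der (D i). Proof. by case: xD. Qed.
Let D_K i (a : K) : D i a%:A = 0. Proof. by case: xD. Qed.

Lemma eul2_pure (nM : 'I_n -> M -> M) b m : flat_nabla x D nM ->
  (forall i, rr_der (D i) b = 0) ->
  eul2 x D nM (pure b m) = \sum_i xi2 x i *: pure b (nM i m).
Proof.
move=> [nMD nMZ _ _] b0; apply: eq_bigr => i _.
have dder j := rr_der_der (D_der j) (D_K j).
have df j a : rr_der (D j) (rr1 R a) = rr1 R (D j a).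
  exact: (rr_der1 (D_der j) (D_K j)).
by rewrite (nab_pure dder df nMD nMZ) b0 [X in X + _]pureE scale0r add0r.
Qed.

Section ConnStratConn.
Variable nabla : nat -> M -> OmegaM M.
Hypothesis conn : higher_connection nabla.
Hypothesis iter : iterative nabla.
Hypothesis int : integrable nabla.
Local Notation nM := (partial_nabla charK xD nabla).
Local Notation ep := (eps_of x D nM).
Let flat : flat_nabla x D nM := partial_nabla_flat charK xD conn iter int.
Let st : stratification ep := eps_of_strat charK xD flat.

(** By [iterative_unique] only order one matters. There the Taylor series is m - sum_i xi_i nabla_i
    m, and a (x) b |-> a db sends -xi_i to dx_i. *)
Lemma nabla_of_eps_of k m : nabla_of ep k m = nabla k m.
Proof.
apply: (iterative_unique charK) k m => //.
- exact: nabla_of_connection.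
- exact: nabla_of_iterative.
(* [s] expands m - sum_i xi_i nabla_i m with xi_i = x_i (x) 1 - 1 (x) x_i, the factor x_i (x) 1
   being absorbed into the module. *)
move=> m; pose s : seq (R * M) := (1, m) ::
  [seq (1, - (x i *: nM i m)) | i <- index_enum 'I_n] ++
  [seq (x i, nM i m) | i <- index_enum 'I_n].
have sE (V : zmodType) (F : R * M -> V) : \sum_(p <- s) F p =
    F (1, m) + \sum_i (F (1, - (x i *: nM i m)) + F (x i, nM i m)).
  by rewrite /s big_cons big_cat !big_map /= -big_split.
have E : taylor ep 1 m s.
  rewrite /taylor (theta_eps_of charK xD flat) /theta_of /pr2 [pr _ _ _ _ _ _]/=.
  rewrite -pi_n_sum; congr (pi_n _ _).
  have -> : nat_inv R 0 = 1 by have := nat_invP R charK 0; rewrite mul1r.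
  rewrite rmorph1 scale1r -/(eul2 x D nM _) (eul2_pure _ flat); last first.
    by move=> i; rewrite (ring_der1 (rr_der_der (D_der i) (D_K i))).
  rewrite sE rmorph1 -sumrN; congr (_ + _); apply: eq_bigr => i _.
  have pN : {morph (fun m' => pure 1 m' : tens (rr1 R) M) : a / - a}.
    by apply: additive_opp => a b; apply: pureDr.
  rewrite pN /xi2 scalerBl opprB.
  by rewrite -pureE addrC pure_scale.
rewrite (nabla_ofE st (leqnn 1) E) sE (nabla1E charK xD conn).
have d1 : dO 1 1 = 0 :> Omega R by rewrite -[1]scale1r dO_K.
have p0 m' : pure 0 m' = 0 :> OmegaM M by rewrite pureE scale0r.
by rewrite d1 p0 add0r; apply: eq_bigr => i _; rewrite p0 add0r.
Qed.
End ConnStratConn.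

Section StratConnStrat.
Variable eps : forall n, tens (PPr R n) M -> tens (PPl R n) M.
Hypothesis st : stratification eps.
Local Notation nabla := (nabla_of eps).
Local Notation nM := (partial_nabla charK xD nabla).
Let flat : flat_nabla x D nM := partial_nabla_flat charK xD (nabla_of_connection st)
  (nabla_of_iterative st) (nabla_of_integrable st).

(* The cocycle condition is differentiated in the second factor: D_i is the   *)
(* coefficient of T in exp(T D_i), and the third factor is left untouched.    *)
Let al : {rmorphism R -> pseries RR} := ps_cst (rr1 R).
Let ga : {rmorphism R -> pseries RR} := ps_cst (rr2 R).
Let be_fun i (r : R) : pseries RR := fun k => rr1 R (flow charK xD i r k).
Let be_nmod i : nmod_morphism (be_fun i).
Proof.
split=> [|a b]; apply/funext => k; rewrite /be_fun.
  by rewrite rmorph0 rmorph0.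
by rewrite rmorphD rmorphD.
Qed.
Let be_monoid i : monoid_morphism (be_fun i).
Proof.
split=> [|a b]; apply/funext => k; rewrite /be_fun.
  by rewrite rmorph1 /GRing.one /= /ps_one /ps_mono rmorphMn rmorph1.
by rewrite rmorphM ps_coefM /conv rmorph_sum; apply: eq_bigr => j _; rewrite /= rmorphM.
Qed.
HB.instance Definition _ i :=
  GRing.isNmodMorphism.Build R (pseries RR) (be_fun i) (be_nmod i).
HB.instance Definition _ i :=
  GRing.isMonoidMorphism.Build R (pseries RR) (be_fun i) (be_monoid i).

Let ab i (a : K) : al a%:A = be_fun i a%:A.
Proof.
apply/funext => k; rewrite /be_fun hd_alg /= /ps_cst /ps_mono.
by rewrite rmorphMn.
Qed.
Let ac (a : K) : al a%:A = ga a%:A.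
Proof. by rewrite /= /ps_cst (rr_iota R a). Qed.

(** Differentiating once costs one order, so the coefficient of T is allowed order k-1; truncated
    subtraction makes this no condition for k = 0. *)
Let G k : set (pseries RR) :=
  [set a | ideal_pow I k (a 0%N) /\ ideal_pow I k.-1 (a 1%N)].
Let G_pow k : ideal_pow (G 1) k `<=` G k.
Proof.
elim: k => [//|k IH]; apply: ideal_gen_sub =>
  [_ [a [b [[a0 a1] /IH [b0 b1] ->]]]||a b [a0 a1] [b0 b1]|a b [b0 b1]].
- split; rewrite ?ps_coef0M ?ps_coefM ?conv1.
    by rewrite -add1n; apply: ideal_pow_add.
  apply: ideal_powD; last exact: ideal_powM.
  case: k b1 b0 {IH} => [//|k] b1 b0.
  exact: (@ideal_pow_add _ I 1 k).
- by split; apply: ideal_pow0.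
- by split; apply: ideal_powD.
- split; rewrite ?ps_coef0M ?ps_coefM ?conv1; first exact: ideal_powM.
  apply: ideal_powD; first exact: ideal_powM.
  by apply: ideal_powM; apply: ideal_pow_le.
Qed.

Let H3 i := rrr_desc (al := al) (be := be_fun i) (ga := ga) (ab i) ac.

Let H3_pow i k b : ideal_pow J k b -> G k (H3 i b).
Proof.
move=> Jb; apply: G_pow; apply: ideal_pow_map Jb => y Jy; split=> //.
apply: ideal_pow1; suff : rr_mul R (H3 i y 0%N) = rrr_mul R y by rewrite Jy.
move: y {Jy}; apply: rrr_ext => [u v|u v|c1 c2 c3].
- by rewrite !rmorphD.
- by rewrite rmorphD.
rewrite !rmorphM rrr_desc1 rrr_desc2 rrr_desc3 !ps_coef0M !rmorphM.
rewrite rrr_mul1 rrr_mul2 rrr_mul3 /= !ps_cst0 /be_fun hd_id.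
by rewrite !rr_mul1 rr_mul2.
Qed.

(** Differentiate the cocycle condition along D_i in the second factor, multiply by xi_i and sum
    over i: the side with only the first and third factors vanishes, and the other is E of the
    Taylor series. The order must be positive for [s] to determine nabla^(1). *)
Lemma eul2_taylor N m s : (0 < N)%N -> taylor eps N m s ->
  imod (ideal_pow I N.+1) (eul2 x D nM (\sum_(p <- s) pure (rr2 R p.1) p.2)).
Proof.
move=> N0 E; apply: pi_n_ker.
have eD : {morph eul2 x D nM : u v / u + v} := eul2D xD flat.
pose q := quo (ideal_pow I N.+1).
pose h (b : RRR) : PP R N := q (\sum_i xi2 x i * H3 i b 1%N).
have hD : {morph h : u v / u + v}.
  move=> u v; rewrite /h -rmorphD -big_split; congr (q _); apply: eq_bigr => i _.
  by rewrite rmorphD mulrDr.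
have hf b a : h (b * rrr1 R a) = h b * PPl R N a.
  rewrite /h -rmorphM mulr_suml; congr (q _); apply: eq_bigr => i _.
  by rewrite rmorphM rrr_desc1 ps_mul_cst mulrA.
have h0 b : ideal_pow J N.+1 b -> h b = 0.
  move=> Jb; rewrite -(rmorph0 q); apply/quoP/ig_in; rewrite subr0.
  apply: ideal_pow_sum => i _; apply: ideal_powS; first exact: diag2_sub.
  by have [_] := H3_pow i Jb.
have := taylor_eval3 st hD hf h0 E.
rewrite [RHS]big1 => [H|p _]; last first.
  rewrite /h big1 ?rmorph0 => [|i _]; first by rewrite pureE scale0r.
  by rewrite rrr_desc3 /= /ps_cst /ps_mono mulr0n mulr0.
rewrite -[RHS]H (additive_sum eD) (additive_sum (@pi_nD _ _ M N)).
apply: eq_bigr => p _.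
rewrite (eul2_pure _ flat); last by move=> i; apply: (rr_der2 (D_der i) (D_K i)).
transitivity (\sum_i \sum_(t <- tay eps N p.2)
   pi_n N (pure (xi2 x i * (rr1 R (D i t.1) * rr2 R p.1)) t.2)).
  rewrite (additive_sum (@pi_nD _ _ M N)); apply: eq_bigr => i _.
  rewrite /partial_nabla (nabla_hd_ofE st _ N0 (tayP eps N p.2)).
  rewrite pure_sumr scaler_sumr (additive_sum (@pi_nD _ _ M N)).
  apply: eq_bigr => t _; congr (pi_n _ _).
  by rewrite hexp1 -pureZ scale_pure [rr2 R _ * _]mulrC.
rewrite exchange_big; apply: eq_bigr => t _ /=.
rewrite -(additive_sum (@pi_nD _ _ M N)) -pure_suml pi_n_pure; congr pure.
rewrite /h; congr (q _); apply: eq_bigr => i _; congr (_ * _).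
rewrite rmorphM rrr_desc2 rrr_desc3 ps_mul_cst /= /be_fun.
by rewrite [hd _ _ _]hexp1.
Qed.

(** A Taylor series [u] of [m] is killed by E, so [pr2] fixes it up to order N+1. It agrees with m
    on the diagonal, so [pr2] sends the difference of [u] and m to order N+1. Order 0 is separate,
    as [eul2_taylor] needs a positive order. *)
Lemma theta_of_nabla_of N m : theta_of x D nM N m = theta eps N m.
Proof.
case: N => [|N].
  rewrite /theta_of /= pi_n_pure rmorph1 /theta.
  by case: st => _ _ -> _.
pose s := tay eps N.+1 m; have E : taylor eps N.+1 m s := tayP eps N.+1 m.
pose u := \sum_(p <- s) pure (rr2 R p.1) p.2 : tens (rr1 R) M.
have -> : theta eps N.+1 m = pi_n N.+1 u by rewrite pi_n_sum.
apply: pi_n_eq; have := pr2_id charK xD flat N.+1 (eul2_taylor (ltn0Sn N) E).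
rewrite -/u => /imod_powN; rewrite opprB => H1.
have split_pr (P : tens (rr1 R) M -> tens (rr1 R) M) v : {morph P : a b / a - b} ->
    P v - u = - P (u - v) - (u - P u).
  by move=> Psub; rewrite Psub !opprB subrKA.
rewrite (split_pr _ _ (additive_sub (pr2D xD flat N.+1))).
apply: imod_powB => //; apply: imod_powN; apply: pr2_imod1 => //.
apply: pi_n_ker; rewrite (additive_sub (@pi_nD _ _ M 0)) pi_n_sum.
by rewrite -(taylor_leq st (leq0n _) E) (taylor0 st) big_seq1 pi_n_pure !rmorph1 subrr.
Qed.
End StratConnStrat.
End RoundTrips.

(** * The equivalence *)

Section TensMap.
Variables (A B : comPzRingType) (f : {rmorphism A -> B}) (M N : lmodType A) (u : M -> N).
Hypothesis lu : linear u.

Lemma tens_map_pure b m : tens_map f u (pure b m) = pure b (u m).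
Proof. exact: (tens_liftE (tens_map_bal f lu)). Qed.
Lemma tens_mapD : {morph tens_map f u : x y / x + y}.
Proof. exact: (tens_liftD (tens_map_bal f lu)). Qed.
Lemma tens_mapZ b x : tens_map f u (b *: x) = b *: tens_map f u x.
Proof.
move: x; apply: tens_ext => [x y|x y|c m].
- by rewrite scalerDr tens_mapD.
- by rewrite tens_mapD scalerDr.
- by rewrite scale_pure !tens_map_pure scale_pure.
Qed.
End TensMap.

(** * Compatibility with morphisms *)

Section Morphisms.
Variables (K : fieldType) (R : comAlgType K) (n : nat).
Variables (x : 'I_n -> R) (D : 'I_n -> R -> R).
Hypothesis charK : [pchar K] =i pred0.
Hypothesis xD : coordinates x D.
Variables (M N : lmodType R) (f : M -> N).
Hypothesis lf : linear f.

Let D_der i : ring_der (D i). Proof. by case: xD. Qed.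
Let D_K i (a : K) : D i a%:A = 0. Proof. by case: xD. Qed.

Lemma partial_nabla_natural nabla nabla' :
  (forall k m, nabla' k (f m) = tens_map (@om_cst K R) f (nabla k m)) ->
  forall i m,
    partial_nabla charK xD nabla' i (f m) = f (partial_nabla charK xD nabla i m).
Proof.
move=> H i m; rewrite /partial_nabla /nabla_hd H.
have fD := linear_additive lf.
move: (nabla _ m) => t; move: t; apply: tens_ext => [u v|u v|w m'].
- by rewrite (tens_mapD lf) tilde_idD.
- by rewrite tilde_idD ps_coefD fD.
- by rewrite tens_map_pure // !tilde_id_pure (linear_scale lf).
Qed.

(** Everything in [theta_of] is built from scalars and the operators [nM], which [f] intertwines
    with [nN]. *)
Lemma theta_of_natural (nM : 'I_n -> M -> M) (nN : 'I_n -> N -> N) :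
  flat_nabla x D nM -> flat_nabla x D nN ->
  (forall i m, nN i (f m) = f (nM i m)) ->
  forall k m, theta_of x D nN k (f m) = tens_map (PPl R k) f (theta_of x D nM k m).
Proof.
move=> flM flN H k m.
have tD := tens_mapD (f := rr1 R) lf; have tZ := tens_mapZ (f := rr1 R) lf.
have [nMD nMZ _ _] := flM; have [nND nNZ _ _] := flN.
have dder j := rr_der_der (D_der j) (D_K j).
have df j a : rr_der (D j) (rr1 R a) = rr1 R (D j a).
  exact: (rr_der1 (D_der j) (D_K j)).
have eul_nat u : eul2 x D nN (tens_map (rr1 R) f u) = tens_map (rr1 R) f (eul2 x D nM u).
  rewrite /eul2 /eul (additive_sum tD); apply: eq_bigr => i _; rewrite tZ; congr (_ *: _).
  move: u; apply: tens_ext => [u v|u v|b m'].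
  - by rewrite tD (nabD dder df nND nNZ).
  - by rewrite (nabD dder df nMD nMZ) tD.
  rewrite tens_map_pure // (nab_pure dder df nND nNZ) (nab_pure dder df nMD nMZ) tD.
  by rewrite !tens_map_pure // H.
have pr_nat l u :
    pr2 x D nN l (tens_map (rr1 R) f u) = tens_map (rr1 R) f (pr2 x D nM l u).
  rewrite /pr2; elim: l => //= l ->.
  by rewrite (additive_sub tD) tZ -!/(eul2 _ _ _ _) eul_nat.
have pi_nat u : pi_n k (tens_map (rr1 R) f u) = tens_map (PPl R k) f (pi_n k u).
  have lD := tens_mapD (f := PPl R k) lf.
  move: u; apply: tens_ext => [u v|u v|b m'].
  - by rewrite tD pi_nD.
  - by rewrite pi_nD lD.
  by rewrite pi_n_pure !tens_map_pure // pi_n_pure.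
by rewrite /theta_of -pi_nat -pr_nat tens_map_pure.
Qed.

(** Applying [f] to the module entries of an expansion of [m] gives an expansion of [f m]. *)
Lemma nabla_of_natural (eM : forall n, tens (PPr R n) M -> tens (PPl R n) M)
    (eN : forall n, tens (PPr R n) N -> tens (PPl R n) N) :
  stratification eM -> stratification eN ->
  (forall n x, tens_map (PPl R n) f (@eM n x) = @eN n (tens_map (PPr R n) f x)) ->
  forall k m, nabla_of eN k (f m) = tens_map (@om_cst K R) f (nabla_of eM k m).
Proof.
move=> stM stN H k m.
have E : taylor eN k (f m) [seq (p.1, f p.2) | p <- tay eM k m].
  rewrite /taylor /theta -(tens_map_pure (PPr R k) lf) -H.
  have := tayP eM k m; rewrite /taylor /theta => ->.
  rewrite (additive_sum (tens_mapD (f := PPl R k) lf)) big_map; apply: eq_bigr => p _.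
  exact: tens_map_pure.
rewrite (nabla_ofE stN (leqnn k) E) big_map.
rewrite (additive_sum (tens_mapD lf)); apply: eq_bigr => p _.
by rewrite tens_map_pure.
Qed.
End Morphisms.

Section Equivalence.
Variables (K : fieldType) (R : comAlgType K) (n : nat).
Variables (x : 'I_n -> R) (D : 'I_n -> R -> R).
Hypothesis charK : [pchar K] =i pred0.
Hypothesis xD : coordinates x D.

Let flat_of (M : icon R) := partial_nabla_flat charK xD
  (@icon_conn K R M) (@icon_iter K R M) (@icon_int K R M).

Definition strat_of_icon (M : icon R) : strat R :=
  Strat (@icon_fg K R M) (eps_of_strat charK xD (flat_of M)).

Definition icon_of_strat (M : strat R) : icon R :=
  Icon (@strat_fg K R M) (nabla_of_connection (@strat_ax K R M))
    (nabla_of_iterative (@strat_ax K R M)) (nabla_of_integrable (@strat_ax K R M)).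

(** [eps] is linear over P^n, hence determined by its Taylor series. *)
Lemma strat_hom_intro (M N : strat R) (f : M -> N) : linear f ->
  (forall n m, tens_map (PPl R n) f (theta (@strat_eps K R M) n m) =
     theta (@strat_eps K R N) n (f m)) ->
  strat_hom_prop f.
Proof.
move=> lf H; split=> // k.
have linM : forall k, linear (@strat_eps K R M k).
  by case: (@strat_ax K R M) => /all_and2[].
have linN : forall k, linear (@strat_eps K R N k).
  by case: (@strat_ax K R N) => /all_and2[].
apply: tens_ext => [u v|u v|b m].
- by rewrite (linear_additive (linM k)) (tens_mapD lf).
- by rewrite (tens_mapD lf) (linear_additive (linN k)).
by rewrite tens_map_pure // !eps_pure // (tens_mapZ lf) H.
Qed.

Lemma strat_of_icon_hom (M N : icon R) (f : M -> N) : icon_hom_prop f ->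
  @strat_hom_prop K R (strat_of_icon M) (strat_of_icon N) f.
Proof.
move=> [lf H]; apply: strat_hom_intro => // k m.
rewrite /= !(theta_eps_of charK xD (flat_of _)).
apply/esym/(theta_of_natural xD lf (flat_of M) (flat_of N)).
exact: partial_nabla_natural.
Qed.

Lemma icon_of_strat_hom (M N : strat R) (f : M -> N) : strat_hom_prop f ->
  @icon_hom_prop K R (icon_of_strat M) (icon_of_strat N) f.
Proof.
move=> [lf H]; split=> // k m.
by apply: nabla_of_natural => //; apply: strat_ax.
Qed.

Program Definition strat_functor : functor (icon_int_category R) (strat_category R) :=
  @Functor (icon_int_category R) (strat_category R) strat_of_icon
    (fun M N f => exist _ (sval f) (strat_of_icon_hom (svalP f))) _ _.
Next Obligation. exact: eq_exist. Qed.
Next Obligation. exact: eq_exist. Qed.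

Program Definition icon_functor : functor (strat_category R) (icon_int_category R) :=
  @Functor (strat_category R) (icon_int_category R) icon_of_strat
    (fun M N f => exist _ (sval f) (icon_of_strat_hom (svalP f))) _ _.
Next Obligation. exact: eq_exist. Qed.
Next Obligation. exact: eq_exist. Qed.

Lemma icon_round_trip (M : icon R) k (m : M) :
  @icon_nabla K R (icon_of_strat (strat_of_icon M)) k m = icon_nabla k m.
Proof.
exact: (@nabla_of_eps_of K R n x D charK xD M _ (@icon_conn K R M)
  (@icon_iter K R M) (@icon_int K R M) k m).
Qed.

Lemma strat_round_trip (M : strat R) k (m : M) :
  theta (@strat_eps K R (strat_of_icon (icon_of_strat M))) k m =
  theta (@strat_eps K R M) k m.
Proof.
rewrite /= (theta_eps_of charK xD (flat_of (icon_of_strat M))).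
exact: theta_of_nabla_of (@strat_ax K R M) k m.
Qed.

(** The round trip keeps the underlying module, so the identity map serves as the component of the
    natural isomorphism; the content is that it respects the connections. *)
Lemma icon_to (M : icon R) :
  @icon_hom_prop K R (icon_of_strat (strat_of_icon M)) M (fun m : M => m).
Proof. by split=> // k m; rewrite tens_map_id icon_round_trip. Qed.
Lemma icon_from (M : icon R) :
  @icon_hom_prop K R M (icon_of_strat (strat_of_icon M)) (fun m : M => m).
Proof. by split=> // k m; rewrite tens_map_id icon_round_trip. Qed.
Lemma strat_to (M : strat R) :
  @strat_hom_prop K R (strat_of_icon (icon_of_strat M)) M (fun m : M => m).
Proof. by apply: strat_hom_intro => // k m; rewrite tens_map_id strat_round_trip. Qed.
Lemma strat_from (M : strat R) :
  @strat_hom_prop K R M (strat_of_icon (icon_of_strat M)) (fun m : M => m).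
Proof. by apply: strat_hom_intro => // k m; rewrite tens_map_id strat_round_trip. Qed.

Lemma equivalence_of_coordinates :
  equivalent_categories (icon_int_category R) (strat_category R).
Proof.
exists strat_functor, icon_functor; split; split.
- apply: (@NatIso _ _ (comp_functor icon_functor strat_functor) (id_functor _)
    (fun M => exist _ _ (icon_to M)) (fun M => exist _ _ (icon_from M))) => *;
  exact: eq_exist.
- apply: (@NatIso _ _ (comp_functor strat_functor icon_functor) (id_functor _)
    (fun M => exist _ _ (strat_to M)) (fun M => exist _ _ (strat_from M))) => *;
  exact: eq_exist.
Qed.
End Equivalence.

Theorem corollary7p3 (K : fieldType) (R : comAlgType K)
  (charK : [pchar K] =i pred0)
  (domR : GRing.integral_domain_axiom R)
  (regR : regular_ring R)
  (locR : localization_of_fg_algebra R)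
  (pointR : exists m : set R, maximal_ideal m /\ finite_residue_field m)
  (smoothR : smooth R) :
  equivalent_categories (icon_int_category R) (strat_category R).
Proof.
have [n [x [D xD]]] := coordinates_exist locR smoothR.
exact: equivalence_of_coordinates charK xD.
Qed.
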